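(* Let $\Gamma$ be a $C^1$ smooth Jordan curve in the plane. For each $N\in\mathbb{N}$ let $\sigma^N\in\mathcal{K}^N$ be an optimal solution to the optimization problem \[ \max\{\,|W_\sigma| \ :\ L_\sigma(\Gamma)=L(\Gamma),\ \sigma\in\mathcal{K}^N\,\}. \] Then \[ 1\le\lim_{N\to\infty}\Pi_{\sigma^N}(\Gamma)=\inf_{\sigma\in\mathcal{K}}\Pi_\sigma(\Gamma). \]
   Context: Let $\Gamma\subset\mathbb{R}^2$ be a $C^1$ smooth Jordan curve (simple, closed, counterclockwise parameterized by a $C^1$ regular map with periodic boundary conditions), with arc length $s$, total length $L(\Gamma)$, enclosed area $\mathcal{A}(\Gamma)$, and unit tangent vector $(\cos\nu,\sin\nu)^T$, where $\nu$ is the tangent angle. $W^{2,2}_{per}(0,2\pi)$ is the Sobolev space of real-valued $2\pi$-periodic functions with square integrable distributional derivatives up to order $2$. The cone of anisotropy functions is \[ \mathcal{K}=\{\sigma\in W^{2,2}_{per}(0,2\pi)\ :\ \sigma(\nu)\ge0,\ \sigma(\nu)+\sigma''(\nu)\ge0\ \text{for a.e. }\nu\in[0,2\pi]\}, \] and for $N\in\mathbb{N}$, \[ \mathcal{K}^N=\Big\{\sigma\in\mathcal{K}\ :\ \exists(\sigma_0,\dots,\sigma_{N-1})^T\in\mathbb{C}^N,\ \sigma(\nu)=\sum_{k=-N+1}^{N-1}\sigma_ke^{ik\nu}\Big\},\qquad \sigma_{-k}=\bar\sigma_k. \] For $\sigma\in\mathcal{K}$, the interface energy is $L_\sigma(\Gamma)=\int_\Gamma\sigma(\nu)\,ds$,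 the area of the Wulff shape is \[ |W_\sigma|=\frac12\int_0^{2\pi}\big(|\sigma(\nu)|^2-|\sigma'(\nu)|^2\big)\,d\nu, \] and the anisoperimetric ratio is \[ \Pi_\sigma(\Gamma)=\frac{L_\sigma(\Gamma)^2}{4|W_\sigma|\,\mathcal{A}(\Gamma)}, \] where the infimum of $\Pi_\sigma(\Gamma)$ is taken over those $\sigma\in\mathcal{K}$ for which this ratio is defined, i.e. $|W_\sigma|>0$. *)

(* Defs.v *)
From HB Require Import structures.
From mathcomp Require Import all_boot all_order all_algebra.
From mathcomp Require Import all_classical all_reals all_analysis.
From mathcomp Require Import complex.

Set Implicit Arguments.
Unset Strict Implicit.
Unset Printing Implicit Defensive.

Import Order.TTheory GRing.Theory Num.Theory.
Import numFieldNormedType.Exports.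

Local Open Scope classical_set_scope.
Local Open Scope complex_scope.
Local Open Scope ring_scope.

(** * Jordan curves *)

(* The points that are off the curve [t |-> (x t, y t)] and whose connected
   component in the complement of the curve is bounded. *)
Definition enclosed_region (R : realType) (x y : R -> R) : set (R * R) :=
  let compl := ~` range (fun t => (x t, y t)) in
  [set p | compl p /\ bounded_set (connected_component compl p)].

(* The index of a 1-periodic C^1 curve around a point [p] off the curve. *)
Definition winding_number (R : realType) (x y : R -> R) (p : R * R) : R :=
  (2 * pi)^-1 *
  \int[lebesgue_measure]_(t in `[0, 1])
    (((x t - p.1) * derive1 y t - (y t - p.2) * derive1 x t) /
     ((x t - p.1) ^+ 2 + (y t - p.2) ^+ 2)).

Definition speed (R : realType) (x y : R -> R) (t : R) : R :=
  Num.sqrt (derive1 x t ^+ 2 + derive1 y t ^+ 2).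

(* C^1 Jordan curves, given by a regular 1-periodic parameterization.  The
   [tangent_angle] is any choice of an angle of the unit tangent vector: it
   only occurs as the argument of 2 pi-periodic functions. *)
Record jordan_curve (R : realType) := JordanCurve {
  cx : R -> R;
  cy : R -> R;
  tangent_angle : R -> R;
  cx_periodic : periodic cx 1;
  cy_periodic : periodic cy 1;
  cx_derivable : forall t, derivable cx t 1;
  cy_derivable : forall t, derivable cy t 1;
  cx_C1 : continuous (derive1 cx);
  cy_C1 : continuous (derive1 cy);
  curve_regular : forall t, (derive1 cx t, derive1 cy t) != (0, 0);
  curve_simple : {in `[0, 1[ &, injective (fun t => (cx t, cy t))};
  curve_counterclockwise :
    forall p, enclosed_region cx cy p -> winding_number cx cy p = 1;
  tangent_angle_cos : forall t, derive1 cx t / speed cx cy t = cos (tangent_angle t);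
  tangent_angle_sin : forall t, derive1 cy t / speed cx cy t = sin (tangent_angle t)
}.

(* [\int_G f ds], where [ds = speed dt] and [f] is a function of the tangent
   angle. *)
Definition curve_integral (R : realType) (G : jordan_curve R) (f : R -> R) : R :=
  \int[lebesgue_measure]_(t in `[0, 1]) (f (tangent_angle G t) * speed (cx G) (cy G) t).

Definition curve_length (R : realType) (G : jordan_curve R) : R :=
  curve_integral G (fun=> 1).

Definition enclosed_area (R : realType) (G : jordan_curve R) : R :=
  fine ((lebesgue_measure \x lebesgue_measure)%E
          (enclosed_region (cx G) (cy G))).

(** * Periodic Sobolev functions *)

Definition periodic_test_function (R : realType) (phi : R -> R) : Prop :=
  periodic phi (2 * pi) /\ forall n t, derivable (derive1n n phi) t 1.

Definition L2_per (R : realType) (f : R -> R) : Prop :=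
  [/\ periodic f (2 * pi), measurable_fun setT f &
      lebesgue_measure.-integrable `[0, 2 * pi] (EFin \o (fun t => f t ^+ 2))].

(* [g] is a square integrable distributional derivative of order [k] of [f]
   on the circle [R / 2 pi Z]. *)
Definition is_weak_derivative (R : realType) (k : nat) (f g : R -> R) : Prop :=
  L2_per g /\
  forall phi, periodic_test_function phi ->
    \int[lebesgue_measure]_(t in `[0, 2 * pi]) (f t * derive1n k phi t) =
    (-1) ^+ k * \int[lebesgue_measure]_(t in `[0, 2 * pi]) (g t * phi t).

(* A weak derivative is unique up to a null set; this selects one. *)
Definition weak_derivative (R : realType) (k : nat) (f : R -> R) : R -> R :=
  xget (cst 0) [set g | is_weak_derivative k f g].

(* An element of [W^{2,2}_per] is represented by its continuous representative
   (which exists by the Sobolev embedding), so that it has values along a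
   curve whose tangent angle is constant on an arc. *)
Definition W22_per (R : realType) : set (R -> R) :=
  [set f | [/\ continuous f, L2_per f &
     forall k, (k <= 2)%N -> exists g, is_weak_derivative k f g]].

(** * Anisotropy functions *)

Definition anisotropy_cone (R : realType) : set (R -> R) :=
  [set sigma | [/\ W22_per sigma,
    {ae lebesgue_measure, forall v : R,
        v \in `[0, 2 * pi] -> 0 <= sigma v} &
    {ae lebesgue_measure, forall v : R,
        v \in `[0, 2 * pi] -> 0 <= sigma v + weak_derivative 2 sigma v}]].

Definition expi (R : realType) (t : R) : R[i] := cos t +i* sin t.

(* The summation index [k] runs over the integers from [- N + 1] to [N - 1]. *)
Definition anisotropy_cone_trig (R : realType) (N : nat) : set (R -> R) :=
  [set sigma | anisotropy_cone sigma /\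
    exists2 c : int -> R[i], (forall k, c (- k) = conjc (c k)) &
      forall v, (sigma v)%:C =
        \sum_(j < N.*2.-1)
           let k := j%:Z - N.-1%:Z in c k * expi (k%:~R * v)].

Definition interface_energy (R : realType) (sigma : R -> R)
    (G : jordan_curve R) : R := curve_integral G sigma.

Definition wulff_area (R : realType) (sigma : R -> R) : R :=
  2^-1 * \int[lebesgue_measure]_(v in `[0, 2 * pi])
           (`|sigma v| ^+ 2 - `|weak_derivative 1 sigma v| ^+ 2).

Definition anisoperimetric_ratio (R : realType) (sigma : R -> R)
    (G : jordan_curve R) : R :=
  interface_energy sigma G ^+ 2 / (4 * wulff_area sigma * enclosed_area G).

Definition feasible (R : realType) (G : jordan_curve R) (N : nat) :
    set (R -> R) :=
  [set sigma | interface_energy sigma G = curve_length G /\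
               anisotropy_cone_trig N sigma].

Definition optimal (R : realType) (G : jordan_curve R) (N : nat)
    (sigma : R -> R) : Prop :=
  feasible G N sigma /\
  forall tau, feasible G N tau -> wulff_area tau <= wulff_area sigma.

(* Main.v *)
From HB Require Import structures.
Require Import Defs.
From mathcomp Require Import all_boot all_order all_algebra.
From mathcomp Require Import all_classical all_reals all_analysis measurable_realfun.
From mathcomp Require Import complex ring lra zify.

(** All feasible anisotropies have the energy [curve_length G], so that a maximizer
    of the Wulff area among the trigonometric polynomials of degree less than [N]
    minimizes the ratio among them ([optimal_ratio_le]).  The theorem follows from
    two facts: a trigonometric polynomial in the cone approximates the ratio of any
    element of the cone, and the ratio is at least [1].

    Approximation ([cone_approx], [exists_feasible]).  The kernels
    [c_n (1 + cos)^n] are nonnegative trigonometric polynomials of integral [1] that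
    concentrate at [0].  Convolution with such a kernel preserves
    [sigma >= 0] and [sigma + sigma'' >= 0].  It converges pointwise and boundedly
    to [sigma], hence the energies converge, and by Jensen's inequality it does not
    increase the integral of [sigma'^2], hence the Wulff areas are in the limit at
    least that of [sigma].  The weak derivatives in the definitions are chosen
    among many; they are unique almost everywhere because a function that is
    orthogonal to all trigonometric polynomials vanishes almost everywhere
    ([weak_derivative_unique]).

    The ratio is at least [1], that is [4 |W| A <= L^2] ([wulff_inequality]).  By
    approximation [sigma] may be taken smooth with [sigma + sigma'' > 0].  Its Wulff
    shape is then bounded by two graphs.  Following E. Schmidt, the Wulff shape is
    scaled and translated until it has the same range of abscissas as the curve, and
    each point [(x, y)] of the curve is paired with a boundary point [(x, z)] of the
    Wulff shape.  As [sigma] is the support function, [x y' - z x' <= sigma(nu) s'].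
    The integral of this inequality is [a + |W| <= L], where [a] is the integral of
    [x dy], and the inequality of arithmetic and geometric means undoes the scaling
    ([wulff_C2]).

    It remains to see that the Lebesgue measure of the enclosed region is the
    integral of [x dy] and is positive.  The index of the curve is locally constant
    off the curve and vanishes far away, so that the enclosed region is the open set
    of the points of nonzero index ([enclosedP]).  It is not empty, because the index
    differs by [1] between two points on either side of the curve ([winding_jump]).
    For its measure, the integral of the index along a vertical line is computed by
    exchanging it with the integral along the curve ([slice_formula]); the exchange
    is legitimate for almost every line, because the index form at [p] is
    dominated by [|x - p_1|^(-1/2) |y - p_2|^(-1/2)].  A second integration over the
    abscissa of the line gives the area ([area_formula]). *)

Set Implicit Arguments.
Unset Strict Implicit.
Unset Printing Implicit Defensive.

Import Order.TTheory GRing.Theory Num.Theory.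
Import numFieldNormedType.Exports.

Local Open Scope classical_set_scope.
Local Open Scope ring_scope.

(** * Integrals over segments *)

Section Base.
Context {R : realType}.
Notation mu := (@lebesgue_measure R).
Implicit Types (f g F : R -> R) (a b c : R).

Lemma is_derive_continuous F (t df : R) : is_derive t 1 F df -> {for t, continuous F}.
Proof.
by move=> dF; apply/differentiable_continuous/derivable1_diffP; apply: ex_derive.
Qed.

Lemma integrable_within a b f : {within `[a, b], continuous f} ->
  mu.-integrable `[a, b] (EFin \o f).
Proof.
by move=> cf; apply: continuous_compact_integrable => //; exact: segment_compact.
Qed.

Lemma integrable_continuous a b f : continuous f ->
  mu.-integrable `[a, b] (EFin \o f).
Proof. by move=> cf; apply/integrable_within/continuous_subspaceT. Qed.

Lemma Rintegral_FTC a b F f : a <= b ->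
  (forall t, a <= t <= b -> is_derive t 1 F (f t)) ->
  {within `[a, b], continuous f} ->
  \int[mu]_(t in `[a, b]) f t = F b - F a.
Proof.
rewrite le_eqVlt => /predU1P[<- _ _|ab dF cf].
  by rewrite set_itv1 Rintegral_set1 subrr.
rewrite /Rintegral (@continuous_FTC2 _ f F a b)//=.
- split.
  + move=> t; rewrite in_itv/= => /andP[at_ tb].
    by apply: ex_derive; apply: dF; rewrite !ltW.
  + apply: cvg_at_right_filter; apply: is_derive_continuous (dF _ _).
    by rewrite lexx ltW.
  + apply: cvg_at_left_filter; apply: is_derive_continuous (dF _ _).
    by rewrite lexx ltW.
- move=> t; rewrite in_itv/= => /andP[at_ tb]; rewrite derive1E.
  by apply: derive_val; apply: dF; rewrite !ltW.
Qed.

Lemma Rintegral_split c a b f : a <= c <= b ->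
  mu.-integrable `[a, b] (EFin \o f) ->
  \int[mu]_(t in `[a, b]) f t =
  \int[mu]_(t in `[a, c]) f t + \int[mu]_(t in `[c, b]) f t.
Proof.
move=> /andP[ac cb] fi.
have := Rintegral_itvB fi (x := c); rewrite !bnd_simp => /(_ ac cb) => e.
rewrite -[X in _ = _ + X](Rintegral_itv_obnd_cbnd (r := c)).
  by rewrite -e addrC subrK.
apply: integrableS fi => //.
by apply: subset_itvr; rewrite bnd_simp.
Qed.

Lemma integrable_itvZ a b (k : R) f : mu.-integrable `[a, b] (EFin \o f) ->
  mu.-integrable `[a, b] (EFin \o (fun t => k * f t)).
Proof.
move=> fi; have := @integrableZl _ _ _ mu `[a, b]%classic (measurable_itv `[a, b]) k _ fi.
by apply: eq_integrable => // t _; rewrite /= EFinM.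
Qed.

Lemma integrable_itvD a b f g : mu.-integrable `[a, b] (EFin \o f) ->
  mu.-integrable `[a, b] (EFin \o g) ->
  mu.-integrable `[a, b] (EFin \o (fun t => f t + g t)).
Proof.
move=> fi gi; have := @integrableD _ _ _ mu `[a, b]%classic (measurable_itv `[a, b]) _ _ fi gi.
by apply: eq_integrable => // t _; rewrite /= EFinD.
Qed.

Lemma integrable_itvM a b M f g : mu.-integrable `[a, b] (EFin \o f) ->
  measurable_fun `[a, b] g -> (forall t, a <= t <= b -> `|g t| <= M) ->
  mu.-integrable `[a, b] (EFin \o (fun t => f t * g t)).
Proof.
move=> fi mg gM; have Mf := integrable_itvZ M fi.
apply: (@le_integrable _ _ _ mu `[a, b]%classic (measurable_itv `[a, b]) _ _ _ _ Mf).
  apply/measurable_EFinP; apply: measurable_funM => //.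
  by have /integrableP[/measurable_EFinP] := fi.
move=> t; rewrite /= in_itv/= => tab.
rewrite lee_fin normrM [leRHS]normrM mulrC ler_wpM2r//.
by rewrite (le_trans (gM _ tab))// ler_norm.
Qed.

Lemma Rintegral_dominated_cvg a b (f_ : nat -> R -> R) f g :
  (forall n, measurable_fun `[a, b] (f_ n)) -> measurable_fun `[a, b] f ->
  {ae mu, forall t, a <= t <= b -> f_ ^~ t @ \oo --> f t} ->
  mu.-integrable `[a, b] (EFin \o g) ->
  (forall n t, a <= t <= b -> `|f_ n t| <= g t) ->
  (fun n => \int[mu]_(t in `[a, b]) f_ n t) @ \oo --> \int[mu]_(t in `[a, b]) f t.
Proof.
move=> mf mlim ff ig fM.
have mab : measurable (`[a, b]%classic : set R) by exact: measurable_itv.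
have := @dominated_convergence _ _ _ mu `[a, b] mab (fun n => EFin \o f_ n)
  (EFin \o f) (EFin \o g).
case.
- by move=> n; apply/measurable_EFinP; exact: mf.
- by apply/measurable_EFinP; exact: mlim.
- apply: filterS ff; first exact: (ae_filter_ringOfSetsType mu).
  move=> t h; rewrite /= in_itv/= => tab.
  by apply: cvg_EFin; [exact: nearW | exact: h].
- exact: ig.
- apply: aeW => t n; rewrite /= in_itv/= => tab.
  by rewrite lee_fin; exact: fM.
move=> fi _ cv.
apply: fine_cvg; rewrite /Rintegral fineK//.
exact: integrable_fin_num.
Qed.

Lemma Rintegral_bounded_cvg a b M (f_ : nat -> R -> R) f :
  (forall n, measurable_fun `[a, b] (f_ n)) ->
  (forall t, a <= t <= b -> f_ ^~ t @ \oo --> f t) ->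
  (forall n t, a <= t <= b -> `|f_ n t| <= M) ->
  (fun n => \int[mu]_(t in `[a, b]) f_ n t) @ \oo --> \int[mu]_(t in `[a, b]) f t.
Proof.
move=> mf ff fM; apply: (Rintegral_dominated_cvg (g := cst M)) => //.
- apply: (measurable_fun_cvg mf) => t; rewrite /= in_itv/=; exact: ff.
- exact: aeW.
- by apply: integrable_continuous => t; exact: cvg_cst.
Qed.

Lemma ae_neq c : {ae mu, forall t : R, t <> c}.
Proof.
exists [set c]; split; [exact: measurable_set1|exact: lebesgue_measure_set1|].
by move=> t /= /contrapT ->.
Qed.

Lemma Rintegral_integrable_le (a b : R) (f g : R -> R) :
  mu.-integrable `[a, b] (EFin \o f) -> mu.-integrable `[a, b] (EFin \o g) ->
  (forall t, a <= t <= b -> f t <= g t) ->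
  \int[mu]_(t in `[a, b]) f t <= \int[mu]_(t in `[a, b]) g t.
Proof.
by move=> fi gi fg; apply: le_Rintegral => // t; rewrite /= in_itv/=; exact: fg.
Qed.

Lemma integrable_subitv (a b c d : R) (f : R -> R) : a <= c -> d <= b ->
  mu.-integrable `[a, b] (EFin \o f) -> mu.-integrable `[c, d] (EFin \o f).
Proof.
move=> ac db; apply: integrableS => // t; rewrite /= !in_itv/= => /andP[ct td].
by rewrite (le_trans ac ct) (le_trans td db).
Qed.

Lemma Rintegral_ae_eq (a b : R) f g : measurable_fun `[a, b] f -> measurable_fun `[a, b] g ->
  {ae mu, forall t : R, a <= t <= b -> f t = g t} ->
  \int[mu]_(t in `[a, b]) f t = \int[mu]_(t in `[a, b]) g t.
Proof.
move=> mf mg fg; congr fine; apply: ae_eq_integral => //.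
- exact/measurable_EFinP.
- exact/measurable_EFinP.
- apply: filterS fg; first exact: (ae_filter_ringOfSetsType mu).
  by move=> t h; rewrite /= in_itv/= => /h ->.
Qed.

Lemma Rintegral_ae_ge0 (a b : R) f : mu.-integrable `[a, b] (EFin \o f) ->
  {ae mu, forall t : R, a <= t <= b -> 0 <= f t} ->
  0 <= \int[mu]_(t in `[a, b]) f t.
Proof.
move=> fi f0; have mf : measurable_fun `[a, b] f.
  by have /integrableP[/measurable_EFinP] := fi.
rewrite (@Rintegral_ae_eq _ _ _ (fun t => `|f t|)) => //.
- by apply: Rintegral_ge0.
- by apply: measurableT_comp.
- apply: filterS f0; first exact: (ae_filter_ringOfSetsType mu).
  by move=> t h tI; rewrite ger0_norm// h.
Qed.

Lemma integral_EFin (a b : R) (f : R -> R) : mu.-integrable `[a, b] (EFin \o f) ->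
  (\int[mu]_(t in `[a, b]) (f t)%:E = (\int[mu]_(t in `[a, b]) f t)%R%:E)%E.
Proof. by move=> fi; rewrite /Rintegral fineK//; exact: integrable_fin_num fi. Qed.

Lemma Rintegral_one (a b : R) : a <= b -> \int[mu]_(t in `[a, b]) (1 : R) = b - a.
Proof.
move=> ab; rewrite Rintegral_cst//= lebesgue_measure_itv/= lte_fin mul1r.
move: ab; rewrite le_eqVlt => /predU1P[->|ab]; first by rewrite ltxx subrr.
by rewrite ab -EFinD.
Qed.

End Base.

(** * Derivatives, primitives and periodic functions *)

Section Calculus.
Context {R : realType}.
Notation mu := (@lebesgue_measure R).
Implicit Types (f g F G : R -> R) (a b c t x : R).

Lemma is_derive_within a b F f :
  (forall t, a <= t <= b -> is_derive t 1 F (f t)) -> {within `[a, b], continuous F}.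
Proof.
move=> dF; apply: continuous_in_subspaceT => t; rewrite inE/= in_itv/= => tab.
by apply: is_derive_continuous (dF t tab).
Qed.

Lemma ge0_derive_le a b F f : a <= b ->
  (forall t, a <= t <= b -> is_derive t 1 F (f t)) ->
  (forall t, a <= t <= b -> 0 <= f t) -> F a <= F b.
Proof.
move=> ab dF f0; have := MVT_segment ab (f := F) (df := f); case.
- by move=> t; rewrite in_itv/= => /andP[at_ tb]; apply: dF; rewrite !ltW.
- exact: is_derive_within dF.
- move=> c; rewrite in_itv/= => cab; rewrite -subr_ge0 => ->.
  by rewrite mulr_ge0 ?f0 ?subr_ge0.
Qed.

Lemma gt0_derive_lt a b F f : a < b ->
  (forall t, a <= t <= b -> is_derive t 1 F (f t)) ->
  (forall t, a < t < b -> 0 < f t) -> F a < F b.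
Proof.
move=> ab dF f0; have := MVT ab (f := F) (df := f); case.
- by move=> t; rewrite in_itv/= => /andP[at_ tb]; apply: dF; rewrite !ltW.
- exact: is_derive_within dF.
- move=> c; rewrite in_itv/= => cab; rewrite -subr_gt0 => ->.
  by rewrite mulr_gt0 ?f0 ?subr_gt0.
Qed.

Lemma derive_eq_diff a b F G f : a <= b ->
  (forall t, a <= t <= b -> is_derive t 1 F (f t)) ->
  (forall t, a <= t <= b -> is_derive t 1 G (f t)) -> F b - F a = G b - G a.
Proof.
move=> ab dF dG.
have dH t : a <= t <= b -> is_derive t 1 (F - G) (cst 0 t).
  move=> tab; have := dF _ tab; have := dG _ tab => ? ?.
  by apply: is_derive_eq; rewrite subrr.
have := MVT_segment ab (f := F - G) (df := cst 0); case.
- by move=> t; rewrite in_itv/= => /andP[at_ tb]; apply: dH; rewrite !ltW.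
- exact: is_derive_within dH.
- by move=> c _; rewrite !fctE mul0r => e; lra.
Qed.

Lemma primitive_exists f a : continuous f ->
  exists F, forall t, a < t -> is_derive t 1 F (f t).
Proof.
move=> cf; exists (fun x => \int[mu]_(t in `[a, x]) f t) => t at_.
have t1 : t < t + 1 by rewrite ltrDl.
have [d e] := continuous_FTC1_closed t1 (@integrable_continuous R a (t + 1) f cf) at_ (cf t).
split; first exact: d.
by rewrite -e derive1E.
Qed.

(** Composing with [clamp a b] extends a function that is continuous within
    [[a, b]] to a continuous function on the line, to which the existence of
    primitives applies. *)
Definition clamp a b x : R := Num.min b (Num.max a x).

Lemma clamp_id a b x : a <= x <= b -> clamp a b x = x.
Proof. by move=> /andP[ax xb]; rewrite /clamp (max_r ax) (min_r xb). Qed.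

Lemma clamp_in a b x : a <= b -> a <= clamp a b x <= b.
Proof. by move=> ab; rewrite /clamp le_min ab le_max lexx/= ge_min lexx. Qed.

Lemma continuous_clamp a b : continuous (clamp a b).
Proof.
have h x : {for x, continuous (cst b \min (cst a \max id) : R -> R^o)}.
  apply: continuous_min; first exact: cst_continuous.
  by apply: continuous_max; [exact: cst_continuous|exact: cvg_id].
exact: h.
Qed.

Lemma continuous_comp_clamp a b f : a <= b -> {within `[a, b], continuous f} ->
  continuous (f \o clamp a b).
Proof.
move=> ab /subspace_continuousP cf x.
have xab : `[a, b]%classic (clamp a b x) by rewrite /= in_itv/= clamp_in.
have h : clamp a b y @[y --> x] --> within `[a, b] (nbhs (clamp a b x)).
  move=> A hA.
  have hA' : \forall y \near x, `[a, b]%classic (clamp a b y) -> A (clamp a b y).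
    exact: (@continuous_clamp a b x _ hA).
  suff : \forall y \near x, A (clamp a b y) by [].
  by apply: filterS hA' => y; apply; rewrite /= in_itv/=; exact: clamp_in.
exact: (cvg_comp _ _ h (cf _ xab)).
Qed.

Lemma periodicz f T : periodic f T -> forall (k : int) t, f (t + T *~ k) = f t.
Proof.
move=> pf [n|n] t; first by rewrite -pmulrn periodicn.
by rewrite NegzE mulrNz -(periodicn pf n.+1 (t - _)) -pmulrn subrK.
Qed.

Lemma reduce_mod2pi (x y : R) : exists k : int, `|x + (2 * pi) *~ k - y| <= pi.
Proof.
have pi0 := pi_gt0 R; have tp : 0 < 2 * pi :> R by rewrite mulr_gt0.
pose k := Num.floor ((y - x + pi) / (2 * pi)).
exists k.
have /andP[] := floor_itv ((y - x + pi) / (2 * pi)).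
rewrite -/k ler_pdivlMr// ltr_pdivrMr// intrD mulrDl mul1r => h1 h2.
rewrite -[X in _ + X - _]mulrzl ler_norml; apply/andP; split; lra.
Qed.

Lemma int_FTC_global (a b : R) F f : a <= b -> continuous f ->
  (forall t, a <= t <= b -> is_derive t 1 F (f t)) ->
  \int[mu]_(t in `[a, b]) f t = F b - F a.
Proof. by move=> ab cf dF; apply: Rintegral_FTC => //; apply: continuous_subspaceT. Qed.

Lemma continuous_bounded_itv (a b : R) f : continuous f ->
  exists M, forall t : R, a <= t <= b -> `|f t| <= M.
Proof.
move=> cf; have [ab|ba] := leP a b; last first.
  by exists 0 => t /andP[at_ tb]; have := le_trans at_ tb; rewrite leNgt ba.
have cn : {within `[a, b], continuous (fun t => `|f t|)}.
  by apply: continuous_subspaceT => t; apply: continuous_comp; [exact: cf|exact: norm_continuous].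
have [c _ hc] := EVT_max ab cn.
by exists `|f c| => t tab; apply: hc; rewrite in_itv.
Qed.

End Calculus.

(** * The boundary of the Wulff shape *)

Section Support.
Context {R : realType}.
Notation mu := (@lebesgue_measure R).
Implicit Types s : R -> R.

(** [(supX, supZ)] is the boundary point of the Wulff shape at which the tangent
    angle is [v]: the support function in the direction of the outer normal
    [(sin v, - cos v)] is [s v], and the derivative of the point is
    [(s v + s'' v) (cos v, sin v)]. *)
Definition supX s (s1 : R -> R) (v : R) : R := s v * sin v + s1 v * cos v.
Definition supZ s (s1 : R -> R) (v : R) : R := s1 v * sin v - s v * cos v.

Lemma sin_periodic : periodic (@sin R) (2 * pi).
Proof. by move=> x; rewrite mulr_natl sinD2pi. Qed.

Lemma cos_periodic : periodic (@cos R) (2 * pi).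
Proof. by move=> x; rewrite mulr_natl cosD2pi. Qed.

Lemma is_derive_supX s (s1 s2 : R -> R) (v : R) : is_derive v 1 s (s1 v) -> is_derive v 1 s1 (s2 v) ->
  is_derive v 1 (supX s s1) ((s v + s2 v) * cos v).
Proof. by move=> ? ?; apply: is_derive_eq; rewrite /GRing.scale/=; ring. Qed.

Lemma is_derive_supZ s (s1 s2 : R -> R) (v : R) : is_derive v 1 s (s1 v) -> is_derive v 1 s1 (s2 v) ->
  is_derive v 1 (supZ s s1) ((s v + s2 v) * sin v).
Proof. by move=> ? ?; apply: is_derive_eq; rewrite /GRing.scale/=; ring. Qed.

(** The boundary point with tangent angle [m] lies in each supporting half plane.
    Its height [D m] in the direction of the normal at [v] is monotone as [m]
    moves towards [v] over at most a half turn, because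
    [D' t = (s t + s'' t) sin (v - t)], and [D v = s v]. *)
Lemma support_ineq s (s1 s2 : R -> R) :
  (forall v : R, is_derive v 1 s (s1 v)) -> (forall v : R, is_derive v 1 s1 (s2 v)) ->
  periodic s (2 * pi) -> (forall v, 0 <= s v + s2 v) ->
  forall m v, supX s s1 m * sin v - supZ s s1 m * cos v <= s v.
Proof.
move=> ds ds1 ps rho0 m v.
have [k] := reduce_mod2pi v m.
rewrite -(periodicz ps k) -(periodicz sin_periodic k v) -(periodicz cos_periodic k v).
move: (v + _) => {k}v; rewrite ler_norml => /andP[h1 h2].
pose D t := s t * cos (v - t) + s1 t * sin (v - t).
have dD (t : R) : is_derive t 1 D ((s t + s2 t) * sin (v - t)).
  have := ds t; have := ds1 t => ? ?.
  by apply: is_derive_eq; rewrite /GRing.scale/=; ring.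
have -> : supX s s1 m * sin v - supZ s s1 m * cos v = D m.
  by rewrite /D/supX/supZ sinB cosB; ring.
have -> : s v = D v by rewrite /D subrr sin0 cos0; ring.
have [mv|vm] := lerP m v.
  apply: (ge0_derive_le mv) => // t /andP[mt tv].
  by apply: mulr_ge0 => //; apply: sin_ge0_pi; apply/andP; split; lra.
rewrite -subr_ge0.
pose E (t : R) := - D t.
have -> : D v - D m = E m - E v by rewrite /E; ring.
rewrite subr_ge0.
apply: (@ge0_derive_le _ _ _ E (fun t => - ((s t + s2 t) * sin (v - t))) (ltW vm)).
move=> t /andP[vt tm]; rewrite -mulrN -sinN opprB.
by apply: mulr_ge0 => //; apply: sin_ge0_pi; apply/andP; split; lra.
Qed.

(** On [[- pi / 2, pi / 2]] the abscissa [supX] increases strictly, so that this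
    lower half of the boundary is the graph of a continuous function [l].  The
    last clause computes the area under the graph with the help of
    [Z dX = - s (s + s'') / 2 + d (X Z) / 2], where the left side is the
    derivative of [L \o supX]. *)
Lemma arc_graph s (s1 s2 S : R -> R) :
  (forall v : R, is_derive v 1 s (s1 v)) -> (forall v : R, is_derive v 1 s1 (s2 v)) ->
  (forall v, 0 < s v + s2 v) ->
  (forall v : R, - (pi / 2) <= v <= pi / 2 -> is_derive v 1 S (s v * (s v + s2 v))) ->
  exists l L : R -> R, [/\ continuous l,
    forall x, supX s s1 (- (pi / 2)) <= x -> is_derive x 1 L (l x),
    forall x, supX s s1 (- (pi / 2)) <= x <= supX s s1 (pi / 2) ->
      exists m, x = supX s s1 m /\ l x = supZ s s1 m &
    L (supX s s1 (pi / 2)) - L (supX s s1 (- (pi / 2))) =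
      - (2^-1 * (S (pi / 2) - S (- (pi / 2)))) +
      2^-1 * (supX s s1 (pi / 2) * supZ s s1 (pi / 2) -
              supX s s1 (- (pi / 2)) * supZ s s1 (- (pi / 2)))].
Proof.
move=> ds ds1 rho0 dS.
set X := supX s s1; set Z := supZ s s1.
have pi0 := pi_gt0 R.
set a := - (pi / 2); set b := pi / 2.
have ab : a < b by rewrite /a /b; lra.
have dX (v : R) : is_derive v 1 X ((s v + s2 v) * cos v) by exact: is_derive_supX.
have dZ (v : R) : is_derive v 1 Z ((s v + s2 v) * sin v) by exact: is_derive_supZ.
have cosp v : a < v < b -> 0 < cos v by move=> h; apply: cos_gt0_pihalf.
have Xlt u v : a <= u -> u < v -> v <= b -> X u < X v.
  move=> au uv vb; apply: (gt0_derive_lt uv) => // t /andP[ut tv].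
  by apply: mulr_gt0 => //; apply: cosp; rewrite (le_lt_trans au ut) (lt_le_trans tv vb).
have Xab : X a < X b by apply: Xlt.
have Xitv v : a <= v <= b -> X a <= X v <= X b.
  move=> /andP[].
  rewrite le_eqVlt => /predU1P[<-|av]; first by rewrite lexx (ltW Xab).
  rewrite le_eqVlt => /predU1P[->|vb]; first by rewrite lexx (ltW Xab).
  by rewrite (ltW (Xlt _ _ (lexx _) av (ltW vb))) (ltW (Xlt _ _ (ltW av) vb (lexx _))).
have cX : {within `[a, b], continuous X}.
  by apply: (@is_derive_within _ _ _ _ (fun v => (s v + s2 v) * cos v)) => t _.
have Xinj : {in `[a, b] &, injective X}.
  move=> u v; rewrite !in_itv/= => /andP[au ub] /andP[av vb] e.
  have [uv|vu|//] := ltgtP u v.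
    by have := Xlt _ _ au uv vb; rewrite e ltxx.
  by have := Xlt _ _ av vu ub; rewrite e ltxx.
have Xsurj x : X a <= x <= X b -> exists2 v, v \in `[a, b] & X v = x.
  move=> xab; apply: (IVT (ltW ab) cX).
  by rewrite (min_l (ltW Xab)) (max_r (ltW Xab)).
pose m x := xget 0 [set v | v \in `[a, b] /\ X v = x].
have mP x : X a <= x <= X b -> m x \in `[a, b] /\ X (m x) = x.
  move=> /Xsurj[v vab e]; rewrite /m; case: xgetP => [y _ [? ?]//|/(_ v)].
  by case; split.
have mK : {in `[a, b], cancel X m}.
  move=> v vab.
  have Xv : X a <= X v <= X b by apply: Xitv; move: vab; rewrite in_itv.
  by have [h1 h2] := mP _ Xv; apply: Xinj.
have cm := segment_can_le_continuous (ltW ab) cX mK.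
pose mm := m \o clamp (X a) (X b).
have cmm : continuous mm by exact: continuous_comp_clamp (ltW Xab) cm.
have cZ : continuous Z by move=> t; apply: is_derive_continuous (dZ t).
pose l := Z \o mm.
have cl : continuous l by move=> x; apply: continuous_comp; [exact: cmm|exact: cZ].
have [L dL] := primitive_exists (X a - 1) cl.
exists l, L; split => //.
- by move=> x ax; apply: dL; lra.
- move=> x xab; exists (m x); rewrite /l /mm /= clamp_id//.
  by have [] := mP _ xab.
pose Q (v : R) := - (2^-1 * S v) + 2^-1 * (X v * Z v).
have e : L (X b) - L (X a) = Q b - Q a; last by rewrite e /Q; ring.
apply: (@derive_eq_diff _ _ _ (L \o X) Q (fun v => Z v * ((s v + s2 v) * cos v)) (ltW ab)).
- move=> v vab.
  have Xv := Xitv _ vab.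
  have dLX : is_derive (X v) 1 L (l (X v)).
    by case/andP: Xv => Xv _; apply: dL; lra.
  have := dX v => ?.
  apply: is_derive_eq; rewrite /l/mm/= clamp_id// mK//.
- move=> v vab; have := dS _ vab; have := dX v; have := dZ v => ? ? ?.
  apply: is_derive_eq; rewrite /GRing.scale/= /X /Z /supX /supZ.
  have -> : s v * (s v + s2 v) = s v * (s v + s2 v) * (cos v ^+ 2 + sin v ^+ 2).
    by rewrite cos2Dsin2 mulr1.
  by field.
Qed.

End Support.

(** * The Wulff inequality for smooth anisotropies *)

Section Wulff.
Context {R : realType}.
Notation mu := (@lebesgue_measure R).

Section Curve.
Variables (x y x1 y1 g : R -> R).
Hypothesis dx : forall t : R, is_derive t 1 x (x1 t).
Hypothesis dy : forall t : R, is_derive t 1 y (y1 t).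
Hypothesis cx1 : continuous x1.
Hypothesis cy1 : continuous y1.
Hypothesis ig : mu.-integrable `[0, 1] (EFin \o g).

Let cx : continuous x. Proof. by move=> t; apply: is_derive_continuous (dx t). Qed.

Lemma continuous_xy1 : continuous (fun t => x t * y1 t).
Proof. by move=> t; apply: cvgM; [exact: cx|exact: cy1]. Qed.

(** The integral of [l (x t) * x1 t] over an arc is the increment of a primitive
    of [l], whatever the horizontal motion of the arc. *)
Lemma arc_estimate (l L : R -> R) (p q : R) : 0 <= p -> p <= q -> q <= 1 ->
  continuous l ->
  (forall t, 0 <= t <= 1 -> is_derive (x t) 1 L (l (x t))) ->
  (forall t, 0 <= t <= 1 -> x t * y1 t - l (x t) * x1 t <= g t) ->
  \int[mu]_(t in `[p, q]) (x t * y1 t) - (L (x q) - L (x p)) <=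
  \int[mu]_(t in `[p, q]) g t.
Proof.
move=> p0 pq q1 cl dL lg.
have clx : continuous (fun t => l (x t) * x1 t).
  move=> t; apply: cvgM; last exact: cx1.
  by apply: continuous_comp; [exact: cx|exact: cl].
have -> : L (x q) - L (x p) = \int[mu]_(t in `[p, q]) (l (x t) * x1 t).
  symmetry; apply: (@int_FTC_global _ _ _ (L \o x) _ pq clx) => t /andP[pt tq].
  have h : is_derive (x t) 1 L (l (x t)) by apply: dL; rewrite (le_trans p0 pt) (le_trans tq q1).
  by have := dx t => ?; apply: is_derive_eq; rewrite mulrC.
rewrite -RintegralB//; [|exact: integrable_continuous continuous_xy1|exact: integrable_continuous].
apply: Rintegral_integrable_le.
- apply: integrable_continuous => t; apply: cvgB; [exact: continuous_xy1|exact: clx].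
- exact: integrable_subitv ig.
- by move=> t /andP[pt tq]; apply: lg; rewrite (le_trans p0 pt) (le_trans tq q1).
Qed.

(** The curve is compared with the graph of [l] on [[p, q]] and with the graph of
    [u] on the rest.  When [x p] and [x q] are the two ends of the Wulff shape,
    the increments of the primitives add up to the area between the graphs. *)
Lemma two_graphs (l L u U : R -> R) (p q : R) : 0 <= p -> p <= q -> q <= 1 ->
  x 0 = x 1 ->
  continuous l -> continuous u ->
  (forall t, 0 <= t <= 1 -> is_derive (x t) 1 L (l (x t))) ->
  (forall t, 0 <= t <= 1 -> is_derive (x t) 1 U (u (x t))) ->
  (forall t, 0 <= t <= 1 -> x t * y1 t - l (x t) * x1 t <= g t) ->
  (forall t, 0 <= t <= 1 -> x t * y1 t - u (x t) * x1 t <= g t) ->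
  \int[mu]_(t in `[0, 1]) (x t * y1 t) +
    ((U (x q) - L (x q)) - (U (x p) - L (x p))) <=
  \int[mu]_(t in `[0, 1]) g t.
Proof.
move=> p0 pq q1 x01 cl cu dL dU lg ug.
have q0 := le_trans p0 pq; have p1 := le_trans pq q1.
have i01 := @integrable_continuous R 0 1 _ continuous_xy1.
have ip1 := @integrable_continuous R p 1 _ continuous_xy1.
rewrite (Rintegral_split (c := p) _ i01) ?p0// (Rintegral_split (c := q) _ ip1) ?pq//.
rewrite (Rintegral_split (c := p) _ ig) ?p0// (@Rintegral_split _ q p 1 g) ?pq//; last exact: integrable_subitv ig.
have h1 := arc_estimate (lexx 0) p0 p1 cu dU ug.
have h2 := arc_estimate p0 pq q1 cl dL lg.
have h3 := arc_estimate q0 q1 (lexx 1) cu dU ug.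
rewrite x01 in h1; lra.
Qed.

End Curve.

Section WulffC2.
Variables (x y x1 y1 nu sp : R -> R).
Hypothesis dx : forall t : R, is_derive t 1 x (x1 t).
Hypothesis dy : forall t : R, is_derive t 1 y (y1 t).
Hypothesis cx1 : continuous x1.
Hypothesis cy1 : continuous y1.
Hypothesis x01 : x 0 = x 1.
Hypothesis y01 : y 0 = y 1.
Hypothesis sp0 : forall t, 0 <= sp t.
Hypothesis x1E : forall t, x1 t = sp t * cos (nu t).
Hypothesis y1E : forall t, y1 t = sp t * sin (nu t).

(** Schmidt's comparison.  If the curve spans the same range of abscissas as the
    Wulff shape, each point of the curve is paired with a boundary point of the
    Wulff shape of the same abscissa, on the lower half while the curve goes from
    its leftmost to its rightmost point and on the upper half on the way back.
    The support inequality reads [x y' - z x' <= s(nu) speed] for the ordinate [z]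
    of that boundary point; its integral over the period is the claim. *)
Lemma wulff_same_width (s s1 s2 : R -> R) (t0 t1 : R) :
  (forall v : R, is_derive v 1 s (s1 v)) -> (forall v : R, is_derive v 1 s1 (s2 v)) ->
  continuous s2 -> periodic s (2 * pi) -> periodic s1 (2 * pi) ->
  (forall v, 0 < s v + s2 v) ->
  mu.-integrable `[0, 1] (EFin \o (fun t => s (nu t) * sp t)) ->
  0 <= t0 <= 1 -> 0 <= t1 <= 1 ->
  x t0 = - s (- (pi / 2)) -> x t1 = s (pi / 2) ->
  (forall t, 0 <= t <= 1 -> - s (- (pi / 2)) <= x t <= s (pi / 2)) ->
  \int[mu]_(t in `[0, 1]) (x t * y1 t) +
    2^-1 * \int[mu]_(v in `[0, 2 * pi]) (s v * (s v + s2 v)) <=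
  \int[mu]_(t in `[0, 1]) (s (nu t) * sp t).
Proof.
move=> ds ds1 cs2 ps ps1 rho0 ig t0I t1I xt0 xt1 xI.
have pi0 := pi_gt0 R.
have cs : continuous s by move=> v; apply: is_derive_continuous (ds v).
have csr : continuous (fun v => s v * (s v + s2 v)).
  by move=> v; apply: cvgM; [exact: cs|apply: cvgD; [exact: cs|exact: cs2]].
have [S dS] := primitive_exists (- (2 * pi)) csr.
have Xmin : supX s s1 (- (pi / 2)) = - s (- (pi / 2)).
  by rewrite /supX sinN cosN cos_pihalf sin_pihalf; ring.
have Xmax : supX s s1 (pi / 2) = s (pi / 2).
  by rewrite /supX cos_pihalf sin_pihalf; ring.
have [|l [L [cl dL lZ eL]]] := @arc_graph _ _ _ _ S ds ds1 rho0.
  by move=> v /andP[v1 v2]; apply: dS; lra.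
(* The upper half of the boundary is the lower half for the reflected support
   function. *)
pose s' v := s (pi - v); pose s1' v := - s1 (pi - v); pose s2' v := s2 (pi - v).
have ds' (v : R) : is_derive v 1 s' (s1' v).
  by have := ds (pi - v) => ?; apply: is_derive_eq; rewrite /s1'; ring.
have ds1' (v : R) : is_derive v 1 s1' (s2' v).
  by have := ds1 (pi - v) => ?; apply: is_derive_eq; rewrite /s2'; ring.
pose S' v := - S (pi - v).
have X'E v : supX s' s1' v = supX s s1 (pi - v).
  by rewrite /supX /s' /s1' sinB cosB sinpi cospi; ring.
have Z'E v : supZ s' s1' v = - supZ s s1 (pi - v).
  by rewrite /supZ /s' /s1' sinB cosB sinpi cospi; ring.
have [v||l' [L' [cl' dL' lZ' eL']]] := @arc_graph _ _ _ _ S' ds' ds1'.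
- by rewrite /s' /s2'; exact: rho0.
- move=> v /andP[v1 v2].
  have h : is_derive (pi - v) 1 S (s (pi - v) * (s (pi - v) + s2 (pi - v))).
    by apply: dS; lra.
  by apply: is_derive_eq; rewrite /s' /s2'; ring.
have e1 : pi - - (pi / 2) = - (pi / 2) + 2 * pi :> R by field.
have e2 : pi - pi / 2 = pi / 2 :> R by field.
have X'min : supX s' s1' (- (pi / 2)) = - s (- (pi / 2)).
  rewrite X'E e1 -Xmin /supX ps ps1 sin_periodic cos_periodic//.
have X'max : supX s' s1' (pi / 2) = s (pi / 2) by rewrite X'E e2.
have Z'min : supZ s' s1' (- (pi / 2)) = - supZ s s1 (- (pi / 2)).
  rewrite Z'E e1 /supZ ps ps1 sin_periodic cos_periodic//.
have Z'max : supZ s' s1' (pi / 2) = - supZ s s1 (pi / 2) by rewrite Z'E e2.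
have supp := support_ineq ds ds1 ps (fun v => ltW (rho0 v)).
have lg t : 0 <= t <= 1 -> x t * y1 t - l (x t) * x1 t <= s (nu t) * sp t.
  move=> tI; have [|m [em ->]] := lZ (x t); first by rewrite Xmin Xmax xI.
  rewrite {}em y1E x1E mulrCA [X in _ - X]mulrCA -mulrBr mulrC.
  by apply: ler_wpM2r => //; exact: supp.
pose u r := - l' r; pose U r := - L' r.
have ug t : 0 <= t <= 1 -> x t * y1 t - u (x t) * x1 t <= s (nu t) * sp t.
  move=> tI; have [|m [em em2]] := lZ' (x t); first by rewrite X'min X'max xI.
  rewrite /u em2 {}em y1E x1E mulrCA [X in _ - X]mulrCA -mulrBr mulrC X'E Z'E opprK.
  by apply: ler_wpM2r => //; exact: supp.
have cu : continuous u by move=> r; apply: cvgN; exact: cl'.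
have dLx t : 0 <= t <= 1 -> is_derive (x t) 1 L (l (x t)).
  by move=> /xI/andP[h _]; apply: dL; rewrite Xmin.
have dUx t : 0 <= t <= 1 -> is_derive (x t) 1 U (u (x t)).
  move=> /xI/andP[h _].
  by have h' : is_derive (x t) 1 L' (l' (x t)) by [apply: dL'; rewrite X'min]; apply: is_derive_eq.
(* The area of the Wulff shape is the area between its two halves, up to
   the choice of the period over which it is integrated. *)
have W : 2^-1 * \int[mu]_(v in `[0, 2 * pi]) (s v * (s v + s2 v)) =
   U (s (pi / 2)) - L (s (pi / 2)) - (U (- s (- (pi / 2))) - L (- s (- (pi / 2)))).
  have pr : S (2 * pi) - S 0 = S (- (pi / 2) + 2 * pi) - S (- (pi / 2)).
    pose T v := S (v + 2 * pi).
    suff : T 0 - T (- (pi / 2)) = S 0 - S (- (pi / 2)) by rewrite /T add0r => e; lra.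
    apply: (@derive_eq_diff _ _ _ T S (fun v => s v * (s v + s2 v))); first lra.
    - move=> v /andP[v1 v2].
      have h : is_derive (v + 2 * pi) 1 S (s v * (s v + s2 v)).
        have -> : s v * (s v + s2 v) = s (v + 2 * pi) * (s (v + 2 * pi) + s2 (v + 2 * pi)).
          rewrite ps; congr (_ * (_ + _)).
          have d1 : is_derive v 1 s1 (s2 (v + 2 * pi)).
            have -> : s1 = s1 \o (id + cst (2 * pi)) by apply/funext => r; rewrite /= ps1.
            have := ds1 (v + 2 * pi) => ?.
            by apply: is_derive_eq; ring.
          by rewrite -(@derive_val _ _ _ _ _ _ _ (ds1 v)) -(@derive_val _ _ _ _ _ _ _ d1).
        by apply: dS; lra.
      by apply: is_derive_eq; ring.
    - by move=> v /andP[v1 v2]; apply: dS; lra.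
  have -> : \int[mu]_(v in `[0, 2 * pi]) (s v * (s v + s2 v)) = S (2 * pi) - S 0.
    by apply: int_FTC_global; [lra|exact: csr|move=> v /andP[v1 v2]; apply: dS; lra].
  rewrite X'max X'min Z'max Z'min /S' e1 e2 in eL'.
  rewrite Xmax Xmin in eL.
  rewrite pr /U.
  lra.
rewrite W.
have [t01|/ltW t10] := leP t0 t1.
  move: t0I t1I => /andP[h0 _] /andP[_ h1].
  have := @two_graphs x x1 y1 _ dx cx1 cy1 ig l L u U t0 t1 h0 t01 h1 x01 cl cu dLx dUx lg ug.
  by rewrite xt0 xt1.
move: t0I t1I => /andP[_ h0] /andP[h1 _].
have := @two_graphs x x1 y1 _ dx cx1 cy1 ig u U l L t1 t0 h1 t10 h0 x01 cu cl dUx dLx ug lg.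
rewrite xt0 xt1 => h.
by apply: le_trans h; rewrite lerD2l; lra.
Qed.

End WulffC2.

End Wulff.

Section WulffScaled.
Context {R : realType}.
Notation mu := (@lebesgue_measure R).

Variables (x y x1 y1 nu sp : R -> R).
Hypothesis dx : forall t : R, is_derive t 1 x (x1 t).
Hypothesis dy : forall t : R, is_derive t 1 y (y1 t).
Hypothesis cx1 : continuous x1.
Hypothesis cy1 : continuous y1.
Hypothesis x01 : x 0 = x 1.
Hypothesis y01 : y 0 = y 1.
Hypothesis sp0 : forall t, 0 <= sp t.
Hypothesis x1E : forall t, x1 t = sp t * cos (nu t).
Hypothesis y1E : forall t, y1 t = sp t * sin (nu t).

(** A homothety of ratio [r] and a horizontal translation, [z v = r s v + c sin v],
    give the Wulff shape the range of abscissas of the curve.  The translation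
    changes neither the energy of a closed curve nor the area, so that
    [wulff_same_width] becomes [a + r^2 W <= r L], and the inequality of
    arithmetic and geometric means eliminates [r]. *)
Lemma wulff_C2 (s s1 s2 : R -> R) :
  (forall v : R, is_derive v 1 s (s1 v)) -> (forall v : R, is_derive v 1 s1 (s2 v)) ->
  continuous s2 -> periodic s (2 * pi) -> periodic s1 (2 * pi) ->
  (forall v, 0 < s v + s2 v) ->
  mu.-integrable `[0, 1] (EFin \o (fun t => s (nu t) * sp t)) ->
  0 <= \int[mu]_(t in `[0, 1]) (x t * y1 t) ->
  0 <= \int[mu]_(v in `[0, 2 * pi]) (s v * (s v + s2 v)) ->
  4 * (2^-1 * \int[mu]_(v in `[0, 2 * pi]) (s v * (s v + s2 v))) *
    \int[mu]_(t in `[0, 1]) (x t * y1 t) <=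
  (\int[mu]_(t in `[0, 1]) (s (nu t) * sp t)) ^+ 2.
Proof.
move=> ds ds1 cs2 ps ps1 rho0 ig.
set a := \int[mu]_(t in `[0, 1]) (x t * y1 t).
set W2 := \int[mu]_(v in `[0, 2 * pi]) _.
set L := \int[mu]_(t in `[0, 1]) _ => a0 W0.
have pi0 := pi_gt0 R.
have cx : continuous x by move=> t; apply: is_derive_continuous (dx t).
have cs : continuous s by move=> v; apply: is_derive_continuous (ds v).
have y1int : \int[mu]_(t in `[0, 1]) y1 t = 0.
  rewrite (@Rintegral_FTC _ _ _ y)//; first by rewrite y01 subrr.
  exact: continuous_subspaceT.
have [t1 t1I xt1] := EVT_max (ler01 : 0 <= 1 :> R) (continuous_subspaceT cx).
have [t0 t0I xt0] := EVT_min (ler01 : 0 <= 1 :> R) (continuous_subspaceT cx).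
have m_le_M : x t0 <= x t1 by apply: xt0.
(* If the curve is contained in a vertical line, no homothety is available but
   the area vanishes. *)
have [M_le_m|m_lt_M] := leP (x t1) (x t0).
  suff -> : a = 0 by rewrite mulr0 sqr_ge0.
  have -> : a = \int[mu]_(t in `[0, 1]) (x t0 * y1 t).
    apply: eq_Rintegral => t; rewrite inE/= => tI; congr (_ * _).
    by apply/eqP; rewrite eq_le (le_trans (xt1 _ _) M_le_m)// xt0.
  rewrite RintegralZl//; last exact: integrable_continuous.
  by rewrite y1int mulr0.
have Wid : 0 < s (pi / 2) + s (- (pi / 2)).
  have : supX s s1 (- (pi / 2)) < supX s s1 (pi / 2).
    apply: (@gt0_derive_lt _ _ _ _ (fun v => (s v + s2 v) * cos v)); first lra.
      by move=> v _; exact: is_derive_supX.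
    by move=> v vI; apply: mulr_gt0 => //; apply: cos_gt0_pihalf.
  by rewrite /supX sinN cosN cos_pihalf sin_pihalf; lra.
pose r := (x t1 - x t0) / (s (pi / 2) + s (- (pi / 2))).
have r0 : 0 < r by rewrite divr_gt0 // subr_gt0.
have rE : r * (s (pi / 2) + s (- (pi / 2))) = x t1 - x t0.
  by rewrite /r divfK// gt_eqF.
pose c := x t1 - r * s (pi / 2).
pose z (v : R) := r * s v + c * sin v.
pose z1 (v : R) := r * s1 v + c * cos v.
pose z2 (v : R) := r * s2 v - c * sin v.
have dz (v : R) : is_derive v 1 z (z1 v).
  by have := ds v => ?; apply: is_derive_eq; rewrite /GRing.scale/= /z1; ring.
have dz1 (v : R) : is_derive v 1 z1 (z2 v).
  by have := ds1 v => ?; apply: is_derive_eq; rewrite /GRing.scale/= /z2; ring.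
have zrho v : z v + z2 v = r * (s v + s2 v) by rewrite /z /z2; ring.
have iy1 : mu.-integrable `[0, 1] (EFin \o y1) by exact: integrable_continuous.
have zL : (fun t => z (nu t) * sp t) = (fun t => r * (s (nu t) * sp t) + c * y1 t).
  by apply/funext => t; rewrite /z y1E; ring.
have irs : mu.-integrable `[0, 1] (EFin \o (fun t => r * (s (nu t) * sp t))).
  exact: integrable_itvZ.
have icy : mu.-integrable `[0, 1] (EFin \o (fun t => c * y1 t)).
  exact: integrable_itvZ.
have key : a + 2^-1 * \int[mu]_(v in `[0, 2 * pi]) (z v * (z v + z2 v)) <=
    \int[mu]_(t in `[0, 1]) (z (nu t) * sp t).
  apply: (@wulff_same_width _ x x1 y1 nu sp _ _ _ _ _ _ _ z z1 z2 t0 t1) => //.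
  - move=> v; apply: cvgB; apply: cvgM; try exact: cvg_cst; [exact: cs2|exact: continuous_sin].
  - by move=> v; rewrite /z ps sin_periodic.
  - by move=> v; rewrite /z1 ps1 cos_periodic.
  - by move=> v; rewrite zrho mulr_gt0.
  - by rewrite zL; exact: integrable_itvD.
  - by rewrite /z sinN sin_pihalf /c; lra.
  - by rewrite /z sin_pihalf /c; lra.
  - move=> t tI; rewrite /z sinN sin_pihalf; apply/andP; split.
      by have := xt0 t tI; rewrite /c; lra.
    by have := xt1 t tI; rewrite /c; lra.
have LE : \int[mu]_(t in `[0, 1]) (z (nu t) * sp t) = r * L.
  rewrite zL RintegralD// RintegralZl// RintegralZl//.
  by rewrite y1int mulr0 addr0.
have csrho : continuous (fun v => s v + s2 v).
  by move=> v; apply: cvgD; [exact: cs|exact: cs2].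
have csr : continuous (fun v => s v * (s v + s2 v)).
  by move=> v; apply: cvgM; [exact: cs|exact: csrho].
have crs : continuous (fun v => (s v + s2 v) * sin v).
  by move=> v; apply: cvgM; [exact: csrho|exact: continuous_sin].
have zint : \int[mu]_(v in `[0, 2 * pi]) ((s v + s2 v) * sin v) = 0.
  transitivity (supZ s s1 (2 * pi) - supZ s s1 0).
    by apply: int_FTC_global => //; [lra|move=> v _; exact: is_derive_supZ].
  have -> : supZ s s1 (2 * pi) = supZ s s1 (0 + 2 * pi) by rewrite add0r.
  by rewrite /supZ ps ps1 sin_periodic cos_periodic subrr.
have WE : \int[mu]_(v in `[0, 2 * pi]) (z v * (z v + z2 v)) = r ^+ 2 * W2.
  have -> : \int[mu]_(v in `[0, 2 * pi]) (z v * (z v + z2 v)) =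
      \int[mu]_(v in `[0, 2 * pi]) (r ^+ 2 * (s v * (s v + s2 v)) +
        (r * c) * ((s v + s2 v) * sin v)).
    by apply: eq_Rintegral => v _; rewrite zrho /z; ring.
  have i1 : mu.-integrable `[0, 2 * pi] (EFin \o (fun v => s v * (s v + s2 v))).
    exact: integrable_continuous.
  have i2 : mu.-integrable `[0, 2 * pi] (EFin \o (fun v => (s v + s2 v) * sin v)).
    exact: integrable_continuous.
  rewrite RintegralD//; [|exact: integrable_itvZ|exact: integrable_itvZ].
  by rewrite RintegralZl// RintegralZl// zint mulr0 addr0.
rewrite LE WE in key.
have L0 : 0 <= L.
  rewrite -(pmulr_rge0 _ r0); apply: le_trans key.
  by rewrite addr_ge0// mulr_ge0// mulr_ge0// sqr_ge0.
have h1 : (a + 2^-1 * (r ^+ 2 * W2)) ^+ 2 <= (r * L) ^+ 2.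
  apply: lerXn2r => //; rewrite nnegrE.
    by rewrite addr_ge0// mulr_ge0// mulr_ge0// sqr_ge0.
  by rewrite mulr_ge0// ltW.
have h2 : 4 * a * (2^-1 * (r ^+ 2 * W2)) <= (a + 2^-1 * (r ^+ 2 * W2)) ^+ 2.
  rewrite -subr_ge0.
  have -> : (a + 2^-1 * (r ^+ 2 * W2)) ^+ 2 - 4 * a * (2^-1 * (r ^+ 2 * W2)) =
    (a - 2^-1 * (r ^+ 2 * W2)) ^+ 2 by ring.
  exact: sqr_ge0.
have r20 : 0 < r ^+ 2 by rewrite exprn_gt0.
rewrite -(ler_pM2l r20).
apply: le_trans (le_trans h2 _); last by rewrite -exprMn.
by rewrite le_eqVlt; apply/orP; left; apply/eqP; ring.
Qed.

End WulffScaled.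

(** * Trigonometric polynomials and convolution on the circle *)

Section Circle.
Context {R : realType}.
Notation mu := (@lebesgue_measure R).
Implicit Types (s f g h z J phi : R -> R) (N k n : nat).

Let pi0 : 0 < (pi : R). Proof. exact: pi_gt0. Qed.
Let pi2 : 0 < 2 * (pi : R). Proof. by rewrite mulr_gt0. Qed.
Let pi2_ge0 : 0 <= 2 * (pi : R). Proof. exact: ltW. Qed.

(** Real trigonometric polynomials of degree less than [N].  The inductive form
    lets each linear property be checked on [cos (k v)] and [sin (k v)]. *)
Inductive trig N : (R -> R) -> Prop :=
| trig_cos k : (k < N)%N -> trig N (fun v => cos (k%:R * v))
| trig_sin k : (k < N)%N -> trig N (fun v => sin (k%:R * v))
| trig_add f g : trig N f -> trig N g -> trig N (fun v => f v + g v)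
| trig_scale c f : trig N f -> trig N (fun v => c * f v).

Lemma trigW N M f : (N <= M)%N -> trig N f -> trig M f.
Proof.
move=> NM; elim=> [k kN|k kN|g h _ ? _ ?|c g _ ?].
- by apply: trig_cos; exact: leq_trans NM.
- by apply: trig_sin; exact: leq_trans NM.
- exact: trig_add.
- exact: trig_scale.
Qed.

Lemma trig_cst N c : (0 < N)%N -> trig N (fun=> c).
Proof.
move=> N0; have := trig_scale c (trig_cos N0).
by congr trig; apply/funext => v; rewrite mul0r cos0 mulr1.
Qed.

Lemma trig_derive N f : trig N f ->
  exists2 f', trig N f' & forall v : R, is_derive v 1 f (f' v).
Proof.
elim=> [k kN|k kN|g h _ [g' ? dg] _ [h' ? dh]|c g _ [g' ? dg]].
- exists (fun v => - k%:R * sin (k%:R * v)); first exact/trig_scale/trig_sin.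
  by move=> v; apply: is_derive_eq; rewrite /GRing.scale/=; ring.
- exists (fun v => k%:R * cos (k%:R * v)); first exact/trig_scale/trig_cos.
  by move=> v; apply: is_derive_eq; rewrite /GRing.scale/=; ring.
- exists (fun v => g' v + h' v); first exact: trig_add.
  by move=> v; have := dg v; have := dh v => ? ?; apply: is_derive_eq.
- exists (fun v => c * g' v); first exact: trig_scale.
  by move=> v; have := dg v => ?; apply: is_derive_eq; rewrite /GRing.scale/=; ring.
Qed.

Lemma trig_periodic N f : trig N f -> periodic f (2 * pi).
Proof.
elim=> [k kN|k kN|g h _ pg _ ph|c g _ pg] v.
- by rewrite mulrDr [X in _ + X]mulr_natl (periodicn cos_periodic).
- by rewrite mulrDr [X in _ + X]mulr_natl (periodicn sin_periodic).
- by rewrite pg ph.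
- by rewrite pg.
Qed.

Lemma trig_continuous N f : trig N f -> continuous f.
Proof.
by move=> /trig_derive[f' _ df] v; apply: is_derive_continuous (df v).
Qed.

(** [2 cos a cos v = cos (a + v) + cos (a - v)], and the same for the sine. *)
Lemma trig_mul_cos N f : trig N f -> trig N.+1 (fun v => f v * cos v).
Proof.
have e (w v : R) : w + v = w + 1 * v by ring.
elim=> [k kN|k kN|g h _ pg _ ph|c g _ pg].
- case: k kN => [|k] kN.
    have : (1 < N.+1)%N by [].
    by move=> /trig_cos; congr trig; apply/funext => v; rewrite mul0r cos0 mul1r mul1r.
  have h1 : trig N.+1 (fun v => cos (k.+2%:R * v)) by exact: trig_cos.
  have h2 : trig N.+1 (fun v => cos (k%:R * v)) by apply: trig_cos; exact: leq_trans (ltnW kN) (leqnSn N).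
  have := trig_scale 2^-1 (trig_add h1 h2); congr trig; apply/funext => v.
  have -> : k.+2%:R * v = k.+1%:R * v + v by rewrite -natr1; ring.
  have -> : k%:R * v = k.+1%:R * v - v by rewrite -natr1; ring.
  by rewrite cosD cosB; field.
- case: k kN => [|k] kN.
    have := trig_cst 0 (ltn0Sn N).
    by congr trig; apply/funext => v; rewrite mul0r sin0 mul0r.
  have h1 : trig N.+1 (fun v => sin (k.+2%:R * v)) by exact: trig_sin.
  have h2 : trig N.+1 (fun v => sin (k%:R * v)) by apply: trig_sin; exact: leq_trans (ltnW kN) (leqnSn N).
  have := trig_scale 2^-1 (trig_add h1 h2); congr trig; apply/funext => v.
  have -> : k.+2%:R * v = k.+1%:R * v + v by rewrite -natr1; ring.
  have -> : k%:R * v = k.+1%:R * v - v by rewrite -natr1; ring.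
  by rewrite sinD sinB; field.
- by have := trig_add pg ph; congr trig; apply/funext => v; rewrite mulrDl.
- by have := trig_scale c pg; congr trig; apply/funext => v; rewrite mulrA.
Qed.

Lemma trig_kernel n : trig n.+1 (fun v => (1 + cos v) ^+ n).
Proof.
elim: n => [|n IH].
  by have := trig_cst 1 (ltnSn 0); congr trig; apply/funext => v; rewrite expr0.
have := trig_add (trigW (leqnSn _) IH) (trig_mul_cos IH); congr trig.
by apply/funext => v; rewrite exprSr mulrDr mulr1.
Qed.

Lemma trig_reflect N J v : trig N J -> trig N (fun t => J (v - t)).
Proof.
elim=> [k kN|k kN|g h _ pg _ ph|c g _ pg].
- have := trig_add (trig_scale (cos (k%:R * v)) (trig_cos kN))
    (trig_scale (sin (k%:R * v)) (trig_sin kN)).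
  by congr trig; apply/funext => t; rewrite mulrBr cosB; ring.
- have := trig_add (trig_scale (sin (k%:R * v)) (trig_cos kN))
    (trig_scale (- cos (k%:R * v)) (trig_sin kN)).
  by congr trig; apply/funext => t; rewrite mulrBr sinB; ring.
- exact: trig_add.
- exact: trig_scale.
Qed.

Lemma trig_bounded N f : trig N f -> exists M, forall v, `|f v| <= M.
Proof.
elim=> [k kN|k kN|g h _ [M1 h1] _ [M2 h2]|c g _ [M hM]].
- by exists 1 => v; rewrite cos_max.
- by exists 1 => v; rewrite sin_max.
- by exists (M1 + M2) => v; rewrite (le_trans (ler_normD _ _))// lerD.
- by exists (`|c| * M) => v; rewrite normrM ler_wpM2l.
Qed.

Definition conv (s J : R -> R) (v : R) : R :=
  \int[mu]_(t in `[0, 2 * pi]) (s t * J (v - t)).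

Lemma integrableM_trig N s J : mu.-integrable `[0, 2 * pi] (EFin \o s) -> trig N J ->
  mu.-integrable `[0, 2 * pi] (EFin \o (fun t => s t * J t)).
Proof.
move=> si tJ; have [M JM] := trig_bounded tJ.
apply: (@integrable_itvM _ _ _ M) => //.
by apply: measurable_funTS; apply: continuous_measurable_fun; exact: trig_continuous tJ.
Qed.

Lemma integrable_conv N s J v : mu.-integrable `[0, 2 * pi] (EFin \o s) -> trig N J ->
  mu.-integrable `[0, 2 * pi] (EFin \o (fun t => s t * J (v - t))).
Proof. by move=> si tJ; apply: (integrableM_trig si (trig_reflect v tJ)). Qed.

(** The addition formula separates the variables, so that the convolution with a
    trigonometric polynomial needs no theorem on parameter integrals. *)
Lemma conv_cos s k v : mu.-integrable `[0, 2 * pi] (EFin \o s) ->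
  conv s (fun v => cos (k%:R * v)) v =
  (\int[mu]_(t in `[0, 2 * pi]) (s t * cos (k%:R * t))) * cos (k%:R * v) +
  (\int[mu]_(t in `[0, 2 * pi]) (s t * sin (k%:R * t))) * sin (k%:R * v).
Proof.
move=> si.
have ic := integrableM_trig si (trig_cos (ltnSn k)).
have is_ := integrableM_trig si (trig_sin (ltnSn k)).
rewrite -RintegralZr// -RintegralZr// -RintegralD//.
- by apply: eq_Rintegral => t _; rewrite mulrBr cosB; ring.
- by have := integrable_itvZ (cos (k%:R * v)) ic; congr integrable; apply/funext => t /=; rewrite mulrC.
- by have := integrable_itvZ (sin (k%:R * v)) is_; congr integrable; apply/funext => t /=; rewrite mulrC.
Qed.

Lemma conv_sin s k v : mu.-integrable `[0, 2 * pi] (EFin \o s) ->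
  conv s (fun v => sin (k%:R * v)) v =
  (\int[mu]_(t in `[0, 2 * pi]) (s t * cos (k%:R * t))) * sin (k%:R * v) +
  (\int[mu]_(t in `[0, 2 * pi]) (s t * sin (k%:R * t))) * - cos (k%:R * v).
Proof.
move=> si.
have ic := integrableM_trig si (trig_cos (ltnSn k)).
have is_ := integrableM_trig si (trig_sin (ltnSn k)).
rewrite -RintegralZr// -RintegralZr// -RintegralD//.
- by apply: eq_Rintegral => t _; rewrite mulrBr sinB; ring.
- by have := integrable_itvZ (sin (k%:R * v)) ic; congr integrable; apply/funext => t /=; rewrite mulrC.
- by have := integrable_itvZ (- cos (k%:R * v)) is_; congr integrable; apply/funext => t /=; rewrite mulrC.
Qed.

Lemma convD N s f g v : mu.-integrable `[0, 2 * pi] (EFin \o s) -> trig N f -> trig N g ->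
  conv s (fun v => f v + g v) v = conv s f v + conv s g v.
Proof.
move=> si tf tg; rewrite /conv -RintegralD//; [|exact: integrable_conv tf|exact: integrable_conv tg].
by apply: eq_Rintegral => t _; rewrite mulrDr.
Qed.

Lemma convZ N s c f v : mu.-integrable `[0, 2 * pi] (EFin \o s) -> trig N f ->
  conv s (fun v => c * f v) v = c * conv s f v.
Proof.
move=> si tf; rewrite /conv -RintegralZl//; last exact: integrable_conv tf.
by apply: eq_Rintegral => t _; rewrite mulrCA.
Qed.

Lemma trig_conv N s J : mu.-integrable `[0, 2 * pi] (EFin \o s) -> trig N J ->
  trig N (conv s J).
Proof.
move=> si; elim=> [k kN|k kN|g h tg pg th ph|c g tg pg].
- under [conv _ _]funext do rewrite conv_cos//.
  by apply: trig_add; apply: trig_scale; [exact: trig_cos|exact: trig_sin].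
- under [conv _ _]funext do rewrite conv_sin//.
  apply: trig_add; apply: trig_scale; first exact: trig_sin.
  have := trig_scale (-1) (trig_cos kN); congr trig.
  by apply/funext => v; rewrite mulN1r.
- under [conv _ _]funext do rewrite (convD _ si tg th).
  exact: trig_add.
- under [conv _ _]funext do rewrite (convZ _ _ si tg).
  exact: trig_scale.
Qed.

Lemma is_derive_conv N J : trig N J ->
  exists J', [/\ trig N J', forall v : R, is_derive v 1 J (J' v) &
    forall s, mu.-integrable `[0, 2 * pi] (EFin \o s) ->
      forall v : R, is_derive v 1 (conv s J) (conv s J' v)].
Proof.
elim=> [k kN|k kN|g h tg [g' [tg' dg cg]] th [h' [th' dh ch]]|c g tg [g' [tg' dg cg]]].
- exists (fun v => - k%:R * sin (k%:R * v)); split; first exact/trig_scale/trig_sin.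
    by move=> v; apply: is_derive_eq; rewrite /GRing.scale/=; ring.
  move=> s si v; rewrite (convZ _ _ si (trig_sin kN)).
  under [conv _ _]funext do rewrite conv_cos//.
  by apply: is_derive_eq; rewrite conv_sin// /GRing.scale/=; ring.
- exists (fun v => k%:R * cos (k%:R * v)); split; first exact/trig_scale/trig_cos.
    by move=> v; apply: is_derive_eq; rewrite /GRing.scale/=; ring.
  move=> s si v; rewrite (convZ _ _ si (trig_cos kN)).
  under [conv _ _]funext do rewrite conv_sin//.
  by apply: is_derive_eq; rewrite conv_cos// /GRing.scale/=; ring.
- exists (fun v => g' v + h' v); split; first exact: trig_add.
    by move=> v; have := dg v; have := dh v => ? ?; apply: is_derive_eq.
  move=> s si v; rewrite (convD _ si tg' th').
  under [conv _ _]funext do rewrite (convD _ si tg th).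
  by have := cg s si v; have := ch s si v => ? ?; apply: is_derive_eq.
- exists (fun v => c * g' v); split; first exact: trig_scale.
    by move=> v; have := dg v => ?; apply: is_derive_eq; rewrite /GRing.scale/=; ring.
  move=> s si v; rewrite (convZ _ _ si tg').
  under [conv _ _]funext do rewrite (convZ _ _ si tg).
  by have := cg s si v => ?; apply: is_derive_eq; rewrite /GRing.scale/=; ring.
Qed.

Lemma Rintegral_cos_sin s k a b : mu.-integrable `[0, 2 * pi] (EFin \o s) ->
  \int[mu]_(t in `[0, 2 * pi]) (s t * (a * cos (k%:R * t) + b * sin (k%:R * t))) =
  a * \int[mu]_(t in `[0, 2 * pi]) (s t * cos (k%:R * t)) +
  b * \int[mu]_(t in `[0, 2 * pi]) (s t * sin (k%:R * t)).
Proof.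
move=> si.
have ic := integrableM_trig si (trig_cos (ltnSn k)).
have is_ := integrableM_trig si (trig_sin (ltnSn k)).
rewrite -RintegralZl// -RintegralZl// -RintegralD//; [|exact: integrable_itvZ|exact: integrable_itvZ].
by apply: eq_Rintegral => t _; ring.
Qed.

(** The exchange of the two integrals is elementary because [J (v - t)] is a finite
    sum of products of functions of [v] and of [t]. *)
Lemma conv_exchange N J s p : mu.-integrable `[0, 2 * pi] (EFin \o s) ->
  mu.-integrable `[0, 2 * pi] (EFin \o p) -> trig N J ->
  \int[mu]_(v in `[0, 2 * pi]) (p v * conv s J v) =
  \int[mu]_(t in `[0, 2 * pi]) (s t * conv p (fun v => J (- v)) t).
Proof.
move=> si pi_.
have tN f : trig N f -> trig N (fun v => f (- v)).
  by move=> /(trig_reflect 0); congr trig; apply/funext => v; rewrite sub0r.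
elim=> [k kN|k kN|g h tg eg th eh|c g tg eg].
- have -> : (fun v : R => cos (k%:R * - v)) = (fun v => cos (k%:R * v)).
    by apply/funext => v; rewrite mulrN cosN.
  under eq_Rintegral do rewrite conv_cos//.
  under [RHS]eq_Rintegral do rewrite conv_cos//.
  by rewrite !Rintegral_cos_sin//; ring.
- have e t : conv p (fun v => sin (k%:R * - v)) t =
    (\int[mu]_(t in `[0, 2 * pi]) (p t * sin (k%:R * t))) * cos (k%:R * t) +
    (- \int[mu]_(t in `[0, 2 * pi]) (p t * cos (k%:R * t))) * sin (k%:R * t).
    have -> : (fun v : R => sin (k%:R * - v)) = (fun v => -1 * sin (k%:R * v)).
      by apply/funext => v; rewrite mulrN sinN mulN1r.
    by rewrite (convZ _ _ pi_ (trig_sin (ltnSn k))) conv_sin//; ring.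
  under [RHS]eq_Rintegral do rewrite e.
  rewrite Rintegral_cos_sin//.
  have -> : \int[mu]_(v in `[0, 2 * pi]) (p v * conv s (fun v => sin (k%:R * v)) v) =
     \int[mu]_(v in `[0, 2 * pi]) (p v *
       ((- \int[mu]_(t in `[0, 2 * pi]) (s t * sin (k%:R * t))) * cos (k%:R * v) +
       (\int[mu]_(t in `[0, 2 * pi]) (s t * cos (k%:R * t))) * sin (k%:R * v))).
    by apply: eq_Rintegral => v _; rewrite conv_sin//; ring.
  by rewrite Rintegral_cos_sin//; ring.
- have -> : (fun v => g (- v) + h (- v)) = (fun v => (fun v => g (- v)) v + (fun v => h (- v)) v) by [].
  under eq_Rintegral do rewrite (convD _ si tg th) mulrDr.
  rewrite RintegralD; [|exact: measurable_itv|exact: (integrableM_trig pi_ (trig_conv si tg))|exact: (integrableM_trig pi_ (trig_conv si th))].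
  rewrite eg eh -RintegralD; [|exact: measurable_itv|exact: (integrableM_trig si (trig_conv pi_ (tN _ tg)))|exact: (integrableM_trig si (trig_conv pi_ (tN _ th)))].
  apply: eq_Rintegral => t _; rewrite -mulrDr; congr (_ * _).
  by rewrite (convD _ pi_ (tN _ tg) (tN _ th)).
- under eq_Rintegral do rewrite (convZ _ _ si tg) mulrCA.
  rewrite RintegralZl; [|exact: measurable_itv|exact: (integrableM_trig pi_ (trig_conv si tg))].
  rewrite eg -RintegralZl; [|exact: measurable_itv|exact: (integrableM_trig si (trig_conv pi_ (tN _ tg)))].
  apply: eq_Rintegral => t _; rewrite mulrCA; congr (_ * _).
  by rewrite (convZ _ _ pi_ (tN _ tg)).
Qed.

(** * Weak derivatives of trigonometric polynomials *)

Lemma derive1_eq f f' : (forall v : R, is_derive v 1 f (f' v)) -> derive1 f = f'.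
Proof. by move=> df; apply/funext => v; rewrite derive1E; apply: derive_val. Qed.

Lemma trig_derive1 N f : trig N f -> trig N (derive1 f).
Proof. by move=> /trig_derive[f' tf' df]; rewrite (derive1_eq df). Qed.

Lemma trig_test N f : trig N f -> periodic_test_function f.
Proof.
move=> tf; split; first exact: trig_periodic tf.
move=> n; have : trig N (derive1n n f).
  elim: n => [|n IH]; first by rewrite derive1n0.
  by rewrite derive1nS; exact: trig_derive1.
by move=> /trig_derive[f' _ df] t; have := df t => ?; exact: ex_derive.
Qed.

Lemma test_derive phi : periodic_test_function phi ->
  (forall t : R, is_derive t 1 phi (derive1 phi t)) /\ periodic_test_function (derive1 phi).
Proof.
move=> [pp dp]; split.
  by move=> t; rewrite derive1E; apply/derivableP; exact: (dp 0%N t).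
split.
  move=> t; rewrite !derive1E; set D := derive phi (t + 2 * pi) 1.
  have d : is_derive (t + 2 * pi) 1 phi D by apply/derivableP; exact: (dp 0%N).
  have h : is_derive t 1 (phi \o (id + cst (2 * pi))) D.
    by apply: is_derive_eq; rewrite addr0 mulr1.
  have e : phi \o (id + cst (2 * pi)) = phi by apply/funext => r; rewrite /= pp.
  by rewrite e in h; rewrite derive_val.
by move=> n t; have := dp n.+1 t; rewrite /derive1n iterSr.
Qed.

Lemma test_continuous phi : periodic_test_function phi -> continuous phi.
Proof. by move=> /test_derive[d _] t; apply: is_derive_continuous (d t). Qed.

Lemma periodic_0 f : periodic f (2 * pi) -> f (2 * pi) = f 0.
Proof. by move=> /(_ 0); rewrite add0r. Qed.

Lemma ibp_periodic f f' g g' :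
  (forall t : R, is_derive t 1 f (f' t)) -> (forall t : R, is_derive t 1 g (g' t)) ->
  continuous f' -> continuous g' -> periodic f (2 * pi) -> periodic g (2 * pi) ->
  \int[mu]_(t in `[0, 2 * pi]) (f t * g' t) =
  - \int[mu]_(t in `[0, 2 * pi]) (f' t * g t).
Proof.
move=> df dg cf' cg' pf pg.
have cf : continuous f by move=> t; apply: is_derive_continuous (df t).
have cg : continuous g by move=> t; apply: is_derive_continuous (dg t).
have c1 : continuous (fun t => f t * g' t) by move=> t; apply: cvgM; [exact: cf|exact: cg'].
have c2 : continuous (fun t => f' t * g t) by move=> t; apply: cvgM; [exact: cf'|exact: cg].
apply/eqP; rewrite -addr_eq0 -RintegralD//; try exact: integrable_continuous.
have -> : \int[mu]_(t in `[0, 2 * pi]) (f t * g' t + f' t * g t) =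
    f (2 * pi) * g (2 * pi) - f 0 * g 0.
  apply: (@int_FTC_global _ _ _ (fun t => f t * g t)); first exact: ltW.
    by move=> t; apply: cvgD; [exact: c1|exact: c2].
  move=> t _; have := df t; have := dg t => ? ?.
  by apply: is_derive_eq; rewrite /GRing.scale/=; ring.
by rewrite !periodic_0// subrr.
Qed.

Lemma continuous_L2 f : continuous f -> periodic f (2 * pi) -> L2_per f.
Proof.
move=> cf pf; split => //; first exact: continuous_measurable_fun.
by apply: integrable_continuous => t; apply: cvgM; exact: cf.
Qed.

Lemma trig_L2 N f : trig N f -> L2_per f.
Proof.
by move=> tf; apply: continuous_L2; [exact: trig_continuous tf|exact: trig_periodic tf].
Qed.

Lemma trig_weak0 N f : trig N f -> is_weak_derivative 0 f f.
Proof. by move=> tf; split; [exact: trig_L2 tf|move=> phi _; rewrite expr0 mul1r]. Qed.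

Lemma trig_weak1 N f f' : trig N f -> trig N f' -> (forall t : R, is_derive t 1 f (f' t)) ->
  is_weak_derivative 1 f f'.
Proof.
move=> tf tf' df; split; first exact: trig_L2 tf'.
move=> phi tphi; have [dphi tphi'] := test_derive tphi.
rewrite derive1n1 expr1 mulN1r; apply: ibp_periodic => //.
- exact: trig_continuous tf'.
- exact: test_continuous.
- exact: trig_periodic tf.
- by have [] := tphi.
Qed.

Lemma trig_weak2 N f f' f'' : trig N f -> trig N f' -> trig N f'' ->
  (forall t : R, is_derive t 1 f (f' t)) -> (forall t : R, is_derive t 1 f' (f'' t)) ->
  is_weak_derivative 2 f f''.
Proof.
move=> tf tf' tf'' df df'; split; first exact: trig_L2 tf''.
move=> phi tphi; have [dphi tphi'] := test_derive tphi.
have [_ h1] := trig_weak1 tf tf' df; have [_ h2] := trig_weak1 tf' tf'' df'.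
have := h1 _ tphi'; have := h2 _ tphi.
rewrite !derive1n1 /= !expr1 !mulN1r => e2 e1.
by rewrite /derive1n/= e1 e2 opprK sqrrN expr1n mul1r.
Qed.

Lemma L2_integrable g : L2_per g -> mu.-integrable `[0, 2 * pi] (EFin \o g).
Proof.
move=> [_ mg ig2].
have i1 : mu.-integrable `[0, 2 * pi] (EFin \o (fun t => 1 + g t ^+ 2)).
  by apply: integrable_itvD => //; apply: integrable_continuous => t; exact: cvg_cst.
apply: (@le_integrable _ _ _ mu `[0, 2 * pi]%classic (measurable_itv _) _ _ _ _ i1).
  by apply/measurable_EFinP; exact: measurable_funTS.
move=> t _; rewrite lee_fin [leRHS]ger0_norm; last by rewrite addr_ge0// sqr_ge0.
rewrite -subr_ge0 -(@real_normK _ (g t)) ?num_real//.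
set a := `|g t|.
have -> : 1 + a ^+ 2 - a = (a - 2^-1) ^+ 2 + 3 / 4 by field.
by rewrite addr_ge0// sqr_ge0.
Qed.

Lemma weak_derivativeP k f : (exists g, is_weak_derivative k f g) ->
  is_weak_derivative k f (weak_derivative k f).
Proof. by move=> h; have := xgetPex (cst 0) h. Qed.

(** * A nonnegative trigonometric approximation of unity *)

(** The kernels are the normalized powers of [1 + cos], which are trigonometric
    polynomials, nonnegative, even, and concentrate at [0]. *)
Definition kmass n : R := \int[mu]_(t in `[0, 2 * pi]) (1 + cos t) ^+ n.

Definition kern n (v : R) : R := (kmass n)^-1 * (1 + cos v) ^+ n.

Lemma trig_kern n : trig n.+1 (kern n).
Proof. exact/trig_scale/trig_kernel. Qed.

(** The integrand is at least [(1 + c)^n] on an interval [[0, eta]] where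
    [cos >= c]. *)
Lemma kmass_lower (c : R) : -1 <= c -> c < 1 ->
  exists2 eta, 0 < eta & forall n, eta * (1 + c) ^+ n <= kmass n.
Proof.
move=> cN1 c1.
have [eta [eta0 eta2 etac]] : exists eta : R, [/\ 0 < eta, eta <= 2 * pi &
    forall t, 0 <= t <= eta -> c <= cos t].
  have := @continuous_cos R 0; rewrite /continuous_at cos0 => /cvgrPdist_lt.
  have e0 : 0 < 1 - c by rewrite subr_gt0.
  move=> /(_ _ e0) [r /= r0 h].
  exists (Num.min (r / 2) (2 * pi)); split.
  - by rewrite lt_min divr_gt0//= pi2.
  - by rewrite ge_min lexx orbT.
  - move=> t; rewrite le_min => /andP[t0 /andP[tr _]].
    have : `|0 - t| < r by rewrite sub0r normrN ger0_norm//; lra.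
    by move=> /h; rewrite ltr_norml => /andP[_]; lra.
exists eta => // n.
have ci : continuous (fun t : R => (1 + cos t) ^+ n).
  exact: trig_continuous (trig_kernel n).
have etaI : 0 <= eta <= 2 * pi by rewrite ltW.
rewrite /kmass (Rintegral_split etaI); last exact: integrable_continuous.
have -> : eta * (1 + c) ^+ n = \int[mu]_(t in `[0, eta]) ((1 + c) ^+ n).
  rewrite Rintegral_cst//= lebesgue_measure_itv/= lte_fin eta0 oppr0 addr0/=.
  by rewrite mulrC.
apply: ler_wpDr; first by apply: Rintegral_ge0 => t _.
apply: Rintegral_integrable_le.
- by apply: integrable_continuous => t; exact: cvg_cst.
- exact: integrable_continuous.
- move=> t tI; apply: lerXn2r; rewrite ?nnegrE; last by rewrite lerD2l etac.
    by rewrite -lerBlDl sub0r.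
  by rewrite -lerBlDl sub0r cos_geN1.
Qed.

Lemma kmass_gt0 n : 0 < kmass n.
Proof.
have [eta eta0 h] := @kmass_lower 0 (lerN10 _) ltr01.
by apply: lt_le_trans (h n); rewrite mulr_gt0// exprn_gt0// addr0.
Qed.

Lemma kern_ge0 n v : 0 <= kern n v.
Proof. by rewrite mulr_ge0// invr_ge0 ltW// kmass_gt0. Qed.

Lemma kernN n v : kern n (- v) = kern n v.
Proof. by rewrite /kern cosN. Qed.

(** The integral over a period is invariant under translation: its derivative in
    the translation parameter is the increment of [J] over a period. *)
Lemma conv1_trig N J v : trig N J -> (forall v, J (- v) = J v) ->
  \int[mu]_(t in `[0, 2 * pi]) J (v - t) = \int[mu]_(t in `[0, 2 * pi]) J t.
Proof.
move=> tJ evenJ.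
have i1 : mu.-integrable `[0, 2 * pi] (EFin \o (cst 1 : R -> R)).
  by apply: integrable_continuous => t; exact: cvg_cst.
have [J' [tJ' dJ dc]] := is_derive_conv tJ.
have eJ w : conv (cst 1) J w = \int[mu]_(t in `[0, 2 * pi]) J (w - t).
  by apply: eq_Rintegral => t _; rewrite mul1r.
rewrite -eJ; transitivity (conv (cst 1) J 0); last first.
  by rewrite eJ; apply: eq_Rintegral => t _; rewrite sub0r evenJ.
apply: is_derive_0_is_cst => w.
apply: (is_derive_eq (dc _ i1 w)).
have cJ' := trig_continuous (trig_reflect w tJ').
transitivity (- J (w - 2 * pi) - (- J (w - 0))).
  rewrite /conv; transitivity (\int[mu]_(t in `[0, 2 * pi]) J' (w - t)).
    by apply: eq_Rintegral => t _; rewrite mul1r.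
  apply: (@int_FTC_global _ _ _ (fun t => - J (w - t))) => // t _.
  by have := dJ (w - t) => ?; apply: is_derive_eq; ring.
by rewrite -(trig_periodic tJ (w - 2 * pi)) subrK subr0 subrr.
Qed.

Lemma kern_int n v : \int[mu]_(t in `[0, 2 * pi]) kern n (v - t) = 1.
Proof.
rewrite (conv1_trig _ (trig_kern n) (kernN n)) RintegralZl//; last first.
  exact: integrable_continuous (trig_continuous (trig_kernel n)).
by rewrite mulVf// gt_eqF// kmass_gt0.
Qed.

Lemma integrable_kern n v : mu.-integrable `[0, 2 * pi] (EFin \o (fun t => kern n (v - t))).
Proof.
exact: integrable_continuous (trig_continuous (trig_reflect v (trig_kern n))).
Qed.

(** Away from [0] the kernel is dominated by the geometric sequence of ratio
    [(1 + c) / (1 + c')], where [c'] lies strictly between [c] and [1]. *)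
Lemma kern_away (c : R) : c < 1 ->
  exists2 u : nat -> R, u @ \oo --> 0 & forall n v, cos v <= c -> kern n v <= u n.
Proof.
move=> c1; wlog cN1 : c c1 / -1 <= c.
  move=> H; have [|cN1] := leP (-1) c; first exact: H.
  have [||u u0 hu] := H (-1); [lra|by []|].
  by exists u => // n v vc; apply: hu; lra.
pose c' := (1 + c) / 2.
have [||eta eta0 h] := @kmass_lower c'; [rewrite /c'; lra|rewrite /c'; lra|].
have c'0 : 0 < 1 + c' by rewrite /c'; lra.
exists (fun n => eta^-1 * ((1 + c) / (1 + c')) ^+ n).
  apply: cvg_geometric; rewrite normrM normfV (gtr0_norm c'0) ger0_norm; last lra.
  by rewrite ltr_pdivrMr// mul1r /c'; lra.
move=> n v vc; rewrite /kern.
have -> : eta^-1 * ((1 + c) / (1 + c')) ^+ n = (eta * (1 + c') ^+ n)^-1 * (1 + c) ^+ n.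
  by rewrite exprMn exprVn invfM; ring.
have hp : 0 < eta * (1 + c') ^+ n by rewrite mulr_gt0// exprn_gt0.
apply: ler_pM => //.
- by rewrite invr_ge0 ltW// kmass_gt0.
- by rewrite lef_pV2// posrE// kmass_gt0.
apply: lerXn2r; rewrite ?nnegrE; last lra; last lra.
by rewrite -lerBlDl sub0r cos_geN1.
Qed.

Lemma conv_kern_bounded s n (v M : R) : mu.-integrable `[0, 2 * pi] (EFin \o s) ->
  (forall t : R, 0 <= t <= 2 * pi -> `|s t| <= M) -> `|conv s (kern n) v| <= M.
Proof.
move=> si sM; have ik := integrable_kern n v.
have ic := integrable_conv v si (trig_kern n).
rewrite /conv; apply: le_trans (le_normr_Rintegral _ ic) _ => //.
have -> : M = \int[mu]_(t in `[0, 2 * pi]) (M * kern n (v - t)).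
  by rewrite RintegralZl// kern_int mulr1.
apply: Rintegral_integrable_le.
- exact: integrable_norm ic.
- exact: integrable_itvZ.
- move=> t tI; rewrite normrM (ger0_norm (kern_ge0 _ _)) ler_wpM2r ?kern_ge0//.
  exact: sM.
Qed.

(** Convergence to [l] requires only that [s] is bounded and close to [l] near [v]
    on the circle, a neighbourhood being given by a lower bound on [cos (v - t)].
    This covers both continuous functions and indicators of intervals. *)
Lemma conv_kern_cvg s (v l M : R) : mu.-integrable `[0, 2 * pi] (EFin \o s) ->
  (forall t : R, 0 <= t <= 2 * pi -> `|s t| <= M) ->
  (forall e : R, 0 < e -> exists2 c : R, c < 1 & forall t : R, 0 <= t <= 2 * pi ->
     c < cos (v - t) -> `|s t - l| <= e) ->
  (fun n => conv s (kern n) v) @ \oo --> l.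
Proof.
move=> si sM sl; apply/cvgrPdist_le => e e0.
have e20 : 0 < e / 2 by rewrite divr_gt0.
have [c [c1 cN1 hc]] : exists c : R, [/\ c < 1, -1 <= c & forall t : R, 0 <= t <= 2 * pi ->
     c < cos (v - t) -> `|s t - l| <= e / 2].
  have [c c1 hc] := sl _ e20; exists (Num.max c (-1)); split.
  - by rewrite gt_max c1/=; lra.
  - by rewrite le_max lexx orbT.
  - by move=> t tI; rewrite gt_max => /andP[ct _]; exact: hc.
have [u u0 hu] := kern_away c1.
pose K := M + `|l|.
have K0 : 0 <= K.
  have h0 : (0 : R) <= 0 <= 2 * (pi : R) by rewrite lexx pi2_ge0.
  by rewrite addr_ge0// (le_trans _ (sM 0 h0)).
have : (fun n => 2 * pi * (K * u n)) @ \oo --> 2 * pi * (K * 0).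
  by apply: cvgMr; apply: cvgMr; exact: u0.
rewrite mulr0 mulr0 => /cvgrPdist_le/(_ _ e20).
apply: filterS => n; rewrite sub0r normrN => un.
have ik := integrable_kern n v.
have ic := integrable_conv v si (trig_kern n).
have ilk := integrable_itvZ (- l) ik.
have iD : mu.-integrable `[0, 2 * pi] (EFin \o (fun t => (s t - l) * kern n (v - t))).
  have := integrable_itvD ic ilk; congr integrable.
  by apply/funext => t /=; rewrite mulrBl mulNr.
have -> : l - conv s (kern n) v = - \int[mu]_(t in `[0, 2 * pi]) ((s t - l) * kern n (v - t)).
  have -> : \int[mu]_(t in `[0, 2 * pi]) ((s t - l) * kern n (v - t)) =
     \int[mu]_(t in `[0, 2 * pi]) (s t * kern n (v - t) + - l * kern n (v - t)).
    by apply: eq_Rintegral => t _; rewrite mulrBl mulNr.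
  rewrite RintegralD; [|exact: measurable_itv|exact: ic|exact: ilk].
  rewrite RintegralZl; [|exact: measurable_itv|exact: ik].
  by rewrite kern_int /conv; ring.
rewrite normrN; apply: le_trans (le_normr_Rintegral _ iD) _ => //.
have icst (a : R) : mu.-integrable `[0, 2 * pi] (EFin \o (fun=> a)).
  by apply: integrable_continuous => t; exact: cvg_cst.
apply: (@le_trans _ _ (\int[mu]_(t in `[0, 2 * pi]) (e / 2 * kern n (v - t) + K * u n))).
  apply: Rintegral_integrable_le.
  - exact: integrable_norm iD.
  - by apply: integrable_itvD; [exact: integrable_itvZ|exact: icst].
  - move=> t tI; rewrite normrM (ger0_norm (kern_ge0 _ _)).
    have un0 : 0 <= u n by rewrite (le_trans (kern_ge0 n pi))// hu// cospi.
    have [h|h] := ltP c (cos (v - t)).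
      apply: ler_wpDr; first exact: mulr_ge0.
      by rewrite ler_wpM2r ?kern_ge0// hc.
    apply: ler_wpDl; first by rewrite mulr_ge0 ?kern_ge0// ltW.
    apply: ler_pM; rewrite ?kern_ge0//; last exact: hu.
    by rewrite (le_trans (ler_normB _ _))// lerD2r sM.
rewrite RintegralD; [|exact: measurable_itv|exact: integrable_itvZ|exact: icst].
have -> : \int[mu]_(t in `[0, 2 * pi]) (e / 2 * kern n (v - t)) = e / 2.
  by rewrite RintegralZl// kern_int mulr1.
rewrite Rintegral_cst//= lebesgue_measure_itv/= lte_fin pi2 oppr0 addr0/=.
rewrite [_ * (2 * pi)]mulrC.
have := le_trans (ler_norm _) un; lra.
Qed.

Lemma cos_near (v t d : R) : 0 < d -> d <= pi -> cos d < cos (v - t) ->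
  exists k : int, `|t + (2 * pi) *~ k - v| < d.
Proof.
move=> d0 dpi; have [k hk] := reduce_mod2pi t v; exists k.
rewrite ltNge; apply/negP => dk.
have e : cos (v - t) = cos `|t + (2 * pi) *~ k - v|.
  have -> : cos `|t + (2 * pi) *~ k - v| = cos (t + (2 * pi) *~ k - v).
    by case: (ger0P (t + (2 * pi) *~ k - v)) => _ //; rewrite cosN.
  rewrite -cosN opprB addrAC periodicz//.
  exact: cos_periodic.
suff : cos (v - t) <= cos d by rewrite leNgt => /negP; apply.
rewrite e.
have h1 : d \in `[0, pi] by rewrite in_itv/= (ltW d0).
have h2 : `|t + (2 * pi) *~ k - v| \in `[0, pi] by rewrite in_itv/= normr_ge0.
rewrite leNgt; apply/negP; rewrite ltr_cos//.
by rewrite ltNge dk.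
Qed.

Lemma cos_lt1 (d : R) : 0 < d -> d <= pi -> cos d < 1.
Proof.
move=> d0 dpi; rewrite -cos0 ltr_cos//; first by rewrite in_itv/= lexx (ltW pi0).
by rewrite in_itv/= (ltW d0).
Qed.

Lemma conv_kern_continuous s v : continuous s -> periodic s (2 * pi) ->
  (fun n => conv s (kern n) v) @ \oo --> s v.
Proof.
move=> cs ps; have [M sM] := @continuous_bounded_itv R 0 (2 * pi) s cs.
apply: (@conv_kern_cvg s v (s v) M) => //; first exact: integrable_continuous.
move=> e e0; have := cs v => /cvgrPdist_lt/(_ _ e0)[r /= r0 hr].
pose d := Num.min r pi.
have d0 : 0 < d by rewrite lt_min r0 pi0.
have dpi : d <= pi by rewrite ge_min lexx orbT.
exists (cos d); first exact: cos_lt1.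
move=> t _ /(cos_near d0 dpi)[k].
rewrite lt_min => /andP[h _].
have := hr (t + (2 * pi) *~ k); rewrite /= distrC => /(_ h) /ltW.
by rewrite (periodicz ps) distrC.
Qed.

Lemma indic_itv_bounded (x t : R) : `|\1_(`[0, x]%classic) t : R| <= 1.
Proof. by rewrite indicE; case: (_ \in _); rewrite ?normr1 ?normr0. Qed.

Lemma integrable_indic_itv (x : R) :
  mu.-integrable `[0, 2 * pi] (EFin \o (\1_(`[0, x]%classic) : R -> R)).
Proof.
have m1 : measurable_fun `[0, 2 * pi] (\1_(`[0, x]%classic) : R -> R).
  exact: measurable_indic.
have ic : mu.-integrable `[0, 2 * pi] (EFin \o (cst 1 : R -> R)).
  by apply: integrable_continuous => t; exact: cvg_cst.
have := @integrable_itvM _ _ _ 1 _ _ ic m1 (fun t _ => indic_itv_bounded x t).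
by congr integrable; apply/funext => t /=; rewrite mul1r.
Qed.

Lemma conv_kern_step (x v : R) : 0 < x < 2 * pi -> 0 < v < 2 * pi -> v <> x ->
  (fun n => conv (\1_(`[0, x]%classic) : R -> R) (kern n) v) @ \oo --> (\1_(`[0, x]%classic) v : R).
Proof.
move=> /andP[x0 x2] /andP[v0 v2] vx.
have b1 := @indic_itv_bounded x; have i1 := integrable_indic_itv x.
apply: (@conv_kern_cvg _ _ _ 1) => // e e0.
pose d := Num.min (Num.min `|v - x| v) (Num.min (2 * pi - v) pi).
have d0 : 0 < d.
  rewrite !lt_min v0 pi0 subr_gt0 v2 normr_gt0 subr_eq0 !andbT.
  exact/eqP.
have dpi : d <= pi by rewrite !ge_min lexx !orbT.
exists (cos d); first exact: cos_lt1.
move=> t /andP[t0 t2] /(cos_near d0 dpi)[k].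
rewrite !lt_min => /andP[/andP[h1 h2] /andP[h3 h4]].
(* [d] is at most the distance from [v] to both ends of the period, so that no
   translate by a nonzero period comes close to [v]. *)
have k0 : k = 0.
  have k1 : (k < 1)%R.
    rewrite ltNge; apply/negP => kge.
    have : (2 * pi : R) <= (2 * pi) *~ k.
      by rewrite -[leLHS]mulr1z ler_pMz2l.
    by move: h3; rewrite ltr_norml; lra.
  have k2 : (-1 < k)%R.
    rewrite ltNge; apply/negP => kle.
    have : (2 * pi) *~ k <= - (2 * pi : R).
      by rewrite -mulrN1z ler_pMz2l.
    by move: h2; rewrite ltr_norml; lra.
  by apply/eqP; rewrite eq_le -ltzD1 add0r k1/= -(addNr (1 : int)) lezD1.
move: h1; rewrite k0 mulr0z addr0 => h1.
suff -> : (\1_(`[0, x]%classic) t : R) = \1_(`[0, x]%classic) v by rewrite subrr normr0 ltW.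
rewrite !indicE; congr (_%:R); congr nat_of_bool.
rewrite !mem_setE !in_itv/= t0 (ltW v0)/=.
have [xv|vx'] := ltP x v.
  move: h1; rewrite (gtr0_norm (x := v - x)) ?subr_gt0// ltr_norml => /andP[h1 _].
  rewrite leNgt; apply/negbTE; rewrite negbK; lra.
have {vx'}vx' : v < x by rewrite lt_neqAle vx' andbT; apply/eqP.
move: h1; rewrite (ltr0_norm (x := v - x)) ?subr_lt0// ltr_norml => /andP[_ h1].
lra.
Qed.

(** * Uniqueness of weak derivatives *)

(** Indicators of intervals are bounded limits almost everywhere of trigonometric
    polynomials, so that a function orthogonal to the latter has vanishing
    integrals over intervals. *)
Lemma orthogonal_primitive z (x : R) : mu.-integrable `[0, 2 * pi] (EFin \o z) ->
  (forall N J, trig N J -> \int[mu]_(t in `[0, 2 * pi]) (z t * J t) = 0) ->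
  0 <= x <= 2 * pi ->
  \int[mu]_(t in `[0, x]) z t = 0.
Proof.
move=> zi zJ /andP[]; rewrite le_eqVlt => /predU1P[<- _|x0].
  by rewrite set_itv1 Rintegral_set1.
rewrite le_eqVlt => /predU1P[->|x2].
  transitivity (\int[mu]_(t in `[0, 2 * pi]) (z t * 1)).
    by apply: eq_Rintegral => t _; rewrite mulr1.
  exact: (zJ _ _ (trig_cst 1 (ltnSn 0))).
pose p : R -> R := \1_(`[0, x]%classic).
have ip : mu.-integrable `[0, 2 * pi] (EFin \o p) by exact: integrable_indic_itv.
have pb t : `|p t| <= 1 by exact: indic_itv_bounded.
have -> : \int[mu]_(t in `[0, x]) z t = \int[mu]_(t in `[0, 2 * pi]) (z t * p t).
  have -> : `[0, x]%classic = `[0, 2 * pi] `&` `[0, x] :> set R.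
    by apply/esym/setIidPr; apply: subset_itvl; rewrite bnd_simp ltW.
  rewrite Rintegral_mkcondr; apply: eq_Rintegral => t _.
  by rewrite /p indicE patchE; case: (t \in _); rewrite ?mulr1 ?mulr0.
have tcp n : trig n.+1 (conv p (kern n)) by apply: trig_conv => //; exact: trig_kern.
have cv : (fun n => \int[mu]_(t in `[0, 2 * pi]) (z t * conv p (kern n) t)) @ \oo -->
    \int[mu]_(t in `[0, 2 * pi]) (z t * p t).
  have mz : measurable_fun `[0, 2 * pi] z.
    by have /integrableP[/measurable_EFinP] := zi.
  apply: (@Rintegral_dominated_cvg _ _ _ _ _ (fun t => `|z t|)).
  - move=> n; apply: measurable_funM => //; apply: measurable_funTS.
    by apply: continuous_measurable_fun; exact: trig_continuous (tcp n).
  - by apply: measurable_funM => //; exact: measurable_indic.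
  - have := ae_neq (2 * pi : R); have := ae_neq (0 : R); have := ae_neq x.
    apply: filterS3; first exact: (ae_filter_ringOfSetsType mu).
    move=> t tx t0 t2 /andP[t0' t2'].
    apply: cvgMr; apply: conv_kern_step => //; first by rewrite x0.
    rewrite !lt_neqAle t0' t2' !andbT; apply/andP; split; last exact/eqP.
    by apply/eqP => e; apply: t0.
  - exact: integrable_norm zi.
  - move=> n t tI; rewrite normrM ler_piMr//.
    by apply: conv_kern_bounded => //.
have e n : \int[mu]_(t in `[0, 2 * pi]) (z t * conv p (kern n) t) = 0.
  have k0 : (fun v => kern n (- v)) = kern n :> (R -> R) by apply/funext => v; rewrite kernN.
  rewrite -{1}k0 -(conv_exchange zi ip (trig_kern n)).
  transitivity (\int[mu]_(v in `[0, 2 * pi]) (cst 0 v : R)); last first.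
    by rewrite Rintegral_cst// mul0r.
  apply: eq_Rintegral => v _; rewrite /= /conv (zJ _ _ (trig_reflect v (trig_kern n))).
  by rewrite mulr0.
move: cv; under eq_fun do rewrite e.
by move=> /cvg_lim <-//; rewrite lim_cst.
Qed.

(** The primitive of [z] vanishes identically, and Lebesgue differentiation
    recovers [z] from it almost everywhere. *)
Lemma orthogonal_ae0 z : mu.-integrable `[0, 2 * pi] (EFin \o z) ->
  (forall N J, trig N J -> \int[mu]_(t in `[0, 2 * pi]) (z t * J t) = 0) ->
  {ae mu, forall t : R, 0 <= t <= 2 * pi -> z t = 0}.
Proof.
move=> zi zJ.
pose w := z \_ `[0, 2 * pi]%classic.
have wT : mu.-integrable setT (EFin \o w).
  by rewrite /w -restrict_EFin; apply/integrable_restrict => //; rewrite setTI.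
have wi (y : R) : mu.-integrable `]-oo, y] (EFin \o w) by apply: integrableS wT.
have li : locally_integrable [set: R] w by apply: integrable_locally.
have := FTC1Ny wi li; cbv zeta.
have F0 : (fun x : R => \int[mu]_(t in [set` `]-oo, x]]) w t) = cst 0.
  apply/funext => x; rewrite /w -Rintegral_mkcondr.
  have -> : `]-oo, x] `&` `[0, 2 * pi] = `[0, Num.min x (2 * pi)]%classic :> set R.
    apply/seteqP; split => t /=; rewrite !in_itv/= le_min.
      by move=> [-> /andP[-> ->]].
    by move=> /andP[-> /andP[-> ->]].
  have [x0|x0] := ltP x 0.
    by rewrite set_itv_ge ?Rintegral_set0// bnd_simp -ltNge gt_min x0.
  by apply: orthogonal_primitive => //; rewrite le_min x0 pi2_ge0 ge_min lexx orbT.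
rewrite F0; apply: filterS; first exact: (ae_filter_ringOfSetsType mu).
by move=> t [_] + tI; rewrite derive1_cst /w patchE mem_set//=.
Qed.

Lemma weak_derivative_unique k f g h : is_weak_derivative k f g -> is_weak_derivative k f h ->
  {ae mu, forall t : R, 0 <= t <= 2 * pi -> g t = h t}.
Proof.
move=> [Lg wg] [Lh wh].
have gi := L2_integrable Lg; have hi := L2_integrable Lh.
have zi : mu.-integrable `[0, 2 * pi] (EFin \o (fun t => g t + (-1) * h t)).
  by apply: integrable_itvD => //; exact: integrable_itvZ.
have := orthogonal_ae0 zi; case.
  move=> N J tJ; have tp := trig_test tJ.
  have e : \int[mu]_(t in `[0, 2 * pi]) (g t * J t) = \int[mu]_(t in `[0, 2 * pi]) (h t * J t).
    have : (-1) ^+ k != 0 :> R by rewrite signr_eq0.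
    by move=> /mulfI; apply; rewrite -wg// -wh.
  have ig := integrableM_trig gi tJ; have ih := integrableM_trig hi tJ.
  have -> : \int[mu]_(t in `[0, 2 * pi]) ((g t + -1 * h t) * J t) =
      \int[mu]_(t in `[0, 2 * pi]) (g t * J t - h t * J t).
    by apply: eq_Rintegral => t _; ring.
  by rewrite RintegralB// e subrr.
move=> A [mA A0 hA]; exists A; split => // t /= ht; apply: hA => /= h0; apply: ht => tI.
by have := h0 tI; lra.
Qed.

(** * Trigonometric polynomials in the anisotropy cone *)

Lemma L2_sqr_integrable g : L2_per g ->
  mu.-integrable `[0, 2 * pi] (EFin \o (fun t => g t ^+ 2)).
Proof. by case. Qed.

Lemma wulff_areaE s : L2_per s -> (exists g, is_weak_derivative 1 s g) ->
  wulff_area s = 2^-1 * (\int[mu]_(t in `[0, 2 * pi]) (s t ^+ 2) -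
    \int[mu]_(t in `[0, 2 * pi]) (weak_derivative 1 s t ^+ 2)).
Proof.
move=> Ls /weak_derivativeP[Lw _]; rewrite /wulff_area -RintegralB//.
- by congr (_ * _); apply: eq_Rintegral => t _; rewrite !real_normK ?num_real.
- exact: L2_sqr_integrable.
- exact: L2_sqr_integrable.
Qed.

Lemma trig_wulff_area1 N f f' : trig N f -> trig N f' ->
  (forall t : R, is_derive t 1 f (f' t)) ->
  wulff_area f = 2^-1 * (\int[mu]_(t in `[0, 2 * pi]) (f t ^+ 2) -
    \int[mu]_(t in `[0, 2 * pi]) (f' t ^+ 2)).
Proof.
move=> tf tf' df; have w1 := trig_weak1 tf tf' df.
have ex : exists g, is_weak_derivative 1 f g by exists f'.
rewrite wulff_areaE//; last exact: trig_L2 tf.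
have [[_ mw _] _] := weak_derivativeP ex.
congr (_ * (_ - _)); apply: Rintegral_ae_eq.
- by apply: measurable_funTS; apply: measurable_funX.
- apply: measurable_funTS; apply: measurable_funX; apply: continuous_measurable_fun.
  exact: trig_continuous tf'.
- have := weak_derivative_unique (weak_derivativeP ex) w1.
  apply: filterS; first exact: (ae_filter_ringOfSetsType mu).
  by move=> t h tI; rewrite h.
Qed.

(** [weak_derivative] selects some weak derivative, which agrees with the classical
    one almost everywhere by uniqueness; integration by parts then replaces
    [- f'^2] by [f f'']. *)
Lemma trig_wulff_area N f f' f'' : trig N f -> trig N f' -> trig N f'' ->
  (forall t : R, is_derive t 1 f (f' t)) -> (forall t : R, is_derive t 1 f' (f'' t)) ->
  wulff_area f = 2^-1 * \int[mu]_(t in `[0, 2 * pi]) (f t * (f t + f'' t)).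
Proof.
move=> tf tf' tf'' df df'; rewrite (trig_wulff_area1 tf tf' df).
have cf := trig_continuous tf; have cf' := trig_continuous tf'; have cf'' := trig_continuous tf''.
have ibp := ibp_periodic df df' cf' cf'' (trig_periodic tf) (trig_periodic tf').
have -> : \int[mu]_(t in `[0, 2 * pi]) (f t * (f t + f'' t)) =
    \int[mu]_(t in `[0, 2 * pi]) (f t ^+ 2 + f t * f'' t).
  by apply: eq_Rintegral => t _; ring.
rewrite RintegralD//; first by rewrite ibp.
- by apply: integrable_continuous => t; apply: cvgM; exact: cf.
- by apply: integrable_continuous => t; apply: cvgM; [exact: cf|exact: cf''].
Qed.

Lemma trig_cone N f f' f'' : trig N f -> trig N f' -> trig N f'' ->
  (forall t : R, is_derive t 1 f (f' t)) -> (forall t : R, is_derive t 1 f' (f'' t)) ->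
  (forall t, 0 <= f t) -> (forall t, 0 <= f t + f'' t) -> anisotropy_cone f.
Proof.
move=> tf tf' tf'' df df' f0 r0.
have w2 := trig_weak2 tf tf' tf'' df df'.
split.
- split; [exact: trig_continuous tf|exact: trig_L2 tf|].
  case=> [|[|[|//]]] _.
  + by exists f; exact: trig_weak0 tf.
  + by exists f'; exact: trig_weak1 tf tf' df.
  + by exists f''.
- by apply: aeW.
- have ex : exists g, is_weak_derivative 2 f g by exists f''.
  have := weak_derivative_unique (weak_derivativeP ex) w2.
  apply: filterS; first exact: (ae_filter_ringOfSetsType mu).
  by move=> t h; rewrite in_itv/= => tI; rewrite h.
Qed.

(** Jensen's inequality: the integral of [(g - m)^2] against the probability density
    [kern n (v - t)], [m] being the mean of [g], is nonnegative. *)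
Lemma conv_kern_jensen n g v : mu.-integrable `[0, 2 * pi] (EFin \o g) ->
  mu.-integrable `[0, 2 * pi] (EFin \o (fun t => g t ^+ 2)) ->
  (conv g (kern n) v) ^+ 2 <= conv (fun t => g t ^+ 2) (kern n) v.
Proof.
move=> gi g2i; set m := conv g (kern n) v.
have ik := integrable_kern n v.
have i1 := integrable_conv v gi (trig_kern n).
have i2 := integrable_conv v g2i (trig_kern n).
have : 0 <= \int[mu]_(t in `[0, 2 * pi]) ((g t - m) ^+ 2 * kern n (v - t)).
  by apply: Rintegral_ge0 => t _; rewrite mulr_ge0 ?sqr_ge0 ?kern_ge0.
have -> : \int[mu]_(t in `[0, 2 * pi]) ((g t - m) ^+ 2 * kern n (v - t)) =
   \int[mu]_(t in `[0, 2 * pi]) (g t ^+ 2 * kern n (v - t) +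
     ((- 2 * m) * (g t * kern n (v - t)) + m ^+ 2 * kern n (v - t))).
  by apply: eq_Rintegral => t _; ring.
have j1 := integrable_itvZ (- 2 * m) i1; have j2 := integrable_itvZ (m ^+ 2) ik.
rewrite RintegralD; [|exact: measurable_itv|exact: i2|exact: integrable_itvD j1 j2].
rewrite RintegralD; [|exact: measurable_itv|exact: j1|exact: j2].
have -> : \int[mu]_(t in `[0, 2 * pi]) (m ^+ 2 * kern n (v - t)) = m ^+ 2.
  by rewrite RintegralZl// kern_int mulr1.
have -> : \int[mu]_(t in `[0, 2 * pi]) (-2 * m * (g t * kern n (v - t))) = - 2 * m * m.
  by rewrite RintegralZl//.
rewrite -[X in X + _]/(conv (fun t => g t ^+ 2) (kern n) v).
by set c := conv _ _ _; lra.
Qed.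

(** Jensen's inequality is integrated in [v]; the kernel, even and of integral [1],
    then disappears. *)
Lemma conv_kern_contraction n g : mu.-integrable `[0, 2 * pi] (EFin \o g) ->
  mu.-integrable `[0, 2 * pi] (EFin \o (fun t => g t ^+ 2)) ->
  \int[mu]_(v in `[0, 2 * pi]) (conv g (kern n) v ^+ 2) <=
  \int[mu]_(t in `[0, 2 * pi]) (g t ^+ 2).
Proof.
move=> gi g2i.
have ic : mu.-integrable `[0, 2 * pi] (EFin \o (cst 1 : R -> R)).
  by apply: integrable_continuous => t; exact: cvg_cst.
have t1 := trig_conv gi (trig_kern n); have t2 := trig_conv g2i (trig_kern n).
have c1 := trig_continuous t1; have c2 := trig_continuous t2.
apply: (@le_trans _ _ (\int[mu]_(v in `[0, 2 * pi]) (cst 1 v * conv (fun t => g t ^+ 2) (kern n) v))).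
  apply: Rintegral_integrable_le.
  - by apply: integrable_continuous => t; apply: cvgM; exact: c1.
  - by apply: integrable_continuous => t; apply: cvgM; [exact: cvg_cst|exact: c2].
  - by move=> t _; rewrite mul1r; exact: conv_kern_jensen.
rewrite (conv_exchange g2i ic (trig_kern n)) le_eqVlt; apply/orP; left; apply/eqP.
apply: eq_Rintegral => t _.
have -> : (fun v => kern n (- v)) = kern n :> (R -> R) by apply/funext => v; rewrite kernN.
rewrite /conv (_ : Rintegral _ _ _ = 1) ?mulr1//.
rewrite -[RHS](kern_int n t).
by apply: eq_Rintegral => u _; rewrite mul1r.
Qed.

Section ComplexForm.
Local Open Scope complex_scope.

(** The sum over [j < 2 N - 1] runs over the integers from [1 - N] to [N - 1], each
    taken once. *)
Lemma sum_int_delta (C : comNzRingType) N (m : int) (F : int -> C) : (`|m|%N < N)%N ->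
  \sum_(j < N.*2.-1) ((j%:Z - N.-1%:Z == m)%:R * F (j%:Z - N.-1%:Z)) = F m.
Proof.
move=> mN.
have h0 : m + N.-1%:Z = `|(m + N.-1%:Z)%R|%N%:Z.
  by rewrite gez0_abs//; lia.
have hj : (`|(m + N.-1%:Z)%R|%N < N.*2.-1)%N by lia.
rewrite (bigD1 (Ordinal hj))//= -h0 addrK eqxx mul1r big1 ?addr0// => j jn.
have -> : (j%:Z - N.-1%:Z == m) = false; last by rewrite mul0r.
apply/negbTE; apply: contra jn => /eqP e; apply/eqP/val_inj => /=.
by rewrite -e subrK absz_nat.
Qed.

Definition hermitian_sum N f := exists2 c : int -> R[i],
  (forall k : int, c (- k) = conjc (c k)) &
  forall v, (f v)%:C = \sum_(j < N.*2.-1)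
     let k := j%:Z - N.-1%:Z in c k * expi (k%:~R * v).

(** A pair of conjugate terms of degrees [k] and [- k].  When [k = 0] the two
    coefficients add up in the same place. *)
Lemma hermitian_delta N k (a b : R[i]) f : (k < N)%N -> b = conjc a ->
  (forall v, (f v)%:C = a * expi (k%:R * v) + b * expi (- (k%:R * v))) ->
  hermitian_sum N f.
Proof.
move=> kN ab fE.
exists (fun m => (m == k%:Z)%:R * a + (m == - k%:Z)%:R * b).
  have cD (x y : R[i]) : conjc (x + y) = conjc x + conjc y.
    by case: x y => [x1 x2] [y1 y2]; apply/eqP; rewrite eq_complex/= opprD !eqxx.
  have cb (d : bool) (x : R[i]) : conjc (d%:R * x) = d%:R * conjc x.
    case: d; rewrite ?mul1r ?mul0r//.
    by apply/eqP; rewrite eq_complex/= oppr0 !eqxx.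
  move=> m; rewrite cD !cb ab conjcK addrC; congr (_%:R * _ + _%:R * _).
    by rewrite eqr_opp.
  by rewrite eqr_oppLR.
move=> v; rewrite fE /=.
under eq_bigr do rewrite mulrDl -mulrA -[X in _ + X]mulrA.
rewrite big_split/=.
rewrite (@sum_int_delta _ N k%:Z (fun m => a * expi (m%:~R * v))); last by rewrite absz_nat.
rewrite (@sum_int_delta _ N (- k%:Z) (fun m => b * expi (m%:~R * v))); last by rewrite abszN absz_nat.
by rewrite mulrNz mulNr.
Qed.

Lemma trig_hermitian N f : trig N f -> hermitian_sum N f.
Proof.
elim=> [k kN|k kN|g h _ [cg hg eg] _ [ch hh eh]|c g _ [cg hg eg]].
- apply: (@hermitian_delta N k (2^-1)%:C (2^-1)%:C) => //.
    by apply/eqP; rewrite eq_complex/= oppr0 !eqxx.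
  move=> v; rewrite /expi cosN sinN; apply/eqP; rewrite eq_complex/=.
  by apply/andP; split; apply/eqP; field.
- apply: (@hermitian_delta N k (0 -i* 2^-1) (0 +i* 2^-1)) => //.
    by apply/eqP; rewrite eq_complex/= opprK !eqxx.
  move=> v; rewrite /expi cosN sinN; apply/eqP; rewrite eq_complex/=.
  by apply/andP; split; apply/eqP; field.
- exists (fun k : int => cg k + ch k) => [k|v]; first by rewrite hg hh rmorphD.
  by rewrite rmorphD/= eg eh -big_split/=; apply: eq_bigr => j _; rewrite mulrDl.
- exists (fun k : int => c%:C * cg k) => [k|v].
    rewrite hg rmorphM; congr (_ * _).
    by apply/eqP; rewrite eq_complex/= oppr0 !eqxx.
  by rewrite rmorphM/= eg big_distrr/=; apply: eq_bigr => j _; rewrite mulrA.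
Qed.

Lemma trig_cone_trig N f f' f'' : trig N f -> trig N f' -> trig N f'' ->
  (forall t : R, is_derive t 1 f (f' t)) -> (forall t : R, is_derive t 1 f' (f'' t)) ->
  (forall t, 0 <= f t) -> (forall t, 0 <= f t + f'' t) -> anisotropy_cone_trig N f.
Proof.
move=> tf tf' tf'' df df' f0 r0; split; first exact: trig_cone tf tf' tf'' df df' f0 r0.
exact: trig_hermitian.
Qed.

End ComplexForm.

(** * Density of trigonometric polynomials in the cone *)

(** Translated kernels are test functions, so that a derivative of a convolution
    falls on the kernel or, weakly, on [s]. *)
Lemma conv_weak2 s g N J J' J'' : is_weak_derivative 2 s g ->
  trig N J -> (forall t : R, is_derive t 1 J (J' t)) -> (forall t : R, is_derive t 1 J' (J'' t)) ->
  forall v, conv s J'' v = conv g J v.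
Proof.
move=> [Lg wg] tJ dJ dJ' v.
have dJv (t : R) : is_derive t 1 (fun t => J (v - t)) (- J' (v - t)).
  by have := dJ (v - t) => ?; apply: is_derive_eq; ring.
have dJv' (t : R) : is_derive t 1 (fun t => - J' (v - t)) (J'' (v - t)).
  by have := dJ' (v - t) => ?; apply: is_derive_eq; ring.
have := wg _ (trig_test (trig_reflect v tJ)).
by rewrite derive1nS derive1n1 (derive1_eq dJv) (derive1_eq dJv') sqrrN expr1n mul1r.
Qed.

Lemma conv_weak1 s g N J J' : mu.-integrable `[0, 2 * pi] (EFin \o s) ->
  is_weak_derivative 1 s g ->
  trig N J -> trig N J' -> (forall t : R, is_derive t 1 J (J' t)) ->
  forall v, conv s J' v = conv g J v.
Proof.
move=> si [Lg wg] tJ tJ' dJ v.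
have dJv (t : R) : is_derive t 1 (fun t => J (v - t)) (- J' (v - t)).
  by have := dJ (v - t) => ?; apply: is_derive_eq; ring.
have := wg _ (trig_test (trig_reflect v tJ)).
rewrite derive1n1 (derive1_eq dJv) expr1 mulN1r => e.
apply: oppr_inj; rewrite /conv -e -mulN1r -RintegralZl//; last exact: integrable_conv tJ'.
by apply: eq_Rintegral => t _; rewrite mulN1r mulrN.
Qed.

(** The approximants are [conv s (kern n) + 1 / (n + 1)].  Convolution with a
    nonnegative kernel preserves both inequalities that define the cone, and the
    additive constant makes the second one strict.  For the Wulff area, the
    integral of [t_n^2] converges by bounded convergence, while that of [t_n'^2] is
    at most that of [s'^2] by Jensen's inequality: hence the sequence [W], a lower
    bound of the areas that converges to the area of [s]. *)
Lemma cone_approx s : anisotropy_cone s ->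
  exists t_ t_' t_'' : nat -> R -> R, exists W : nat -> R, exists M : R,
  (forall n, [/\ trig n.+1 (t_ n), trig n.+1 (t_' n), trig n.+1 (t_'' n),
     forall v : R, is_derive v 1 (t_ n) (t_' n v) &
     forall v : R, is_derive v 1 (t_' n) (t_'' n v)]) /\
  (forall n v, 0 <= t_ n v /\ 0 < t_ n v + t_'' n v) /\
  [/\ forall v, t_ ^~ v @ \oo --> s v,
      forall n v, `|t_ n v| <= M,
      W @ \oo --> wulff_area s &
      forall n, W n <= wulff_area (t_ n)].
Proof.
move=> [[cs Ls ws] s0 r0].
have [ps _ _] := Ls.
have w1 := weak_derivativeP (ws 1%N isT).
have w2 := weak_derivativeP (ws 2%N isT).
set g1 := weak_derivative 1 s in w1; set g2 := weak_derivative 2 s in w2 r0.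
have [Lg1 _] := w1; have [Lg2 _] := w2.
have si := L2_integrable Ls; have g1i := L2_integrable Lg1; have g2i := L2_integrable Lg2.
have /choice[k' hk'] : forall n, exists k' : R -> R, [/\ trig n.+1 k', forall v : R, is_derive v 1 (kern n) (k' v) &
    forall s, mu.-integrable `[0, 2 * pi] (EFin \o s) ->
      forall v : R, is_derive v 1 (conv s (kern n)) (conv s k' v)].
  by move=> n; exact: is_derive_conv (trig_kern n).
have /choice[k'' hk''] : forall n, exists k'' : R -> R, [/\ trig n.+1 k'', forall v : R, is_derive v 1 (k' n) (k'' v) &
    forall s, mu.-integrable `[0, 2 * pi] (EFin \o s) ->
      forall v : R, is_derive v 1 (conv s (k' n)) (conv s k'' v)].
  by move=> n; have [tk' _ _] := hk' n; exact: is_derive_conv tk'.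
pose e n : R := n.+1%:R^-1.
have e0 n : 0 < e n by rewrite invr_gt0 ltr0n.
have cve : e @ \oo --> 0.
  exact: cvg_harmonic.
pose t_ n v := conv s (kern n) v + e n.
have ct_ v : t_ ^~ v @ \oo --> s v.
  rewrite -[X in _ --> X]addr0; apply: cvgD => //.
  exact: conv_kern_continuous.
have [M sM] := @continuous_bounded_itv R 0 (2 * pi) s cs.
have tM n v : `|t_ n v| <= M + 1.
  rewrite (le_trans (ler_normD _ _))// lerD//.
    by apply: conv_kern_bounded.
  by rewrite gtr0_norm// invf_le1 ?ltr0n// ler1n.
have c0 n v : 0 <= conv s (kern n) v.
  apply: Rintegral_ae_ge0; first exact: integrable_conv (trig_kern n).
  apply: filterS s0; first exact: (ae_filter_ringOfSetsType mu).
  by move=> t + tI; rewrite in_itv/= => h; rewrite mulr_ge0 ?kern_ge0// h.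
have c2E n v : conv s (k'' n) v = conv g2 (kern n) v.
  have [tk' dk' _] := hk' n; have [tk'' dk'' _] := hk'' n.
  exact: (conv_weak2 w2 (trig_kern n) dk' dk'').
have r1 n v : 0 <= conv s (kern n) v + conv s (k'' n) v.
  have i1 := integrable_conv v si (trig_kern n).
  have i2 := integrable_conv v g2i (trig_kern n).
  rewrite c2E /conv -RintegralD//; apply: Rintegral_ae_ge0; first exact: integrable_itvD.
  apply: filterS r0; first exact: (ae_filter_ringOfSetsType mu).
  by move=> t + tI; rewrite in_itv/= => h; rewrite -mulrDl mulr_ge0 ?kern_ge0// h.
pose W n := 2^-1 * (\int[mu]_(t in `[0, 2 * pi]) (t_ n t ^+ 2) -
    \int[mu]_(t in `[0, 2 * pi]) (g1 t ^+ 2)).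
have T n : [/\ trig n.+1 (t_ n), trig n.+1 (conv s (k' n)), trig n.+1 (conv s (k'' n)),
     forall v : R, is_derive v 1 (t_ n) (conv s (k' n) v) &
     forall v : R, is_derive v 1 (conv s (k' n)) (conv s (k'' n) v)].
  have [tk' dk' ck'] := hk' n; have [tk'' dk'' ck''] := hk'' n.
  split; [|exact: trig_conv|exact: trig_conv| |].
  - by apply: trig_add; [apply: trig_conv => //; exact: trig_kern|exact: trig_cst].
  - by move=> v; have := ck' _ si v => ?; apply: is_derive_eq; rewrite addr0.
  - by move=> v; exact: (ck'' _ si v).
exists t_, (fun n => conv s (k' n)), (fun n => conv s (k'' n)), W, (M + 1).
split; first exact: T.
split.
  move=> n v; rewrite /t_; have := c0 n v; have := r1 n v; have := e0 n => h1 h2 h3.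
  by split; lra.
split => //.
- rewrite wulff_areaE//; last by exists g1.
  apply: cvgMr; apply: cvgB; last exact: cvg_cst.
  apply: (@Rintegral_bounded_cvg R 0 (2 * pi) ((M + 1) ^+ 2) (fun n t => t_ n t ^+ 2)).
  + move=> n; apply: measurable_funTS; apply: measurable_funX; apply: continuous_measurable_fun.
    by have [h _ _ _ _] := T n; exact: trig_continuous h.
  + by move=> t _; apply: cvgM; exact: ct_.
  + by move=> n t _; rewrite normrX lerXn2r// nnegrE// (le_trans _ (tM n t)).
- move=> n; have [h1 h2 h3 h4 h5] := T n.
  rewrite (trig_wulff_area1 h1 h2 h4) /W ler_wpM2l// lerB//.
  have [tk' dk' _] := hk' n.
  have -> : conv s (k' n) = conv g1 (kern n).
    by apply/funext => v; exact: (conv_weak1 si w1 (trig_kern n) tk' dk').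
  by apply: conv_kern_contraction => //; exact: L2_sqr_integrable.
Qed.

End Circle.

(** * Angles along a plane path *)

Section FullTurn.
Context {R : realType}.
Notation mu := (@lebesgue_measure R).

(** While [a] does not vanish, [atan (b / a)] is a branch of the angle of [(a, b)],
    the derivative of which is the integrand. *)
Lemma chart_integral (s t : R) (a b a1 b1 : R -> R) : s <= t ->
  (forall r : R, is_derive r 1 a (a1 r)) -> (forall r : R, is_derive r 1 b (b1 r)) ->
  continuous a1 -> continuous b1 ->
  (forall r, s <= r <= t -> a r != 0) ->
  \int[mu]_(r in `[s, t]) ((a r * b1 r - b r * a1 r) / (a r ^+ 2 + b r ^+ 2)) =
  atan (b t / a t) - atan (b s / a s).
Proof.
move=> st da db ca1 cb1 a0.
have ca : continuous a by move=> r; apply: is_derive_continuous (da r).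
have cb : continuous b by move=> r; apply: is_derive_continuous (db r).
apply: (@Rintegral_FTC _ _ _ (fun r => atan (b r / a r))) => // [r rI|].
  have ar := a0 _ rI; have := da r; have := db r => d1 d2.
  have d3 := is_deriveV ar d2.
  apply: is_derive_eq; rewrite /GRing.scale/=.
  have h1 : a r ^+ 2 + b r ^+ 2 != 0.
    by rewrite gt_eqF// ltr_wpDr ?sqr_ge0// exprn_even_gt0.
  by field; rewrite ar h1.
apply: continuous_in_subspaceT => r; rewrite inE/= in_itv/= => rI.
have ar := a0 _ rI.
apply: cvgM; first by apply: cvgB; apply: cvgM; [exact: ca|exact: cb1|exact: cb|exact: ca1].
apply: cvgV; first by rewrite gt_eqF// ltr_wpDr ?sqr_ge0// exprn_even_gt0.
by apply: cvgD; apply: cvgM; [exact: ca|exact: ca|exact: cb|exact: cb].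
Qed.

Lemma atan_inv (s : R) : 0 < s -> atan s + atan s^-1 = pi / 2.
Proof.
move=> s0; have /andP[h1 h2] : - (pi / 2) < atan s < pi / 2 by rewrite atan_gtNpi2 atan_ltpi2.
have h0 : 0 < atan s by rewrite -atan0; exact: lt_atan.
suff -> : atan s^-1 = pi / 2 - atan s by rewrite addrC subrK.
have cs : cos (atan s) != 0 by rewrite gt_eqF// cos_gt0_pihalf// h1.
have ss : sin (atan s) != 0.
  rewrite gt_eqF// sin_gt0_pi// h0/=; have := pi_gt0 R; lra.
have -> : s^-1 = tan (pi / 2 - atan s).
  rewrite -{1}(atanK s) /tan sinB cosB sin_pihalf cos_pihalf.
  by field; rewrite ss cs.
by rewrite tanK// in_itv/=; apply/andP; split; lra.
Qed.

(** A closed path that lies in turn in the right, upper, left, lower and again right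
    half planes makes one full turn: the angle is [atan (b / a)] on the right and
    left pieces and [atan (- a / b)] on the others, and each of the four changes of
    chart contributes [atan s + atan s^-1 = pi / 2]. *)
Lemma full_turn (a b a1 b1 : R -> R) (r1 r2 r3 r4 : R) :
  (forall r : R, is_derive r 1 a (a1 r)) -> (forall r : R, is_derive r 1 b (b1 r)) ->
  continuous a1 -> continuous b1 ->
  0 <= r1 -> r1 <= r2 -> r2 <= r3 -> r3 <= r4 -> r4 <= 1 ->
  a 0 = a 1 -> b 0 = b 1 ->
  (forall r, 0 <= r <= r1 -> 0 < a r) -> (forall r, r1 <= r <= r2 -> 0 < b r) ->
  (forall r, r2 <= r <= r3 -> a r < 0) -> (forall r, r3 <= r <= r4 -> b r < 0) ->
  (forall r, r4 <= r <= 1 -> 0 < a r) ->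
  mu.-integrable `[0, 1] (EFin \o (fun r => (a r * b1 r - b r * a1 r) / (a r ^+ 2 + b r ^+ 2))) ->
  \int[mu]_(r in `[0, 1]) ((a r * b1 r - b r * a1 r) / (a r ^+ 2 + b r ^+ 2)) = 2 * pi.
Proof.
move=> da db ca1 cb1 r10 r12 r23 r34 r41 a01 b01 ha1 hb2 ha3 hb4 ha5 fi.
set f := fun r => (a r * b1 r - b r * a1 r) / (a r ^+ 2 + b r ^+ 2) in fi *.
have A (s t : R) : s <= t -> (forall r, s <= r <= t -> a r != 0) ->
    \int[mu]_(r in `[s, t]) f r = atan (b t / a t) - atan (b s / a s).
  by move=> st h; exact: (chart_integral st da db ca1 cb1 h).
have B (s t : R) : s <= t -> (forall r, s <= r <= t -> b r != 0) ->
    \int[mu]_(r in `[s, t]) f r = atan (- a t / b t) - atan (- a s / b s).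
  move=> st h.
  have dna (r : R) : is_derive r 1 (fun r => - a r) (- a1 r).
    by have := da r => ?; apply: is_derive_eq.
  have cna : continuous (fun r => - a1 r) by move=> r; apply: cvgN; exact: ca1.
  rewrite -(chart_integral st db dna cb1 cna h).
  by apply: eq_Rintegral => r _; rewrite /f sqrrN (addrC (b r ^+ 2)); congr (_ / _); ring.
have i1 : mu.-integrable `[r1, 1] (EFin \o f) by exact: integrable_subitv fi.
have i2 : mu.-integrable `[r2, 1] (EFin \o f) by exact: integrable_subitv i1.
have i3 : mu.-integrable `[r3, 1] (EFin \o f) by exact: integrable_subitv i2.
have l3 := le_trans r34 r41; have l2 := le_trans r23 l3; have l1 := le_trans r12 l2.
rewrite (Rintegral_split (c := r1) _ fi) ?r10// (Rintegral_split (c := r2) _ i1) ?r12//.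
rewrite (Rintegral_split (c := r3) _ i2) ?r23// (Rintegral_split (c := r4) _ i3) ?r34//.
rewrite (A 0 r1)//; last by move=> r /ha1 h; rewrite gt_eqF.
rewrite (B r1 r2)//; last by move=> r /hb2 h; rewrite gt_eqF.
rewrite (A r2 r3)//; last by move=> r /ha3 h; rewrite lt_eqF.
rewrite (B r3 r4)//; last by move=> r /hb4 h; rewrite lt_eqF.
rewrite (A r4 1)//; last by move=> r /ha5 h; rewrite gt_eqF.
have P1 : 0 < a r1 by apply: ha1; rewrite r10 lexx.
have P2 : 0 < b r1 by apply: hb2; rewrite r12 lexx.
have P3 : 0 < b r2 by apply: hb2; rewrite r12 lexx.
have P4 : a r2 < 0 by apply: ha3; rewrite r23 lexx.
have P5 : a r3 < 0 by apply: ha3; rewrite r23 lexx.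
have P6 : b r3 < 0 by apply: hb4; rewrite r34 lexx.
have P7 : b r4 < 0 by apply: hb4; rewrite r34 lexx.
have P8 : 0 < a r4 by apply: ha5; rewrite r41 lexx.
have e1 : atan (b r1 / a r1) - atan (- a r1 / b r1) = pi / 2.
  by rewrite mulNr atanN opprK -(invf_div (b r1)) atan_inv// divr_gt0.
have e2 : atan (- a r2 / b r2) - atan (b r2 / a r2) = pi / 2.
  have h : 0 < - a r2 / b r2 by rewrite divr_gt0// oppr_gt0.
  have -> : b r2 / a r2 = - (- a r2 / b r2)^-1 by rewrite invf_div invrN mulrN opprK.
  by rewrite atanN opprK atan_inv.
have e3 : atan (b r3 / a r3) - atan (- a r3 / b r3) = pi / 2.
  by rewrite mulNr atanN opprK -(invf_div (b r3)) atan_inv// nmulr_rgt0// invr_lt0.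
have e4 : atan (- a r4 / b r4) - atan (b r4 / a r4) = pi / 2.
  have h : 0 < - a r4 / b r4 by rewrite mulNr oppr_gt0 pmulr_rlt0// invr_lt0.
  have -> : b r4 / a r4 = - (- a r4 / b r4)^-1 by rewrite invf_div invrN mulrN opprK.
  by rewrite atanN opprK atan_inv.
rewrite a01 b01; lra.
Qed.

End FullTurn.

(** * Open boxes of the plane *)

Section OpenPlane.
Context {R : realType}.

Definition open_box (p : R * R) (r : R) : set (R * R) :=
  `]p.1 - r, p.1 + r[%classic `*` `]p.2 - r, p.2 + r[%classic.

Lemma measurable_open_box p r : measurable (open_box p r).
Proof. by apply: measurableX; exact: measurable_itv. Qed.

Lemma open_boxP p r q : open_box p r q <-> `|p.1 - q.1| < r /\ `|p.2 - q.2| < r.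
Proof.
rewrite /open_box /= !in_itv/= !ltr_norml.
by split=> -[] /andP[h1 h2] /andP[h3 h4]; split; apply/andP; split; lra.
Qed.

(** Boxes with a rational centre and a rational radius form a countable base, and
    they are measurable for the product sigma-algebra. *)
Lemma box_open_measurable (E : set (R * R)) :
  (forall p, E p -> exists2 r, 0 < r & open_box p r `<=` E) -> measurable E.
Proof.
move=> oE.
pose B (k : rat * rat * rat) := open_box (ratr k.1.1, ratr k.1.2) (ratr k.2).
pose F (k : rat * rat * rat) := if `[< B k `<=` E >] then B k else set0.
have -> : E = \bigcup_k F k.
  apply/seteqP; split => p; last first.
    by move=> [k _]; rewrite /F; case: asboolP => // h; exact: h.
  move=> Ep; have [r r0 hr] := oE p Ep.
  have r40 : r / 4 < r / 2 by lra.
  have [c] := rat_in_itvoo r40; rewrite in_itv/= => /andP[c1 c2].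
  have l1 : p.1 - ratr c < p.1 + ratr c by lra.
  have l2 : p.2 - ratr c < p.2 + ratr c by lra.
  have [a] := rat_in_itvoo l1; rewrite in_itv/= => /andP[a1 a2].
  have [b] := rat_in_itvoo l2; rewrite in_itv/= => /andP[b1 b2].
  exists (a, b, c) => //; rewrite /F.
  have Bp : B (a, b, c) p.
    by apply/open_boxP => /=; rewrite !ltr_norml; split; apply/andP; split; lra.
  case: asboolP => // -[] q /open_boxP/=; rewrite !ltr_norml => -[/andP[q1 q2] /andP[q3 q4]].
  by apply: hr; apply/open_boxP; rewrite !ltr_norml; split; apply/andP; split; lra.
apply: countable_bigcupT_measurable => // k; rewrite /F.
by case: asboolP => _ //; exact: measurable_open_box.
Qed.

Lemma box_open (E : set (R * R)) :
  (forall p, E p -> exists2 r, 0 < r & open_box p r `<=` E) -> open E.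
Proof.
move=> oE; rewrite openE => p /oE[r r0 hr].
exists (ball p.1 r, ball p.2 r); first by split; exact: nbhsx_ballx.
by move=> q [q1 q2]; apply: hr; apply/open_boxP.
Qed.

End OpenPlane.

(** * An integrable singularity *)

Section Singular.
Context {R : realType}.
Notation mu := (@lebesgue_measure R).

(** [|v|^(-1/2)] is the increasing limit of [invsqrt_reg], which is continuous and
    whose integral is explicit. *)
Definition invsqrt_reg (n : nat) (v : R) : R := (Num.sqrt (`|v| + n.+1%:R^-1))^-1.

(** The value [+oo] at [0] makes [invsqrt] the pointwise limit of [invsqrt_reg]
    everywhere. *)
Definition invsqrt (v : R) : \bar R :=
  if v == 0 then +oo%E else ((Num.sqrt `|v|)^-1)%:E.

Lemma invsqrt_reg_arg_gt0 n (v : R) : 0 < `|v| + n.+1%:R^-1.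
Proof. by rewrite ltr_wpDl// invr_gt0 ltr0n. Qed.

Lemma invsqrt_reg_gt0 n v : 0 < invsqrt_reg n v.
Proof. by rewrite invr_gt0 sqrtr_gt0 invsqrt_reg_arg_gt0. Qed.

Lemma invsqrt_ge0 v : (0 <= invsqrt v)%E.
Proof. by rewrite /invsqrt; case: ifP => // _; rewrite lee_fin invr_ge0 sqrtr_ge0. Qed.

Lemma invsqrt_gt0 v : (0 < invsqrt v)%E.
Proof.
rewrite /invsqrt; case: ifPn => // v0.
by rewrite lte_fin invr_gt0 sqrtr_gt0 normr_gt0.
Qed.

Lemma continuous_invsqrt_reg n : continuous (invsqrt_reg n).
Proof.
move=> v; apply: cvgV; first by rewrite gt_eqF// sqrtr_gt0 invsqrt_reg_arg_gt0.
have h : {for v, continuous (fun w : R => `|w| + n.+1%:R^-1 : R)}.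
  by apply: cvgD; [exact: norm_continuous|exact: cvg_cst].
exact: (continuous_comp h (@sqrt_continuous R _)).
Qed.

Lemma continuous_invsqrt_reg_sub n (c : R) : continuous (fun v => invsqrt_reg n (c - v)).
Proof.
move=> v; have h : {for v, continuous (fun w : R => c - w : R)}.
  by apply: cvgB; [exact: cvg_cst|exact: cvg_id].
exact: (continuous_comp h (@continuous_invsqrt_reg n _)).
Qed.

Lemma invsqrt_reg_nd (v : R) : {homo invsqrt_reg ^~ v : n m / (n <= m)%N >-> n <= m}.
Proof.
move=> n m nm; rewrite /invsqrt_reg lef_pV2 ?posrE ?sqrtr_gt0 ?invsqrt_reg_arg_gt0//.
by rewrite ler_wsqrtr// lerD2l lef_pV2 ?posrE ?ltr0n// ler_nat.
Qed.

Lemma invsqrt_reg_cvg (v : R) : (fun n => (invsqrt_reg n v)%:E) @ \oo --> invsqrt v.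
Proof.
have hc : (fun n => n.+1%:R^-1 : R) @ \oo --> 0 by exact: cvg_harmonic.
rewrite /invsqrt; case: ifPn => [/eqP ->|v0].
  apply/cvgeryP; apply/cvgryPge => A.
  have : (0 : R) < (`|A| + 1)^-1 ^+ 2 by rewrite exprn_gt0// invr_gt0 ltr_wpDl.
  move=> e0; move/cvgrPdist_le : hc => /(_ _ e0); apply: filterS => n.
  rewrite sub0r normrN ger0_norm ?invr_ge0// => h.
  rewrite /invsqrt_reg normr0 add0r.
  apply: (@le_trans _ _ (`|A| + 1)); first by rewrite (le_trans (ler_norm _))// lerDl.
  rewrite -[leLHS]invrK lef_pV2 ?posrE ?sqrtr_gt0 ?invr_gt0 ?ltr0n ?ltr_wpDl//.
  apply: (@le_trans _ _ (Num.sqrt ((`|A| + 1)^-1 ^+ 2))); first exact: ler_wsqrtr.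
  by rewrite sqrtr_sqr ger0_norm// invr_ge0 addr_ge0.
apply: cvg_EFin; first exact: nearW.
have nv : 0 < `|v| by rewrite normr_gt0.
apply: cvgV; first by rewrite gt_eqF// sqrtr_gt0.
have h : (fun n => `|v| + n.+1%:R^-1 : R) @ \oo --> `|v|.
  by rewrite -[X in _ --> X]addr0; apply: cvgD => //; exact: cvg_cst.
exact: (cvg_comp _ _ h (@sqrt_continuous R _)).
Qed.

Lemma measurable_invsqrt : measurable_fun setT invsqrt.
Proof.
apply: (@emeasurable_fun_cvg _ _ _ _ (fun n v => (invsqrt_reg n v)%:E)).
  move=> n; apply/measurable_EFinP; apply: continuous_measurable_fun.
  exact: continuous_invsqrt_reg.
by move=> v _; exact: invsqrt_reg_cvg.
Qed.

Lemma invsqrt_reg_int n (c H : R) : `|c| <= H ->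
  \int[mu]_(v in `[- H, H]) invsqrt_reg n (c - v) <= 4 * Num.sqrt (2 * H + 1).
Proof.
rewrite ler_norml => /andP[c1 c2]; set e := n.+1%:R^-1 : R.
have e0 : 0 < e by rewrite invr_gt0 ltr0n.
have e1 : e <= 1 by rewrite invf_le1 ?ltr0n// ler1n.
have cq := @continuous_invsqrt_reg_sub n c.
rewrite (Rintegral_split (c := c)); [|by rewrite c1|exact: integrable_continuous].
have L : \int[mu]_(v in `[- H, c]) invsqrt_reg n (c - v) =
    - 2 * Num.sqrt (c - c + e) - - 2 * Num.sqrt (c - - H + e).
  apply: (@int_FTC_global _ _ _ (fun v => - 2 * Num.sqrt (c - v + e))) => // v /andP[v1 v2].
  have a0 : 0 < c - v + e by lra.
  have := is_derive1_sqrt a0 => d.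
  apply: is_derive_eq; rewrite /GRing.scale/= /invsqrt_reg ger0_norm ?subr_ge0// -/e.
  by field; rewrite gt_eqF// sqrtr_gt0.
have U : \int[mu]_(v in `[c, H]) invsqrt_reg n (c - v) =
    2 * Num.sqrt (H - c + e) - 2 * Num.sqrt (c - c + e).
  apply: (@int_FTC_global _ _ _ (fun v => 2 * Num.sqrt (v - c + e))) => // v /andP[v1 v2].
  have a0 : 0 < v - c + e by lra.
  have := is_derive1_sqrt a0 => d.
  apply: is_derive_eq; rewrite /GRing.scale/= /invsqrt_reg distrC ger0_norm ?subr_ge0// -/e.
  by field; rewrite gt_eqF// sqrtr_gt0.
rewrite L U.
have h1 : Num.sqrt (c - - H + e) <= Num.sqrt (2 * H + 1) by apply: ler_wsqrtr; lra.
have h2 : Num.sqrt (H - c + e) <= Num.sqrt (2 * H + 1) by apply: ler_wsqrtr; lra.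
have h3 := sqrtr_ge0 (c - c + e).
move: h1 h2 h3; move: (Num.sqrt _) (Num.sqrt _) (Num.sqrt _) (Num.sqrt _) => *; lra.
Qed.

Lemma invsqrt_int (c H : R) : `|c| <= H ->
  (\int[mu]_(v in `[(- H)%R, H%R]) invsqrt (c - v)%R <= (4 * Num.sqrt (2 * H + 1))%R%:E)%E.
Proof.
move=> cH.
have cq n := @continuous_invsqrt_reg_sub n c.
have -> : (\int[mu]_(v in `[(- H)%R, H%R]) invsqrt (c - v)%R =
    \int[mu]_(v in `[(- H)%R, H%R]) limn (fun n => (invsqrt_reg n (c - v)%R)%:E))%E.
  by apply: eq_integral => v _; symmetry; apply/cvg_lim => //; exact: invsqrt_reg_cvg.
have cv : ((\int[mu]_(v in `[(- H)%R, H%R]) (invsqrt_reg n (c - v)%R)%:E)%E @[n --> \oo] -->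
    \int[mu]_(v in `[(- H)%R, H%R]) limn (fun n => (invsqrt_reg n (c - v)%R)%:E))%E.
  apply: (@cvg_monotone_convergence _ _ R mu `[(- H)%R, H%R]%classic (measurable_itv _)
    (fun n v => (invsqrt_reg n (c - v)%R)%:E)).
  - move=> n; apply/measurable_EFinP; apply: measurable_funTS.
    exact: continuous_measurable_fun.
  - by move=> n v _; rewrite lee_fin ltW// invsqrt_reg_gt0.
  - by move=> v _ m n mn; rewrite lee_fin; exact: invsqrt_reg_nd.
rewrite -(cvg_lim _ cv)//; apply: lime_le; first exact: cvgP cv.
apply: nearW => n; rewrite integral_EFin; last exact: integrable_continuous.
by rewrite lee_fin; exact: invsqrt_reg_int.
Qed.

End Singular.

(** * Fubini on rectangles *)

Section FubiniRect.
Context {R : realType}.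
Notation mu := (@lebesgue_measure R).
Local Open Scope ereal_scope.
Variables (A B : set R) (mA : measurable A) (mB : measurable B).
Variable f : R * R -> \bar R.
Hypothesis mf : measurable_fun setT f.

Let g := f \_ (A `*` B).

Let mg : measurable_fun setT g.
Proof.
have h : measurable_fun (A `*` B) f by apply: measurable_funS mf.
exact: ((measurable_restrictT f (measurableX mA mB)).1 h).
Qed.

Let gE a b : g (a, b) = ((fun a => ((fun b => f (a, b)) \_ B) b) \_ A) a.
Proof.
by rewrite /g !patchE in_setX/=; case: (a \in A).
Qed.

Let int_t a : \int[mu]_b g (a, b) = ((fun a => \int[mu]_(b in B) f (a, b)) \_ A) a.
Proof.
under eq_integral do rewrite gE.
rewrite [RHS]patchE; case: (boolP (a \in A)) => aA.
  rewrite [RHS]integral_mkcond; apply: eq_integral => b _.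
  by rewrite patchE aA.
by apply: integral0_eq => b _; rewrite patchE (negbTE aA).
Qed.

Let int_x b : \int[mu]_a g (a, b) = ((fun b => \int[mu]_(a in A) f (a, b)) \_ B) b.
Proof.
under eq_integral do rewrite gE.
rewrite [RHS]patchE; case: (boolP (b \in B)) => bB.
  rewrite [RHS]integral_mkcond; apply: eq_integral => a _.
  by rewrite !patchE; case: (a \in A) => //; rewrite bB.
by apply: integral0_eq => a _; rewrite !patchE (negbTE bB); case: (a \in A).
Qed.

Lemma tonelli_rect : (forall z, 0 <= f z) ->
  \int[mu]_(a in A) \int[mu]_(b in B) f (a, b) = \int[mu]_(b in B) \int[mu]_(a in A) f (a, b).
Proof.
move=> f0; have g0 z : 0 <= g z by rewrite /g patchE; case: ifP.
have := @fubini_tonelli _ _ _ _ R mu mu g mg g0.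
under eq_integral do rewrite int_t.
under [in X in _ = X -> _]eq_integral do rewrite int_x.
by rewrite -!integral_mkcond.
Qed.

Lemma measurable_tonelli_rect : (forall z, 0 <= f z) ->
  measurable_fun A (fun a => \int[mu]_(b in B) f (a, b)).
Proof.
move=> f0; have g0 z : 0 <= g z by rewrite /g patchE; case: ifP.
apply: (measurable_restrictT (fun a => \int[mu]_(b in B) f (a, b)) mA).2.
have := @measurable_fun_fubini_tonelli_F _ _ _ _ R mu g mg g0.
by rewrite /fubini_F; under [X in measurable_fun _ X -> _]funext do rewrite int_t.
Qed.

Let ig : \int[mu]_(b in B) \int[mu]_(a in A) `|f (a, b)| < +oo -> (mu \x mu).-integrable setT g.
Proof.
move=> foo; apply: (@integrable21ltyP _ _ _ _ R mu mu g mg).2; apply: le_lt_trans foo.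
rewrite [leRHS]integral_mkcond.
rewrite (_ : (fun b => _) = (fun b => \int[mu]_(a in A) `|f (a, b)|) \_ B)//.
apply/funext => b; rewrite patchE; case: (boolP (b \in B)) => bB.
  rewrite [RHS]integral_mkcond; apply: eq_integral => a _.
  by rewrite gE !patchE; case: (a \in A); rewrite ?bB ?abse0.
by apply: integral0_eq => a _; rewrite gE !patchE (negbTE bB); case: (a \in A); rewrite abse0.
Qed.

Lemma fubini_rect : \int[mu]_(b in B) \int[mu]_(a in A) `|f (a, b)| < +oo ->
  \int[mu]_(a in A) \int[mu]_(b in B) f (a, b) = \int[mu]_(b in B) \int[mu]_(a in A) f (a, b).
Proof.
move=> /ig ig'; have := @Fubini _ _ _ _ R mu mu g ig'.
under eq_integral do rewrite int_t.
under [in X in _ = X -> _]eq_integral do rewrite int_x.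
by rewrite -!integral_mkcond.
Qed.

Lemma measurable_fubini_rect : \int[mu]_(b in B) \int[mu]_(a in A) `|f (a, b)| < +oo ->
  measurable_fun A (fun a => \int[mu]_(b in B) f (a, b)).
Proof.
move=> /ig ig'; apply: (measurable_restrictT (fun a => \int[mu]_(b in B) f (a, b)) mA).2.
have := @measurable_fubini_F _ _ _ _ R mu mu g ig'.
by rewrite /fubini_F; under [X in measurable_fun _ X -> _]funext do rewrite int_t.
Qed.

End FubiniRect.

(** * The index of the points of a vertical line *)

Section StripIntegral.
Context {R : realType}.
Notation mu := (@lebesgue_measure R).

(** With [p^2 = |a|] and [q^2 = |s|], this is
    [p q (p^2 + q^2) <= p^4 + q^4].  The bound is a product of two singularities,
    each of which is integrable in its variable. *)
Lemma kernel_bound (a s u v C : R) : 0 < C -> `|u| <= C -> `|v| <= C ->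
  ((`|(a * v - s * u) / (a ^+ 2 + s ^+ 2)|)%:E <= C%:E * (invsqrt a * invsqrt s))%E.
Proof.
move=> C0 uC vC.
have oo0 : invsqrt (0 : R) = +oo%E by rewrite /invsqrt eqxx.
have [->|a0] := eqVneq a 0.
  by rewrite oo0 gt0_mulye ?invsqrt_gt0// gt0_muley ?leey// lte_fin.
have [->|s0] := eqVneq s 0.
  by rewrite oo0 gt0_muley ?invsqrt_gt0// gt0_muley ?leey// lte_fin.
rewrite /invsqrt (negbTE a0) (negbTE s0) -!EFinM lee_fin.
set p := Num.sqrt `|a|; set q := Num.sqrt `|s|.
have p0 : 0 < p by rewrite sqrtr_gt0 normr_gt0.
have q0 : 0 < q by rewrite sqrtr_gt0 normr_gt0.
have pE : `|a| = p ^+ 2 by rewrite sqr_sqrtr.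
have qE : `|s| = q ^+ 2 by rewrite sqr_sqrtr.
have den : a ^+ 2 + s ^+ 2 = p ^+ 4 + q ^+ 4.
  by rewrite -(real_normK (num_real a)) -(real_normK (num_real s)) pE qE -!exprM.
have d0 : 0 < p ^+ 4 + q ^+ 4 by rewrite addr_gt0// exprn_gt0.
rewrite normrM normfV den (gtr0_norm d0) ler_pdivrMr//.
have num : `|a * v - s * u| <= C * (p ^+ 2 + q ^+ 2).
  rewrite (le_trans (ler_normB _ _))// !normrM pE qE mulrDr.
  by rewrite lerD// mulrC ler_wpM2r// sqr_ge0.
apply: le_trans num _; rewrite -mulrA ler_pM2l//.
have pq0 : 0 < p * q by rewrite mulr_gt0.
rewrite -invfM -(ler_pM2l pq0) mulrA divff ?gt_eqF// mul1r.
have h1 := sqr_ge0 (p - q); have h2 := sqr_ge0 (p ^+ 2 - q ^+ 2).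
have h3 : 0 <= (p ^+ 2 + q ^+ 2) * (p - q) ^+ 2 by rewrite mulr_ge0// addr_ge0// sqr_ge0.
have -> : p ^+ 4 + q ^+ 4 = p * q * (p ^+ 2 + q ^+ 2) +
  2^-1 * ((p ^+ 2 + q ^+ 2) * (p - q) ^+ 2 + (p ^+ 2 - q ^+ 2) ^+ 2) by field.
by rewrite lerDl mulr_ge0// addr_ge0.
Qed.

Lemma ln_ratio_le (A B : R) : 0 < A -> 0 < B -> ln A - ln B <= (A - B) / B.
Proof.
move=> A0 B0; rewrite -ln_div ?posrE//.
have -> : A / B = 1 + (A - B) / B by field; rewrite gt_eqF.
apply: le_ln1Dx.
rewrite mulrBl divff ?gt_eqF//; have : 0 < A / B by rewrite divr_gt0.
lra.
Qed.

(** Both arguments of the logarithm are at least [(H - M)^2] and they differ by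
    [4 H y]. *)
Lemma ln_strip (a y M H : R) : a != 0 -> `|y| <= M -> 0 < M -> 2 * M <= H ->
  `|ln (a ^+ 2 + (y - H) ^+ 2) - ln (a ^+ 2 + (y + H) ^+ 2)| <= 8 * M / (H - M).
Proof.
move=> a0 yM M0 HM; set A := a ^+ 2 + (y - H) ^+ 2; set B := a ^+ 2 + (y + H) ^+ 2.
have := yM; rewrite ler_norml => /andP[y1 y2].
have D0 : 0 < H - M by lra.
have a2 : 0 <= a ^+ 2 by exact: sqr_ge0.
have AD : (H - M) ^+ 2 <= A.
  have : (H - M) ^+ 2 <= (H - y) ^+ 2 by apply: lerXn2r; rewrite ?nnegrE; lra.
  by rewrite /A -[(y - H) ^+ 2]sqrrN opprB; lra.
have BD : (H - M) ^+ 2 <= B.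
  have : (H - M) ^+ 2 <= (y + H) ^+ 2 by apply: lerXn2r; rewrite ?nnegrE; lra.
  by rewrite /B; lra.
have D2 : 0 < (H - M) ^+ 2 by rewrite exprn_gt0.
have A0 := lt_le_trans D2 AD; have B0 := lt_le_trans D2 BD.
have AB : `|A - B| <= 8 * M * (H - M).
  have -> : A - B = - (4 * (H * y)) by rewrite /A /B; ring.
  rewrite normrN normrM (ger0_norm (_ : 0 <= 4))// normrM (ger0_norm (_ : 0 <= H)); last lra.
  have h1 : H * `|y| <= H * M by rewrite ler_wpM2l//; lra.
  have h2 : H * M <= 2 * (H - M) * M by rewrite ler_wpM2r//; lra.
  lra.
have fr X : (H - M) ^+ 2 <= X -> `|A - B| / X <= 8 * M / (H - M).
  move=> hX; have X0 := lt_le_trans D2 hX.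
  rewrite ler_pdivrMr// (le_trans AB)//.
  have -> : 8 * M * (H - M) = 8 * M / (H - M) * (H - M) ^+ 2 by field; rewrite gt_eqF.
  by rewrite ler_wpM2l// divr_ge0// ?mulr_ge0// ltW.
rewrite ler_norml; apply/andP; split.
  rewrite lerNl opprB; apply: le_trans (ln_ratio_le B0 A0) _.
  apply: le_trans (fr A AD); rewrite ler_pM2r ?invr_gt0// distrC; exact: ler_norm.
apply: le_trans (ln_ratio_le A0 B0) _.
by apply: le_trans (fr B BD); rewrite ler_pM2r ?invr_gt0//; exact: ler_norm.
Qed.

Lemma atan_cvg (a c : R) : a != 0 ->
  (fun n => atan ((n%:R + c) / a)) @ \oo --> Num.sg a * (pi / 2).
Proof.
move=> a0; wlog ap : a a0 / 0 < a.
  move=> H; have [h|h|h] := ltgtP a 0; last by rewrite h eqxx in a0.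
    have := H (- a); rewrite oppr_eq0 oppr_gt0 => /(_ a0 h).
    move=> /cvgN k.
    have -> : Num.sg a * (pi / 2) = - (Num.sg (- a) * (pi / 2)) by rewrite sgrN mulNr opprK.
    rewrite (_ : (fun n => _) = (fun n => - atan ((n%:R + c) / - a)))//.
    by apply/funext => n; rewrite invrN mulrN atanN opprK.
  exact: H.
rewrite gtr0_sg// mul1r.
have h : (fun n => (n%:R + c) / a) @ \oo --> +oo.
  apply/cvgryPge => A; near=> n.
  rewrite ler_pdivlMr//.
  have : A * a - c <= n%:R by near: n; exact: nbhs_infty_ger.
  lra.
exact: (cvg_comp _ _ h (@cvgy_atan R)).
Unshelve. all: by end_near. Qed.

(** The integral of the index form over the segment [[- H, H]] of the vertical
    line, [(a, y)] being the position of the curve relative to the centre of the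
    segment and [(u, v)] its velocity. *)
Definition strip (a y u v H : R) : R :=
  v * (atan ((H - y) / a) + atan ((H + y) / a)) +
  u * (2^-1 * (ln (a ^+ 2 + (y - H) ^+ 2) - ln (a ^+ 2 + (y + H) ^+ 2))).

Lemma strip_integral (a y u v H : R) : a != 0 -> 0 <= H ->
  let k := fun eta => (a * v - (y - eta) * u) / (a ^+ 2 + (y - eta) ^+ 2) in
  continuous k /\ \int[mu]_(eta in `[- H, H]) k eta = strip a y u v H.
Proof.
move=> a0 H0 k.
have a2 : 0 < a ^+ 2 by rewrite exprn_even_gt0.
have den eta : 0 < a ^+ 2 + (y - eta) ^+ 2 by rewrite ltr_wpDr ?sqr_ge0.
have cs : continuous (fun eta : R => y - eta).
  by move=> t; apply: cvgB; [exact: cvg_cst|exact: cvg_id].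
have ck : continuous k.
  move=> t; apply: cvgM.
    by apply: cvgB; [exact: cvg_cst|apply: cvgM; [exact: cs|exact: cvg_cst]].
  apply: cvgV; first by rewrite gt_eqF.
  by apply: cvgD; [exact: cvg_cst|apply: cvgM; exact: cs].
split => //.
pose F eta := v * - atan ((y - eta) / a) + u * (2^-1 * ln (a ^+ 2 + (y - eta) ^+ 2)).
have dF (eta : R) : is_derive eta 1 F (k eta).
  have := is_derive1_ln (den eta) => d.
  apply: is_derive_eq; rewrite /GRing.scale/= /k.
  have h : a ^+ 2 + (y - eta) ^+ 2 != 0 by rewrite gt_eqF.
  by field; rewrite ?a0 ?h.
have HH : - H <= H by lra.
transitivity (F H - F (- H)); first exact: (int_FTC_global HH ck (fun t _ => dF t)).
rewrite /F /strip opprK.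
have -> : (y - H) / a = - ((H - y) / a) by rewrite -mulNr opprB.
by rewrite atanN opprK (addrC H y); ring.
Qed.

Lemma strip_bound (a y u v C M H : R) : a != 0 -> `|u| <= C -> `|v| <= C ->
  `|y| <= M -> 0 < M -> 2 * M <= H -> `|strip a y u v H| <= C * (pi + 4).
Proof.
move=> a0 uC vC yM M0 HM.
have C0 : 0 <= C by exact: le_trans (normr_ge0 _) uC.
rewrite (le_trans (ler_normD _ _))// [leRHS]mulrDr lerD// normrM ler_pM//.
  rewrite ler_norml.
  have := atan_gtNpi2 ((H - y) / a); have := atan_ltpi2 ((H - y) / a).
  have := atan_gtNpi2 ((H + y) / a); have := atan_ltpi2 ((H + y) / a).
  by move=> *; apply/andP; split; lra.
rewrite normrM ger0_norm//.
have h1 := ln_strip a0 yM M0 HM.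
have h2 : 8 * M / (H - M) <= 8.
  by rewrite ler_pdivrMr ?subr_gt0; lra.
lra.
Qed.

(** The sequence of half heights starts at [2 M] so that [strip_bound] applies to
    each term. *)
Lemma strip_cvg (a y u v M : R) : a != 0 -> `|y| <= M -> 0 < M ->
  (fun n => strip a y u v (n%:R + 2 * M)) @ \oo --> pi * Num.sg a * v.
Proof.
move=> a0 yM M0; have -> : pi * Num.sg a * v =
   v * (Num.sg a * (pi / 2) + Num.sg a * (pi / 2)) + u * (2^-1 * 0) by field.
apply: cvgD; apply: cvgMr.
  apply: cvgD.
    have := @atan_cvg a (2 * M - y) a0; under eq_fun do rewrite addrA; exact.
  have := @atan_cvg a (2 * M + y) a0; under eq_fun do rewrite addrA; exact.
apply: cvgMr; apply/cvgr0Pnorm_le => e e0; near=> n.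
have n0 : 0 <= n%:R :> R by [].
have h : 2 * M <= n%:R + 2 * M by lra.
apply: le_trans (ln_strip a0 yM M0 h) _.
rewrite ler_pdivrMr; last lra.
have : 8 * M / e <= n%:R by near: n; exact: nbhs_infty_ger.
rewrite ler_pdivrMr// => hn.
have : 0 < e * M by rewrite mulr_gt0.
lra.
Unshelve. all: by end_near. Qed.

Lemma measurable_sgr : measurable_fun setT (Num.sg : R -> R).
Proof.
apply: nondecreasing_measurable => // u v uv.
by case: (sgrP u) => hu; case: (sgrP v) => hv; rewrite ?lexx ?ler01 ?lerN10//; lra.
Qed.

End StripIntegral.

(** * The index of a closed curve *)

Section ClosedCurve.
Context {R : realType}.
Notation mu := (@lebesgue_measure R).
Variables (x y x1 y1 : R -> R).
Hypothesis dx : forall t : R, is_derive t 1 x (x1 t).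
Hypothesis dy : forall t : R, is_derive t 1 y (y1 t).
Hypothesis cx1 : continuous x1.
Hypothesis cy1 : continuous y1.
Hypothesis px : periodic x 1.
Hypothesis py : periodic y 1.

(** The form is the derivative of the angle under which the curve is seen from [p],
    so that [wint p] is [2 pi] times the index of [p]. *)
Definition wform (p : R * R) (t : R) : R :=
  ((x t - p.1) * y1 t - (y t - p.2) * x1 t) / ((x t - p.1) ^+ 2 + (y t - p.2) ^+ 2).

Definition wint (p : R * R) : R := \int[mu]_(t in `[0, 1]) wform p t.

Definition off (p : R * R) : Prop := forall t, (x t, y t) <> p.

Definition dist2 (p : R * R) (t : R) : R := (x t - p.1) ^+ 2 + (y t - p.2) ^+ 2.

Lemma curve_cx : continuous x. Proof. by move=> t; apply: is_derive_continuous (dx t). Qed.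
Lemma curve_cy : continuous y. Proof. by move=> t; apply: is_derive_continuous (dy t). Qed.

Lemma periodic1_0 (f : R -> R) : periodic f 1 -> f 1 = f 0.
Proof. by move=> /(_ 0); rewrite add0r. Qed.

Lemma off_dist2 p : off p -> forall t, 0 < dist2 p t.
Proof.
move=> op t; rewrite lt_neqAle addr_ge0 ?sqr_ge0// andbT eq_sym.
rewrite paddr_eq0 ?sqr_ge0// !sqrf_eq0 !subr_eq0; apply/negP => /andP[/eqP e1 /eqP e2].
by apply: (op t); rewrite e1 e2; case: p {op e1 e2}.
Qed.

Lemma dist2_off p : (forall t, 0 < dist2 p t) -> off p.
Proof. by move=> h t e; have := h t; rewrite /dist2 -e/= !subrr expr0n/= addr0 ltxx. Qed.

Lemma continuous_dist2 p : continuous (dist2 p).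
Proof.
move=> t; apply: cvgD; apply: cvgM; apply: cvgB; try exact: cvg_cst;
 by [exact: curve_cx|exact: curve_cy].
Qed.

Lemma periodic1_range (f : R -> R) t : periodic f 1 ->
  exists2 u, 0 <= u < 1 & forall g : R -> R, periodic g 1 -> g t = g u.
Proof.
move=> _; exists (t - (Num.floor t)%:~R).
  have /andP[h1 h2] := floor_itv t; rewrite intrD1 in h2.
  by apply/andP; split; lra.
move=> g pg; have := periodicz pg (- Num.floor t) t.
by rewrite mulrNz.
Qed.

Lemma off_dist2_lower p : off p -> exists2 d, 0 < d & forall t, d <= dist2 p t.
Proof.
move=> op; have cd : {within `[0, 1], continuous (dist2 p)}.
  by apply: continuous_subspaceT; exact: continuous_dist2.
have [c _ hc] := EVT_min (ler01 : 0 <= 1 :> R) cd.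
exists (dist2 p c); first exact: off_dist2.
move=> t; have [u /andP[u0 u1] hu] := periodic1_range t px.
rewrite (hu (dist2 p)); first by apply: hc; rewrite in_itv/= u0 ltW.
by move=> r; rewrite /dist2 px py.
Qed.

Lemma continuous_wform p : off p -> continuous (wform p).
Proof.
move=> op t; apply: cvgM.
  by apply: cvgB; apply: cvgM; [apply: cvgB; [exact: curve_cx|exact: cvg_cst]|exact: cy1|
     apply: cvgB; [exact: curve_cy|exact: cvg_cst]|exact: cx1].
apply: cvgV; last exact: continuous_dist2.
by rewrite gt_eqF//; exact: off_dist2.
Qed.

Lemma wint_box1 p : (forall t, x t != p.1) -> wint p = 0.
Proof.
move=> xp; rewrite /wint /wform.
transitivity (atan ((y 1 - p.2) / (x 1 - p.1)) - atan ((y 0 - p.2) / (x 0 - p.1))); last first.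
  by rewrite !periodic1_0// subrr.
apply: (@chart_integral _ 0 1 (fun t => x t - p.1) (fun t => y t - p.2) x1 y1) => //.
- by move=> t; have := dx t => ?; apply: is_derive_eq; rewrite subr0.
- by move=> t; have := dy t => ?; apply: is_derive_eq; rewrite subr0.
- by move=> t _; rewrite subr_eq0.
Qed.

Lemma wint_box2 p : (forall t, y t != p.2) -> wint p = 0.
Proof.
move=> xp; rewrite /wint /wform.
transitivity (\int[mu]_(t in `[0, 1]) (((y t - p.2) * - x1 t - (- (x t - p.1)) * y1 t) /
   ((y t - p.2) ^+ 2 + (- (x t - p.1)) ^+ 2))).
  by apply: eq_Rintegral => t _; congr (_ / _); ring.
transitivity (atan (- (x 1 - p.1) / (y 1 - p.2)) - atan (- (x 0 - p.1) / (y 0 - p.2))); last first.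
  by rewrite !periodic1_0// subrr.
apply: (@chart_integral _ 0 1 (fun t => y t - p.2) (fun t => - (x t - p.1)) y1 (fun t => - x1 t)) => //.
- by move=> t; have := dy t => ?; apply: is_derive_eq; rewrite subr0.
- by move=> t; have := dx t => ?; apply: is_derive_eq; rewrite subr0.
- by move=> t; apply: cvgN; exact: cx1.
- by move=> t _; rewrite subr_eq0.
Qed.

(** The difference of the angles at which two points [p] and [q] see the curve is
    the angle of the quotient of [g - p] by [g - q] in complex notation, that is of
    [(dotpq, crosspq)], for the curve [g]. *)
Section Difference.
Variables p q : R * R.
Definition dotpq (t : R) : R := (x t - p.1) * (x t - q.1) + (y t - p.2) * (y t - q.2).
Definition crosspq (t : R) : R := (x t - q.1) * (y t - p.2) - (y t - q.2) * (x t - p.1).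
Definition dotpq' (t : R) : R :=
  x1 t * (x t - q.1) + (x t - p.1) * x1 t + (y1 t * (y t - q.2) + (y t - p.2) * y1 t).
Definition crosspq' (t : R) : R :=
  x1 t * (y t - p.2) + (x t - q.1) * y1 t - (y1 t * (x t - p.1) + (y t - q.2) * x1 t).

Lemma is_derive_dotpq (t : R) : is_derive t 1 dotpq (dotpq' t).
Proof.
have := dx t; have := dy t => ? ?.
by apply: is_derive_eq; rewrite /GRing.scale/= /dotpq'; ring.
Qed.

Lemma is_derive_crosspq (t : R) : is_derive t 1 crosspq (crosspq' t).
Proof.
have := dx t; have := dy t => ? ?.
by apply: is_derive_eq; rewrite /GRing.scale/= /crosspq'; ring.
Qed.

Lemma continuous_dotpq' : continuous dotpq'.
Proof.
move=> t; apply: cvgD; apply: cvgD; apply: cvgM; try (apply: cvgB; try exact: cvg_cst);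
 by [exact: curve_cx|exact: curve_cy|exact: cx1|exact: cy1].
Qed.

Lemma continuous_crosspq' : continuous crosspq'.
Proof.
move=> t; apply: cvgB; apply: cvgD; apply: cvgM; try (apply: cvgB; try exact: cvg_cst);
 by [exact: curve_cx|exact: curve_cy|exact: cx1|exact: cy1].
Qed.

Lemma wform_diff t : 0 < dist2 p t -> 0 < dist2 q t ->
  wform p t - wform q t =
  (dotpq t * crosspq' t - crosspq t * dotpq' t) / (dotpq t ^+ 2 + crosspq t ^+ 2).
Proof.
move=> hp hq.
have -> : dotpq t ^+ 2 + crosspq t ^+ 2 = dist2 p t * dist2 q t.
  by rewrite /dotpq /crosspq /dist2; ring.
rewrite /wform -/(dist2 p t) -/(dist2 q t).
have -> : dotpq t * crosspq' t - crosspq t * dotpq' t =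
  ((x t - p.1) * y1 t - (y t - p.2) * x1 t) * dist2 q t -
  ((x t - q.1) * y1 t - (y t - q.2) * x1 t) * dist2 p t.
  by rewrite /dotpq /crosspq /dotpq' /crosspq' /dist2; ring.
by field; rewrite !gt_eqF.
Qed.

Lemma wint_diff : off p -> off q -> wint p - wint q =
  \int[mu]_(t in `[0, 1])
   ((dotpq t * crosspq' t - crosspq t * dotpq' t) / (dotpq t ^+ 2 + crosspq t ^+ 2)).
Proof.
move=> op oq; rewrite /wint -RintegralB//.
- by apply: eq_Rintegral => t _; rewrite wform_diff//; exact: off_dist2.
- by apply: integrable_continuous; exact: continuous_wform.
- by apply: integrable_continuous; exact: continuous_wform.
Qed.

End Difference.

(** For [q] close to [p], the angle between [g - p] and [g - q] is acute along the
    whole curve; hence [dotpq > 0] and the single chart [chart_integral] computes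
    the difference of the indices, which is [0] for a closed curve. *)
Lemma wint_locally_constant p : off p ->
  exists2 r, 0 < r & forall q, `|p.1 - q.1| < r -> `|p.2 - q.2| < r -> off q /\ wint q = wint p.
Proof.
move=> op; have [d d0 hd] := off_dist2_lower op.
exists (Num.min 1 (d / 4)); first by rewrite lt_min ltr01 divr_gt0.
move=> q; rewrite !lt_min => /andP[q1 q1d] /andP[q2 q2d].
have sq (z : R) : `|z| < 1 -> `|z| < d / 4 -> z ^+ 2 < d / 4.
  move=> z1 zd; rewrite -(real_normK (num_real z)); apply: le_lt_trans zd.
  by rewrite expr2 ler_piMl// ltW.
have h1 := sq _ q1 q1d; have h2 := sq _ q2 q2d.
have dotE t : 2 * dotpq p q t = dist2 p t + dist2 q t - ((p.1 - q.1) ^+ 2 + (p.2 - q.2) ^+ 2).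
  by rewrite /dotpq /dist2; ring.
have oq : off q.
  apply: dist2_off => t.
  have : 2 * (dist2 q t + ((p.1 - q.1) ^+ 2 + (p.2 - q.2) ^+ 2)) - dist2 p t =
     (x t + p.1 - 2 * q.1) ^+ 2 + (y t + p.2 - 2 * q.2) ^+ 2.
    by rewrite /dist2; ring.
  have := sqr_ge0 (x t + p.1 - 2 * q.1); have := sqr_ge0 (y t + p.2 - 2 * q.2).
  have := hd t; move: (_ ^+ 2) (_ ^+ 2) (dist2 _ _) (dist2 _ _) => *; lra.
split => //; apply/eqP; rewrite eq_sym -subr_eq0; apply/eqP.
rewrite wint_diff//.
transitivity (atan (crosspq p q 1 / dotpq p q 1) - atan (crosspq p q 0 / dotpq p q 0)); last first.
  by rewrite /dotpq /crosspq !(periodic1_0 px) !(periodic1_0 py) subrr.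
apply: (@chart_integral _ 0 1 (dotpq p q) (crosspq p q) (dotpq' p q) (crosspq' p q)) => //.
- by move=> t; exact: is_derive_dotpq.
- by move=> t; exact: is_derive_crosspq.
- exact: continuous_dotpq'.
- exact: continuous_crosspq'.
- move=> t _; rewrite gt_eqF//.
  have := dotE t; have := hd t; have := off_dist2 oq t.
  move: (_ ^+ 2) (_ ^+ 2) h1 h2 => *; lra.
Qed.

(** * The jump of the index across the curve *)

Section Jump.
Hypothesis reg : forall t, (x1 t, y1 t) != (0, 0).
Hypothesis simple : {in `[0, 1[ &, injective (fun t => (x t, y t))}.

Lemma vertical_tangent : exists2 t0 : R, 0 < t0 < 1 & y1 t0 != 0.
Proof.
have cx := curve_cx.
have [|||c] := @Rolle R x 0 1 ltr01.
- by move=> t _; have := dx t => ?; exact: ex_derive.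
- exact: continuous_subspaceT.
- by rewrite (periodic1_0 px).
rewrite in_itv/= => cI dc; exists c => //; apply/eqP => y0.
have /eqP := reg c; apply; rewrite y0; congr pair.
by rewrite -(@derive_val _ _ _ _ _ _ _ (dx c)) (@derive_val _ _ _ _ _ _ _ dc).
Qed.

(** The points [p] and [q] are placed on either side of a point [g t0] with
    [y' t0 <> 0], at the horizontal distance [e0].  With the notations of
    [dotpq], [dotpq = dist2 (g t0) - e0^2] and [crosspq] is proportional to
    [y - y t0].  So the path [(dotpq, crosspq)] is in the right half plane as long
    as the curve is at distance more than [e0] from [g t0], and crosses the three
    other half planes near [t0]: [full_turn] shows that the indices differ by [1],
    so that one of them is nonzero. *)
Lemma winding_jump : exists2 p, off p & wint p != 0.
Proof.
have cx := curve_cx; have cy := curve_cy.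
have [t0 /andP[t00 t01] y1t0] := vertical_tangent.
pose c := y1 t0.
have c2 : 0 < c * y1 t0 by rewrite -expr2 exprn_even_gt0.
have [d [d0 d1 d2 hd]] : exists d, [/\ 0 < d, 0 <= t0 - d, t0 + d <= 1 &
    forall t, t0 - d <= t <= t0 + d -> 0 < c * y1 t].
  have cc : {for t0, continuous (fun t => c * y1 t)}.
    by apply: cvgM; [exact: cvg_cst|exact: cy1].
  move: cc => /cvgrPdist_lt/(_ _ c2)[r /= r0 hr].
  exists (Num.min (r / 2) (Num.min t0 (1 - t0))); split.
  - by rewrite !lt_min divr_gt0//= t00 subr_gt0.
  - have : Num.min (r / 2) (Num.min t0 (1 - t0)) <= t0 by rewrite !ge_min lexx orbT.
    by rewrite subr_ge0.
  - have : Num.min (r / 2) (Num.min t0 (1 - t0)) <= 1 - t0 by rewrite !ge_min lexx !orbT.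
    by lra.
  - move=> t; have : Num.min (r / 2) (Num.min t0 (1 - t0)) <= r / 2 by rewrite !ge_min lexx.
    move: (Num.min _ _) => m mr /andP[h1 h2].
    have : `|t0 - t| < r by rewrite ltr_norml; apply/andP; split; lra.
    by move=> /hr/=; rewrite ltr_norml => /andP[_]; lra.
have dcy (t : R) : is_derive t 1 (fun t => c * y t) (c * y1 t).
  by have := dy t => ?; apply: is_derive_eq; rewrite /GRing.scale/=; ring.
have yR t : t0 < t -> t <= t0 + d -> 0 < c * (y t - y t0).
  move=> h1 h2; rewrite mulrBr subr_gt0.
  apply: (gt0_derive_lt h1 (fun t _ => dcy t)) => u /andP[u1 u2]; apply: hd.
  by apply/andP; split; lra.
have yL t : t < t0 -> t0 - d <= t -> c * (y t - y t0) < 0.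
  move=> h1 h2; rewrite mulrBr subr_lt0.
  apply: (gt0_derive_lt h1 (fun t _ => dcy t)) => u /andP[u1 u2]; apply: hd.
  by apply/andP; split; lra.
(* The rest of the curve stays at a positive distance from [g0], as the curve is
   simple. *)
pose g0 := (x t0, y t0).
have far0 t : 0 <= t <= 1 -> t <> t0 -> 0 < dist2 g0 t.
  move=> tI tt0; rewrite lt_neqAle addr_ge0 ?sqr_ge0// andbT eq_sym.
  rewrite paddr_eq0 ?sqr_ge0// !sqrf_eq0 !subr_eq0/=; apply/negP => /andP[/eqP e1 /eqP e2].
  have t0I : t0 \in `[0, 1[ by rewrite in_itv/= (ltW t00).
  have [t1|t1] := eqVneq t 1.
    have z0 : (0 : R) \in `[0, 1[ by rewrite in_itv/= lexx ltr01.
    have : (0 : R) = t0.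
      by apply: simple => //=; rewrite -e1 -e2 t1 !periodic1_0.
    by move=> e; move: t00; rewrite e ltxx.
  apply: tt0; apply: simple => //=; last by rewrite e1 e2.
  by rewrite in_itv/= lt_neqAle t1; move: tI => /andP[-> ->].
have far s t : 0 <= s -> s <= t -> t <= 1 -> ~ (s <= t0 <= t) ->
    exists2 D, 0 < D & forall r, s <= r <= t -> D <= dist2 g0 r.
  move=> s0 st t1 nt0.
  have cd : {within `[s, t], continuous (dist2 g0)}.
    by apply: continuous_subspaceT; exact: continuous_dist2.
  have [m mI hm] := EVT_min st cd.
  exists (dist2 g0 m).
    move: mI; rewrite in_itv/= => /andP[m1 m2]; apply: far0.
      by rewrite (le_trans s0 m1) (le_trans m2 t1).
    by move=> e; apply: nt0; rewrite -e m1.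
  by move=> r rI; apply: hm; rewrite in_itv.
have [D1 D10 hD1] : exists2 D, 0 < D & forall r, 0 <= r <= t0 - d -> D <= dist2 g0 r.
  by apply: far => //; [lra|move=> /andP[]; lra].
have [D2 D20 hD2] : exists2 D, 0 < D & forall r, t0 + d <= r <= 1 -> D <= dist2 g0 r.
  by apply: far => //; [lra|move=> /andP[]; lra].
pose e0 := Num.min 1 (Num.min (D1 / 2) (D2 / 2)).
have e00 : 0 < e0 by rewrite !lt_min ltr01 !divr_gt0.
have [e0D1 e0D2] : e0 ^+ 2 < D1 /\ e0 ^+ 2 < D2.
  have h1 : e0 ^+ 2 <= e0 by rewrite expr2 ler_piMl ?(ltW e00)// ge_min lexx.
  have h2 : e0 <= D1 / 2 by rewrite !ge_min lexx !orbT.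
  have h3 : e0 <= D2 / 2 by rewrite !ge_min lexx !orbT.
  by split; apply: le_lt_trans h1 _; lra.
have away t : 0 <= t <= 1 -> ~ (t0 - d <= t <= t0 + d) -> e0 ^+ 2 < dist2 g0 t.
  move=> /andP[h0 h1] nt; have [h2|h2] := leP t (t0 - d).
    by apply: lt_le_trans e0D1 _; apply: hD1; rewrite h0.
  apply: lt_le_trans e0D2 _; apply: hD2; rewrite h1 andbT.
  by rewrite leNgt; apply/negP => h3; apply: nt; rewrite !ltW.
(* The sign of [eta] makes the turn counterclockwise. *)
pose eta := Num.sg c * e0.
have eta2 : eta ^+ 2 = e0 ^+ 2 by rewrite exprMn sqr_sg y1t0 mul1r.
have eta0 : eta != 0 by rewrite -sqrf_eq0 eta2 gt_eqF// exprn_gt0.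
pose p := (x t0 - eta, y t0); pose q := (x t0 + eta, y t0).
have offpq (z : R) : z ^+ 2 = e0 ^+ 2 -> off (x t0 + z, y t0).
  move=> z2 t; have [u /andP[u0 u1] hu] := periodic1_range t px.
  rewrite (hu _ px) (hu _ py) => -[ex ey].
  have [/andP[n1 n2]|/negP n] := boolP (t0 - d <= u <= t0 + d).
    have [h|h|h] := ltgtP u t0.
    - by have := yL _ h n1; rewrite ey subrr mulr0 ltxx.
    - by have := yR _ h n2; rewrite ey subrr mulr0 ltxx.
    - move: ex; rewrite h => /eqP; rewrite -subr_eq0 opprD addrA subrr sub0r oppr_eq0 => /eqP z0.
      by move: z2; rewrite z0 expr0n/= => /esym/eqP; rewrite gt_eqF// exprn_gt0.
  have := away u; rewrite u0 (ltW u1) => /(_ isT n).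
  by rewrite /dist2 ex ey/= addrAC subrr add0r subrr expr0n/= addr0 z2 ltxx.
have op : off p by rewrite /p; apply: offpq; rewrite sqrrN.
have oq : off q by rewrite /q; apply: offpq.
pose a := dotpq p q; pose b := crosspq p q.
have aE t : a t = dist2 g0 t - e0 ^+ 2.
  by rewrite -eta2 /a /dotpq /dist2 /p /q/=; ring.
have bE t : b t = - 2 * eta * (y t - y t0).
  by rewrite /b /crosspq /p /q/=; ring.
have bE' t : b t * `|c| = - 2 * e0 * (c * (y t - y t0)).
  by rewrite bE /eta; rewrite [in RHS](numEsg c); ring.
have ac0 : 0 < `|c| by rewrite normr_gt0.
have bL t : t < t0 -> t0 - d <= t -> 0 < b t.
  move=> h1 h2; rewrite -(pmulr_lgt0 _ ac0) bE' mulNr mulNr oppr_gt0.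
  by rewrite pmulr_rlt0 ?yL// mulr_gt0.
have bR t : t0 < t -> t <= t0 + d -> b t < 0.
  move=> h1 h2; rewrite -(pmulr_llt0 _ ac0) bE' mulNr mulNr oppr_lt0.
  by rewrite pmulr_rgt0 ?yR// mulr_gt0.
have da (r : R) : is_derive r 1 a (dotpq' p q r) by exact: is_derive_dotpq.
have db (r : R) : is_derive r 1 b (crosspq' p q r) by exact: is_derive_crosspq.
have [d' [d'0 d'd hd']] : exists d', [/\ 0 < d', d' < d & forall t, t0 - d' <= t <= t0 + d' -> a t < 0].
  have ca : {for t0, continuous a} by apply: is_derive_continuous (da t0).
  have at0 : a t0 = - e0 ^+ 2 by rewrite aE /dist2/= !subrr expr0n/= addr0 sub0r.
  have e20 : 0 < e0 ^+ 2 by rewrite exprn_gt0.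
  move: ca => /cvgrPdist_lt/(_ _ e20)[r /= r0 hr].
  exists (Num.min (r / 2) (d / 2)); split.
  - by rewrite lt_min !divr_gt0.
  - by rewrite gt_min; apply/orP; right; lra.
  - move=> t; have : Num.min (r / 2) (d / 2) <= r / 2 by rewrite !ge_min lexx.
    move: (Num.min _ _) => m mr /andP[h1 h2].
    have : `|t0 - t| < r by rewrite ltr_norml; apply/andP; split; lra.
    by move=> /hr/=; rewrite at0 ltr_norml => /andP[]; lra.
have key : wint p - wint q = 2 * pi.
  rewrite (wint_diff op oq).
  apply: (@full_turn _ a b (dotpq' p q) (crosspq' p q)
    (t0 - d) (t0 - d') (t0 + d') (t0 + d)) => //.
  - exact: continuous_dotpq'.
  - exact: continuous_crosspq'.
  - lra.
  - lra.
  - lra.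
  - by rewrite /a /dotpq !(periodic1_0 px) !(periodic1_0 py).
  - by rewrite /b /crosspq !(periodic1_0 px) !(periodic1_0 py).
  - move=> r /andP[h1 h2]; rewrite aE subr_gt0.
    by apply: lt_le_trans e0D1 _; apply: hD1; rewrite h1.
  - by move=> r /andP[h1 h2]; apply: bL; lra.
  - by move=> r /andP[h1 h2]; apply: bR; lra.
  - move=> r /andP[h1 h2]; rewrite aE subr_gt0.
    by apply: lt_le_trans e0D2 _; apply: hD2; rewrite h1.
  - apply: integrable_continuous.
    have -> : (fun r => (a r * crosspq' p q r - b r * dotpq' p q r) / (a r ^+ 2 + b r ^+ 2)) =
       (fun t => wform p t - wform q t).
      by apply/funext => t; rewrite (wform_diff (off_dist2 op t) (off_dist2 oq t)).
    by move=> t; apply: cvgB; apply: continuous_wform.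
have [p0|p0] := eqVneq (wint p) 0; last by exists p.
exists q => //; apply/eqP => q0; move: key; rewrite p0 q0 subrr.
have := pi_gt0 R; lra.
Qed.

End Jump.

(** * The enclosed region *)

Lemma curve_bounded : exists2 M, 0 < M & forall t, `|x t| < M /\ `|y t| < M.
Proof.
have bd (f : R -> R) : continuous f -> periodic f 1 -> exists M, forall t, `|f t| <= M.
  move=> cf pf.
  have cn : {within `[0, 1], continuous (fun t => `|f t|)}.
    by apply: continuous_subspaceT => t; apply: continuous_comp; [exact: cf|exact: norm_continuous].
  have [c _ hc] := EVT_max (ler01 : 0 <= 1 :> R) cn.
  exists `|f c| => t; have [u /andP[u0 u1] hu] := periodic1_range t pf.
  by rewrite (hu f pf); apply: hc; rewrite in_itv/= u0 ltW.
have [M1 h1] := bd x curve_cx px; have [M2 h2] := bd y curve_cy py.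
have M10 := le_trans (normr_ge0 _) (h1 0); have M20 := le_trans (normr_ge0 _) (h2 0).
exists (M1 + M2 + 1); first by rewrite ltr_wpDl// addr_ge0.
by move=> t; have := h1 t; have := h2 t => ? ?; split; lra.
Qed.

Lemma wint_outside M p : (forall t, `|x t| < M /\ `|y t| < M) ->
  (M <= `|p.1|) || (M <= `|p.2|) -> wint p = 0.
Proof.
move=> hM /orP[] h.
- apply: wint_box1 => // t; apply/eqP => e.
  by have [+ _] := hM t; rewrite e ltNge h.
- apply: wint_box2 => // t; apply/eqP => e.
  by have [_ +] := hM t; rewrite e ltNge h.
Qed.

Lemma wint_level_open (P : R -> Prop) p : off p -> P (wint p) ->
  exists2 r, 0 < r & open_box p r `<=` [set q | off q /\ P (wint q)].
Proof.
move=> op Pp; have [r r0 hr] := wint_locally_constant op.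
by exists r => // q /open_boxP[q1 q2]; have [oq e] := hr q q1 q2; split => //; rewrite e.
Qed.

Lemma wint_connected (C : set (R * R)) p q : connected C -> (forall r, C r -> off r) ->
  C p -> C q -> wint q = wint p.
Proof.
move=> cC Coff Cp Cq.
pose B := C `&` [set r | wint r = wint p].
have BC : B = C.
  apply: cC; first by exists p.
  - exists [set r | off r /\ wint r = wint p].
      by apply: box_open => r [or er]; exact: (wint_level_open (P := fun w => w = wint p)).
    by apply/seteqP; split => r [Cr er]; split => //; [split => //; exact: Coff|case: er].
  - exists (~` [set r | off r /\ wint r <> wint p]).
      apply: open_closedC; apply: box_open => r [or er].
      exact: (wint_level_open (P := fun w => w <> wint p)).
    apply/seteqP; split => r [Cr er]; split => //; first by move=> [].
    by apply: contrapT => h; apply: er; split => //; exact: Coff.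
by have [] : B q by rewrite BC.
Qed.

Lemma off_compl p : (~` range (fun t => (x t, y t))) p <-> off p.
Proof.
split; first by move=> h t e; apply: h; exists t.
by move=> h [t _ e]; exact: (h t).
Qed.

Hypothesis Hccw : forall p, enclosed_region x y p -> wint p = 2 * pi.

(** A point of index [<> 0] has a component on which the index is constant, hence
    nonzero, and the index vanishes outside a box: the component is bounded.  The
    converse is the counterclockwise orientation. *)
Lemma enclosedP p : enclosed_region x y p <-> off p /\ wint p <> 0.
Proof.
have pi0 := pi_gt0 R.
split.
  move=> Ep; split; last by rewrite Hccw//; lra.
  by case: Ep => /off_compl.
move=> [op wp]; split; first exact/off_compl.
have [M M0 hM] := curve_bounded.
set C := connected_component _ _.
have CM q : C q -> `|q| <= M.
  move=> Cq; have Cp : C p by apply: connected_component_refl; exact/off_compl.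
  have Coff r : C r -> off r.
    by move=> /connected_component_sub /off_compl.
  have e := wint_connected (@component_connected _ _ _) Coff Cp Cq.
  rewrite prod_normE/= ge_max leNgt [X in _ && X]leNgt -negb_or; apply/negP => h.
  apply: wp; rewrite -e; apply: (wint_outside hM).
  by case/orP: h => /ltW ->//; rewrite orbT.
exists M; split; first exact: num_real.
by move=> M' MM' q /CM h; exact: le_trans h (ltW MM').
Qed.

Lemma enclosed_box M p : (forall t, `|x t| < M /\ `|y t| < M) -> enclosed_region x y p ->
  `|p.1| < M /\ `|p.2| < M.
Proof.
move=> hM /enclosedP[op wp].
by split; rewrite ltNge; apply/negP => h; apply: wp; apply: (wint_outside hM); rewrite h// orbT.
Qed.

Lemma enclosed_box_open p : enclosed_region x y p ->
  exists2 r, 0 < r & open_box p r `<=` enclosed_region x y.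
Proof.
move=> /enclosedP[op wp]; have [r r0 hr] := wint_level_open (P := fun w => w <> 0) op wp.
by exists r => // q /hr[oq wq]; apply/enclosedP.
Qed.

Lemma measurable_enclosed : measurable (enclosed_region x y).
Proof. exact: box_open_measurable enclosed_box_open. Qed.

Lemma enclosed_measure_fin : ((mu \x mu)%E (enclosed_region x y) < +oo)%E.
Proof.
have [M M0 hM] := curve_bounded.
apply: (@le_lt_trans _ _ ((mu \x mu)%E (open_box (0, 0) M))).
  apply: le_measure; rewrite ?inE; [exact: measurable_enclosed|exact: measurable_open_box|].
  move=> p /(enclosed_box hM)[h1 h2]; apply/open_boxP => /=.
  by rewrite !sub0r !normrN.
rewrite /open_box product_measure1E//= !lebesgue_measure_itv/= !lte_fin.
by case: ifP => _; rewrite -?EFinD -?EFinM ?mul0e ltry.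
Qed.

Lemma enclosed_measure_gt0 : enclosed_region x y !=set0 ->
  (0 < (mu \x mu)%E (enclosed_region x y))%E.
Proof.
move=> [p /enclosed_box_open[r r0 hr]].
apply: (@lt_le_trans _ _ ((mu \x mu)%E (open_box p r))).
  rewrite /open_box product_measure1E//= !lebesgue_measure_itv/= !lte_fin.
  have -> : p.1 - r < p.1 + r by lra.
  have -> : p.2 - r < p.2 + r by lra.
  by rewrite -!EFinD -EFinM lte_fin mulr_gt0//; lra.
by apply: le_measure; rewrite ?inE; [exact: measurable_open_box|exact: measurable_enclosed|].
Qed.

(** * The trace of the curve is a null set *)

Definition trace : set (R * R) := [set p | ~ off p].

Lemma traceP p : trace p -> exists2 u : R, 0 <= u < 1 & p = (x u, y u).
Proof.
move=> /= Np; have [t e] : exists t, (x t, y t) = p.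
  by apply: contrapT => h; apply: Np => t e; apply: h; exists t.
have [u uI hu] := periodic1_range t px; exists u => //.
by rewrite -e (hu x px) (hu y py).
Qed.

Lemma measurable_trace : measurable trace.
Proof.
rewrite -[trace]setCK; apply: measurableC; apply: box_open_measurable => p /contrapT op.
have [r r0 hr] := wint_locally_constant op.
exists r => // q /open_boxP[q1 q2]; have [oq _] := hr q q1 q2.
by move=> /(_ oq).
Qed.

Lemma lipschitz_itv (f f1 : R -> R) : (forall t : R, is_derive t 1 f (f1 t)) -> continuous f1 ->
  exists2 C : R, 0 <= C & forall s t : R, 0 <= s <= 1 -> 0 <= t <= 1 -> `|f t - f s| <= C * `|t - s|.
Proof.
move=> df cf1; have [C hC] := @continuous_bounded_itv R 0 1 f1 cf1.
have C0 : 0 <= C.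
  have h0 : (0 : R) <= 0 <= (1 : R) by rewrite lexx/= ler01.
  exact: le_trans (normr_ge0 _) (hC 0 h0).
exists C => //; move=> s t; wlog st : s t / s <= t.
  move=> H sI tI; have [h|h] := leP s t; first exact: H.
  by rewrite distrC (distrC t s); apply: H => //; exact: ltW.
move=> /andP[s0 s1] /andP[t0 t1].
have [c] := MVT_segment st (fun r _ => df r) (is_derive_within (fun r _ => df r)).
rewrite in_itv/= => /andP[c1 c2] ->; rewrite normrM ler_wpM2r// hC//.
by rewrite (le_trans s0 c1) (le_trans c2 t1).
Qed.

(** The curve is Lipschitz, so that it is covered by [n + 1] squares of side
    [O(1 / n)], of total area [O(1 / n)]. *)
Lemma trace_null : (mu \x mu)%E trace = 0%E.
Proof.
have [C1 C10 h1] := lipschitz_itv dx cx1.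
have [C2 C20 h2] := lipschitz_itv dy cy1.
pose C := C1 + C2 + 1.
have C0 : 0 < C by rewrite ltr_wpDl// addr_ge0.
pose B n (i : nat) := open_box (x (i%:R / n.+1%:R), y (i%:R / n.+1%:R)) (C / n.+1%:R) : set (R * R).
have cover n : trace `<=` \big[setU/set0]_(i < n.+1) B n i.
  move=> p /traceP[u /andP[u0 u1] ->].
  have n0 : 0 < n.+1%:R :> R by rewrite ltr0n.
  pose i := Num.truncn (u * n.+1%:R).
  have nu0 : 0 <= u * n.+1%:R by rewrite mulr_ge0.
  have /andP[i1 i2] := truncn_itv nu0.
  have iN : (i < n.+1)%N.
    by rewrite -(ltr_nat R); apply: le_lt_trans i1 _; rewrite gtr_pMl.
  rewrite -(bigcup_mkord n.+1 (B n)); exists i => //.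
  have in1 : i%:R / n.+1%:R <= u by rewrite ler_pdivrMr.
  have in2 : u <= i%:R / n.+1%:R + n.+1%:R^-1.
    by rewrite -[X in _ + X]mul1r -mulrDl ler_pdivlMr// natr1 ltW.
  have in0 : 0 <= i%:R / n.+1%:R :> R by rewrite divr_ge0.
  have d : `|u - i%:R / n.+1%:R| <= n.+1%:R^-1 by rewrite ger0_norm ?subr_ge0// lerBlDl.
  have uI : 0 <= u <= 1 by rewrite u0 ltW.
  have iI : 0 <= (i%:R / n.+1%:R : R) <= 1 by apply/andP; split; [exact: in0|exact: le_trans in1 (ltW u1)].
  have v0 : 0 < n.+1%:R^-1 :> R by rewrite invr_gt0.
  apply/open_boxP; rewrite /= distrC (distrC (y _)); split.
    apply: le_lt_trans (h1 _ _ iI uI) _; apply: (@le_lt_trans _ _ (C1 * n.+1%:R^-1)).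
      by rewrite ler_wpM2l.
    by rewrite ltr_pM2r// /C; lra.
  apply: le_lt_trans (h2 _ _ iI uI) _; apply: (@le_lt_trans _ _ (C2 * n.+1%:R^-1)).
    by rewrite ler_wpM2l.
  by rewrite ltr_pM2r// /C; lra.
have bound n : ((mu \x mu)%E trace <= (4 * C ^+ 2 / n.+1%:R)%:E)%E.
  have n0 : 0 < n.+1%:R :> R by rewrite ltr0n.
  apply: (@le_trans _ _ (\sum_(i < n.+1) (mu \x mu)%E (B n i))%E).
    apply: content_subadditive => //; last exact: measurable_trace.
    by move=> i _; exact: measurable_open_box.
  have -> : (\sum_(i < n.+1) (mu \x mu)%E (B n i) = \sum_(i < n.+1) ((2 * C / n.+1%:R) ^+ 2)%R%:E)%E.
    apply: eq_bigr => i _; rewrite /B /open_box product_measure1E//= !lebesgue_measure_itv/= !lte_fin.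
    have v0 : 0 < C / n.+1%:R by rewrite divr_gt0.
    set X := x _; set Y := y _; set e := C / _ in v0 *.
    have -> : X - e < X + e by lra.
    have -> : Y - e < Y + e by lra.
    rewrite -!EFinD -EFinM; congr EFin.
    by rewrite (_ : 2 * C / n.+1%:R = 2 * e); [ring|rewrite /e mulrA].
  rewrite sumEFin lee_fin sumr_const card_ord -[leLHS]mulr_natr.
  rewrite le_eqVlt; apply/orP; left; apply/eqP.
  by field; rewrite gt_eqF.
have cv : (fun n => (4 * C ^+ 2 / n.+1%:R)%:E) @ \oo --> 0%:E.
  apply: cvg_EFin; first exact: nearW.
  rewrite -[X in _ --> X](mulr0 (4 * C ^+ 2)); apply: cvgMr.
  exact: cvg_harmonic.
apply/eqP; rewrite eq_le measure_ge0 andbT.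
have : ((mu \x mu)%E trace <= limn (fun n => (4 * C ^+ 2 / n.+1%:R)%R%:E))%E.
  by apply: lime_ge; [exact: cvgP cv|exact: nearW].
by rewrite (cvg_lim _ cv).
Qed.

(** * Vertical slices of the enclosed region *)

Let mI (a b : R) : measurable (`[a, b]%classic : set R).
Proof. exact: measurable_itv. Qed.

Lemma ae_slice_trace : {ae mu, forall xi : R, mu (xsection trace xi) = 0%E}.
Proof.
have mt := measurable_trace.
have := trace_null; rewrite /product_measure1 => h.
have mfun := @measurable_fun_xsection _ _ _ _ R mu _ mt.
have : (\int[mu]_xi `|(mu \o xsection trace) xi| = 0)%E.
  by rewrite -h; apply: eq_integral => xi _; rewrite gee0_abs// measure_ge0.
move/(ae_eq_integral_abs mu measurableT mfun).
by move=> [N [mN N0 hN]]; exists N; split => // xi k; apply: hN => k'; exact/k/(k' I).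
Qed.

Lemma measurable_invsqrt_comp :
  measurable_fun setT (fun z : R * R => invsqrt (x z.2 - z.1)).
Proof.
apply: (measurableT_comp measurable_invsqrt); apply: measurable_funB.
  apply: (measurableT_comp (continuous_measurable_fun curve_cx)).
  exact: measurable_snd.
exact: measurable_fst.
Qed.

(** By Tonelli, the double integral is at most the supremum over [t] of the integral
    in [xi], which [invsqrt_int] bounds. *)
Lemma ae_slice_invsqrt (M : R) : (forall t, `|x t| <= M) ->
  {ae mu, forall xi : R, - M <= xi <= M -> (\int[mu]_(t in `[0%R, 1%R]) invsqrt (x t - xi)%R < +oo)%E}.
Proof.
move=> hM.
have f0 z : (0 <= invsqrt (x z.2 - z.1)%R)%E by exact: invsqrt_ge0.
have mG := measurable_tonelli_rect (mI (- M) M) (mI 0 1) measurable_invsqrt_comp f0.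
have fin : (\int[mu]_(xi in `[(- M)%R, M]) \int[mu]_(t in `[0%R, 1%R]) invsqrt (x t - xi)%R < +oo)%E.
  have := tonelli_rect (mI (- M) M) (mI 0 1) measurable_invsqrt_comp f0.
  move=> /= ->.
  apply: (@le_lt_trans _ _ (\int[mu]_(t in `[0%R, 1%R]) (4 * Num.sqrt (2 * M + 1))%R%:E)%E).
    apply: ge0_le_integral => //.
    - by move=> t _; apply: integral_ge0 => xi _; exact: invsqrt_ge0.
    - have mf' : measurable_fun setT (fun z : R * R => invsqrt (x z.1 - z.2)).
        apply: (measurableT_comp measurable_invsqrt); apply: measurable_funB.
          apply: (measurableT_comp (continuous_measurable_fun curve_cx)).
          exact: measurable_fst.
        exact: measurable_snd.
      apply: (measurable_tonelli_rect (mI 0 1) (mI (- M) M) mf') => z.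
      exact: invsqrt_ge0.
    - by move=> t _; exact: invsqrt_int.
  rewrite integral_cst//= lebesgue_measure_itv/= lte_fin ltr01 oppr0 adde0 mule1.
  exact: ltry.
have ig : mu.-integrable `[(- M)%R, M] (fun xi => \int[mu]_(t in `[0%R, 1%R]) invsqrt (x t - xi)%R)%E.
  apply/integrableP; split => //.
  rewrite (_ : (fun xi => _) = (fun xi => \int[mu]_(t in `[0%R, 1%R]) invsqrt (x t - xi)%R)%E)//.
  by apply/funext => xi; rewrite gee0_abs//; apply: integral_ge0 => t _; exact: invsqrt_ge0.
have := @integrable_ae _ _ R mu `[(- M)%R, M]%classic (mI _ _) _ ig.
move=> [N [mN N0 hN]]; exists N; split => // xi k; apply: hN => k'; apply: k => xiM.
have /k' : `[(- M)%R, M]%classic xi by rewrite /= in_itv.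
by rewrite ge0_fin_numE//; apply: integral_ge0 => t _; exact: invsqrt_ge0.
Qed.

Lemma measurable_inv_ge0 (D : R * R -> R) : (forall z, 0 <= D z) -> measurable_fun setT D ->
  measurable_fun setT (fun z => (D z)^-1).
Proof.
move=> D0 mD.
have -> : (fun z => (D z)^-1) = (fun r => r `^ (-1)) \o D.
  by apply/funext => z; rewrite /= powR_inv1.
by apply: measurableT_comp => //; exact: measurable_powR.
Qed.

Lemma measurable_wform xi : measurable_fun setT (fun z : R * R => wform (xi, z.1) z.2).
Proof.
have m2 (f : R -> R) : continuous f -> measurable_fun setT (fun z : R * R => f z.2).
  by move=> cf; apply: (measurableT_comp (continuous_measurable_fun cf)); exact: measurable_snd.
have mx := m2 _ curve_cx; have my := m2 _ curve_cy.
have mx1 := m2 _ cx1; have my1 := m2 _ cy1.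
have ma : measurable_fun setT (fun z : R * R => x z.2 - xi) by apply: measurable_funB.
have ms : measurable_fun setT (fun z : R * R => y z.2 - z.1).
  by apply: measurable_funB => //; exact: measurable_fst.
apply: measurable_funM.
  by apply: measurable_funB; apply: measurable_funM.
apply: measurable_inv_ge0; first by move=> z; rewrite addr_ge0 ?sqr_ge0.
by apply: measurable_funD; apply: measurable_funX.
Qed.

(** The abscissas to which the exchange of integrals applies: the index form is
    integrable on the vertical line, and the line meets the curve in a null set. *)
Definition good (xi : R) := (\int[mu]_(t in `[0%R, 1%R]) invsqrt (x t - xi)%R < +oo)%E /\
  mu (xsection trace xi) = 0%E.

Lemma measurable_invsqrt_slice xi : measurable_fun setT (fun t => invsqrt (x t - xi)).
Proof.
apply: (measurableT_comp measurable_invsqrt); apply: measurable_funB => //.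
exact: (continuous_measurable_fun curve_cx).
Qed.

Lemma good_avoid xi : good xi -> {ae mu, forall t : R, 0 <= t <= 1 -> x t <> xi}.
Proof.
move=> [gi _].
have ig : mu.-integrable `[0%R, 1%R] (fun t => invsqrt (x t - xi)).
  apply/integrableP; split; first by apply: measurable_funTS; exact: measurable_invsqrt_slice.
  rewrite (_ : (fun t => _) = (fun t => invsqrt (x t - xi)))//.
  by apply/funext => t; rewrite gee0_abs// invsqrt_ge0.
have := @integrable_ae _ _ R mu `[0%R, 1%R]%classic (mI _ _) _ ig.
move=> [N [mN N0 hN]]; exists N; split => // t k; apply: hN => k'; apply: k => tI e.
have /k' : `[0%R, 1%R]%classic t by rewrite /= in_itv.
by rewrite e subrr /invsqrt eqxx.
Qed.

Lemma speed_bound : exists2 C : R, 0 < C & forall t : R, 0 <= t <= 1 -> `|x1 t| <= C /\ `|y1 t| <= C.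
Proof.
have [C1 h1] := @continuous_bounded_itv R 0 1 x1 cx1.
have [C2 h2] := @continuous_bounded_itv R 0 1 y1 cy1.
exists (`|C1| + `|C2| + 1); first by rewrite ltr_wpDl// addr_ge0.
move=> t tI; have := h1 t tI; have := h2 t tI; have := ler_norm C1; have := ler_norm C2.
have := normr_ge0 C1; have := normr_ge0 C2.
by move=> *; split; lra.
Qed.

(** [kernel_bound] gives the majorant [C |x - xi|^(-1/2) |y - eta|^(-1/2)], whose
    integral in [eta] is bounded uniformly in [t]. *)
Lemma slice_integrable (xi H : R) : good xi -> (forall t, `|y t| <= H) ->
  (\int[mu]_(t in `[0%R, 1%R]) \int[mu]_(eta in `[(- H)%R, H]) `|(wform (xi, eta) t)%:E| < +oo)%E.
Proof.
move=> [gi _] yH; have [C C0 hC] := speed_bound.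
pose K := 4 * Num.sqrt (2 * H + 1).
have K0 : 0 <= K by rewrite mulr_ge0.
apply: (@le_lt_trans _ _ (\int[mu]_(t in `[0%R, 1%R]) ((C * K)%:E * invsqrt (x t - xi)%R))%E); last first.
  rewrite ge0_integralZl//.
  - by rewrite lte_mul_pinfty// lee_fin mulr_ge0// ltW.
  - by apply: measurable_funTS; exact: measurable_invsqrt_slice.
  - by move=> t _; exact: invsqrt_ge0.
  - by rewrite lee_fin mulr_ge0// ltW.
have mw := measurable_wform xi.
have msl t : measurable_fun setT (fun eta : R => invsqrt (y t - eta)).
  by apply: (measurableT_comp measurable_invsqrt); apply: measurable_funB.
have mw2 t : measurable_fun setT (fun eta : R => wform (xi, eta) t).
  exact: (measurableT_comp mw (pair2_measurable t)).
apply: ge0_le_integral => //.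
- by move=> t _; apply: integral_ge0.
- pose g (z : R * R) := `|(wform (xi, z.2) z.1)%:E|%E.
  have mg : measurable_fun setT g.
    rewrite /g; apply: measurableT_comp => //; apply/measurable_EFinP.
    exact: (measurableT_comp mw (@measurable_swap _ _ _ _)).
  by apply: (measurable_tonelli_rect (mI 0 1) (mI (- H) H) mg) => z; exact: abse_ge0.
- apply: measurable_funTS; apply: emeasurable_funM => //; exact: measurable_invsqrt_slice.
- move=> t; rewrite /= in_itv/= => tI; have [h1 h2] := hC t tI.
  apply: (@le_trans _ _ (\int[mu]_(eta in `[(- H)%R, H]) (C%:E * invsqrt (x t - xi)%R * invsqrt (y t - eta)%R))%E).
    apply: ge0_le_integral => //.
    + apply: measurable_funTS; apply/measurable_EFinP; apply: measurableT_comp => //.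
      exact: mw2.
    + by apply: measurable_funTS; apply: measurable_funeM; exact: msl.
    + move=> eta _; rewrite -muleA; have := @kernel_bound R (x t - xi) (y t - eta) (x1 t) (y1 t) C C0 h1 h2.
      by [].
  rewrite ge0_integralZl//; [| by apply: measurable_funTS; exact: msl | by move=> eta _; exact: invsqrt_ge0 | ].
  - rewrite EFinM -!muleA lee_pmul2l//; rewrite ?lte_fin//.
    rewrite muleC; apply: lee_wpmul2r; first exact: invsqrt_ge0.
    by have := @invsqrt_int R (y t) H (yH t).
  - by rewrite mule_ge0 ?invsqrt_ge0// lee_fin ltW.
Qed.

Local Notation E := (enclosed_region x y).

Section SliceFormula.

Let mE : measurable E.
Proof. exact: measurable_enclosed. Qed.

Variables (xi M : R).
Hypothesis gxi : good xi.
Hypothesis M0 : 0 < M.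
Hypothesis hM : forall t, `|x t| < M /\ `|y t| < M.

Let S := xsection E xi.

Let mS : measurable S. Proof. exact: measurable_xsection. Qed.

Lemma xsection_enclosed eta : S eta <-> E (xi, eta).
Proof. by rewrite /S /xsection /= inE. Qed.

(** The index is [1] on the slice of the enclosed region and [0] elsewhere off the
    curve. *)
Lemma slice_lhs H : M <= H ->
  (\int[mu]_(eta in `[(- H)%R, H]) \int[mu]_(t in `[0%R, 1%R]) (wform (xi, eta) t)%:E =
   (2 * pi)%:E * mu S)%E.
Proof.
move=> MH; have yH t : `|y t| <= H by apply: le_trans MH; apply: ltW; case: (hM t).
have pi0 := pi_gt0 R.
have SH : S `<=` `[(- H), H].
  move=> eta /xsection_enclosed Eeta.
  have [_ /=] := enclosed_box hM Eeta.
  by rewrite in_itv/= ltr_norml => /andP[h1 h2]; apply/andP; split; lra.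
have mf : measurable_fun `[(- H), H]
   (fun eta => \int[mu]_(t in `[0%R, 1%R]) (wform (xi, eta) t)%:E)%E.
  have mw : measurable_fun setT (fun z : R * R => (wform (xi, z.1) z.2)%:E).
    by apply/measurable_EFinP; exact: measurable_wform.
  exact: (measurable_fubini_rect (mI (- H) H) (mI 0 1) mw (slice_integrable gxi yH)).
transitivity (\int[mu]_(eta in `[(- H)%R, H]) ((2 * pi)%:E * (\1_S eta)%:E))%E.
  apply: ae_eq_integral => //.
    by apply: measurable_funeM; apply/measurable_EFinP; exact: measurable_indic.
  have [_ null] := gxi.
  exists (xsection trace xi); split => //.
    by apply: measurable_xsection; exact: measurable_trace.
  move=> eta /= h; rewrite /xsection/= inE => op; apply: h => _.
  have cw := continuous_wform op.
  rewrite integral_EFin; last exact: integrable_continuous.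
  rewrite -/(wint (xi, eta)) -EFinM indicE; congr EFin.
  have [/set_mem/xsection_enclosed Eeta|/negP nE] := boolP (eta \in S).
    by rewrite Hccw// mulr1.
  rewrite mulr0; apply: contrapT => w0; apply: nE; rewrite inE; apply/xsection_enclosed.
  by apply/(enclosedP).
rewrite ge0_integralZl//.
- by rewrite integral_indic// setIidl.
- by apply/measurable_EFinP; exact: measurable_indic.
- by rewrite lee_fin mulr_ge0// ltW.
Qed.

(** The integral of the index along a vertical line is computed in the other order,
    with the integral in [eta] first.  As the line is exhausted by segments, the
    form seen from the line tends to [pi sgn (x - xi) y'], with a bound that
    permits dominated convergence. *)
Lemma slice_formula :
  ((2 * pi)%:E * mu S = \int[mu]_(t in `[0%R, 1%R]) (pi * Num.sg (x t - xi) * y1 t)%:E)%E.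
Proof.
pose H n := n%:R + 2 * M.
have H2 n : 2 * M <= H n by rewrite /H lerDr.
have M2 : M <= 2 * M by rewrite ler_peMl ?(ltW M0)// ler1n.
have MH n : M <= H n by apply: le_trans (H2 n).
have yH n t : `|y t| <= H n by apply: le_trans (MH n); apply: ltW; case: (hM t).
have mw : measurable_fun setT (fun z : R * R => (wform (xi, z.1) z.2)%:E).
  by apply/measurable_EFinP; exact: measurable_wform.
pose f n t := (\int[mu]_(eta in `[(- H n)%R, H n]) (wform (xi, eta) t)%:E)%E.
have e n : ((2 * pi)%:E * mu S = \int[mu]_(t in `[0%R, 1%R]) f n t)%E.
  rewrite -(slice_lhs (MH n)) /f.
  exact: (fubini_rect (mI _ _) (mI _ _) mw (slice_integrable gxi (yH n))).
have [C C0 hC] := speed_bound.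
have mx : measurable_fun setT (fun t => x t - xi).
  by apply: measurable_funB => //; exact: (continuous_measurable_fun curve_cx).
have msg : measurable_fun setT (fun t => Num.sg (x t - xi)).
  exact: (measurableT_comp measurable_sgr mx).
have fE n t : x t <> xi -> f n t = (strip (x t - xi) (y t) (x1 t) (y1 t) (H n))%:E.
  move=> /eqP; rewrite -subr_eq0 => a0.
  have H0 : 0 <= H n by apply: le_trans (MH n); exact: ltW.
  have [ck <-] := strip_integral (y t) (x1 t) (y1 t) a0 H0.
  by rewrite /f -integral_EFin//; exact: integrable_continuous.
have := @dominated_convergence _ _ _ mu `[0%R, 1%R]%classic (mI 0 1) f
  (fun t => (pi * Num.sg (x t - xi) * y1 t)%:E) (cst (C * (pi + 4))%:E).
case.
- move=> n.
  have mw' : measurable_fun setT (fun z : R * R => (wform (xi, z.2) z.1)%:E).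
    exact: (measurableT_comp mw (@measurable_swap _ _ _ _)).
  apply: (measurable_fubini_rect (mI 0 1) (mI (- H n) (H n)) mw').
  have mabs : measurable_fun setT (fun z : R * R => `|(wform (xi, z.1) z.2)%:E|%E).
    by apply: measurableT_comp.
  have := tonelli_rect (mI (- H n) (H n)) (mI 0 1) mabs (fun z => abse_ge0 _) => /= ->.
  exact: (slice_integrable gxi (yH n)).
- apply/measurable_EFinP; apply: measurable_funTS; apply: measurable_funM.
    by apply: measurable_funM => //; exact: measurable_cst.
  exact: continuous_measurable_fun.
- have [N [mN N0 hN]] := good_avoid gxi.
  exists N; split => // t k; apply: hN => k'; apply: k => tI.
  have xt : x t <> xi by apply: k'; move: tI; rewrite /= in_itv.
  under eq_fun do rewrite (fE _ _ xt).
  apply: cvg_EFin; first exact: nearW.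
  have a0 : x t - xi != 0 by rewrite subr_eq0; exact/eqP.
  by apply: strip_cvg => //; apply: ltW; case: (hM t).
- apply/integrableP; split; first exact: measurable_cst.
  by rewrite integral_cst//= lebesgue_measure_itv/= lte_fin ltr01 oppr0 adde0 mule1 ltry.
- have [N [mN N0 hN]] := good_avoid gxi.
  exists N; split => // t k; apply: hN => k'; apply: k => n tI.
  have tI' : 0 <= t <= 1 by move: tI; rewrite /= in_itv.
  have xt : x t <> xi by exact: k'.
  have [c1 c2] := hC t tI'.
  rewrite (fE _ _ xt) /= lee_fin; apply: (@strip_bound _ _ _ _ _ _ M) => //.
    by rewrite subr_eq0; exact/eqP.
  by apply: ltW; case: (hM t).
move=> _ _ cv.
have cv2 : (fun n => \int[mu]_(t in `[0%R, 1%R]) f n t)%E @ \oo --> ((2 * pi)%:E * mu S)%E.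
  by under eq_fun do rewrite -e; exact: cvg_cst.
exact: (cvg_unique _ cv2 cv).
Qed.

End SliceFormula.

(** * The area of the enclosed region *)

Lemma integrable_sg (c a b : R) :
  mu.-integrable `[a, b] (EFin \o (fun xi : R => Num.sg (c - xi))).
Proof.
have msg : measurable_fun setT (fun xi : R => Num.sg (c - xi)).
  by apply: (measurableT_comp measurable_sgr); apply: measurable_funB.
have icst : mu.-integrable `[a, b] (EFin \o (cst 1 : R -> R)).
  by apply: integrable_continuous => u; exact: cvg_cst.
have := @integrable_itvM R a b 1 _ _ icst (measurable_funTS msg).
have b1 t : a <= t <= b -> `|Num.sg (c - t)| <= 1.
  by move=> _; rewrite normr_sg; case: (_ != _).
by move=> /(_ b1); congr integrable; apply/funext => t /=; rewrite mul1r.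
Qed.

Lemma sg_integral (c M : R) : `|c| <= M -> \int[mu]_(xi in `[- M, M]) Num.sg (c - xi) = 2 * c.
Proof.
rewrite ler_norml => /andP[c1 c2].
have msg : measurable_fun setT (fun xi : R => Num.sg (c - xi)).
  by apply: (measurableT_comp measurable_sgr); apply: measurable_funB.
have icst (a b k : R) : mu.-integrable `[a, b] (EFin \o (fun=> k)).
  by apply: integrable_continuous => t; exact: cvg_cst.
have isg a b := @integrable_sg c a b.
rewrite (Rintegral_split (c := c)); [|by rewrite c1|exact: isg].
have -> : \int[mu]_(t in `[- M, c]) Num.sg (c - t) = c + M.
  transitivity (\int[mu]_(t in `[- M, c]) (1 : R)); last by rewrite Rintegral_one// opprK.
  apply: Rintegral_ae_eq; [exact: measurable_funTS|exact: measurable_cst|].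
  have := ae_neq c; apply: filterS; first exact: (ae_filter_ringOfSetsType mu).
  move=> t tc /andP[_ ht]; rewrite gtr0_sg// subr_gt0 lt_neqAle ht andbT.
  exact/eqP.
have -> : \int[mu]_(t in `[c, M]) Num.sg (c - t) = - (M - c).
  transitivity (\int[mu]_(t in `[c, M]) (-1 * (1 : R))); last first.
    by rewrite RintegralZl ?Rintegral_one// ?mulN1r//; exact: icst.
  apply: Rintegral_ae_eq; [exact: measurable_funTS|exact: measurable_cst|].
  have := ae_neq c; apply: filterS; first exact: (ae_filter_ringOfSetsType mu).
  move=> t tc /andP[ht _]; rewrite ltr0_sg ?mulr1// subr_lt0 lt_neqAle ht andbT.
  by apply/eqP => e; apply: tc.
ring.
Qed.

(** [slice_formula] is integrated over [xi] in [[- M, M]].  Its right side is bounded,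
    so that Fubini's theorem applies, and [pi sgn (x - xi)] becomes [2 pi x]. *)
Lemma area_formula : fine ((mu \x mu)%E E) = \int[mu]_(t in `[0, 1]) (x t * y1 t).
Proof.
have pi0 := pi_gt0 R.
have [M M0 hM] := curve_bounded.
have xM t : `|x t| <= M by apply: ltW; case: (hM t).
have [C C0 hC] := speed_bound.
have mE : measurable E by exact: measurable_enclosed.
pose f (z : R * R) := (pi * Num.sg (x z.2 - z.1) * y1 z.2)%:E.
have mf : measurable_fun setT f.
  apply/measurable_EFinP; apply: measurable_funM.
    apply: measurable_funM; first exact: measurable_cst.
    apply: (measurableT_comp measurable_sgr); apply: measurable_funB; last exact: measurable_fst.
    apply: (measurableT_comp (continuous_measurable_fun curve_cx)); exact: measurable_snd.
  by apply: (measurableT_comp (continuous_measurable_fun cy1)); exact: measurable_snd.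
have i2 : (\int[mu]_(xi in `[(- M)%R, M]) (pi * C)%R%:E = (pi * C * (M + M))%:E)%E.
  have -> : (fun=> (pi * C)%R%:E) = cst (pi * C)%R%:E :> (R -> \bar R) by [].
  rewrite integral_cst// [X in (_ * X)%E]lebesgue_measure_itv/= lte_fin -EFinB opprK.
  by rewrite (_ : - M < M) ?EFinM//; lra.
have bnd : (\int[mu]_(t in `[0%R, 1%R]) \int[mu]_(xi in `[(- M)%R, M]) (pi * C)%R%:E < +oo)%E.
  rewrite i2 (_ : (fun=> (pi * C * (M + M))%:E) = cst (pi * C * (M + M))%:E :> (R -> \bar R))//.
  by rewrite integral_cst// [X in (_ * X)%E]lebesgue_measure_itv/= lte_fin ltr01 oppr0 adde0 mule1 ltry.
have fin : (\int[mu]_(t in `[0%R, 1%R]) \int[mu]_(xi in `[(- M)%R, M]) `|f (xi, t)| < +oo)%E.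
  apply: le_lt_trans bnd; apply: ge0_le_integral => //.
  - by move=> t _; apply: integral_ge0.
  - have mabs : measurable_fun setT (fun z : R * R => `|f (z.2, z.1)|%E).
      apply: measurableT_comp => //; exact: (measurableT_comp mf (@measurable_swap _ _ _ _)).
    by apply: (measurable_tonelli_rect (mI 0 1) (mI (- M) M) mabs) => z; exact: abse_ge0.
  - move=> t; rewrite /= in_itv/= => tI; apply: ge0_le_integral => //.
    + have mt : measurable_fun setT (fun xi => f (xi, t)).
        exact: (measurableT_comp mf (pair2_measurable t)).
      by apply: measurable_funTS; exact: (measurableT_comp (@abse_measurable R setT) mt).
    + move=> xi _; rewrite lee_fin !normrM (gtr0_norm pi0) -mulrA ler_pM2l//.
      rewrite -[leRHS]mul1r; apply: ler_pM => //; last by case: (hC t tI).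
      by rewrite normr_sg; case: (_ != _).
have fub := fubini_rect (mI (- M) M) (mI 0 1) mf fin.
have rhs : (\int[mu]_(t in `[0%R, 1%R]) \int[mu]_(xi in `[(- M)%R, M]) f (xi, t) =
   ((2 * pi) * \int[mu]_(t in `[0, 1]) (x t * y1 t))%R%:E)%E.
  have cxy : continuous (fun t => x t * y1 t).
    by move=> t; apply: cvgM; [exact: curve_cx|exact: cy1].
  rewrite -RintegralZl; [|exact: mI|exact: integrable_continuous].
  rewrite -integral_EFin; last by apply: integrable_itvZ; exact: integrable_continuous.
  apply: eq_integral => t _.
  have isg := @integrable_sg (x t) (- M) M.
  have e : (fun xi => f (xi, t)) = (EFin \o (fun xi => (pi * y1 t) * Num.sg (x t - xi))).
    by apply/funext => xi; rewrite /f/= mulrAC.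
  rewrite e integral_EFin; last exact: integrable_itvZ.
  by rewrite RintegralZl; [rewrite sg_integral; [congr EFin; ring|exact: xM]|exact: mI|exact: isg].
have lhs : ((2 * pi)%:E * (mu \x mu) E = \int[mu]_(xi in `[(- M)%R, M]) \int[mu]_(t in `[0%R, 1%R]) f (xi, t))%E.
  rewrite /product_measure1 -ge0_integralZl; last 4 first.
  - exact: measurableT.
  - exact: measurable_fun_xsection.
  - by move=> xi _; exact: measure_ge0.
  - by rewrite lee_fin mulr_ge0 ?(ltW pi0).
  rewrite [RHS]integral_mkcond; apply: ae_eq_integral.
  - exact: measurableT.
  - by apply: measurable_funeM; exact: measurable_fun_xsection.
  - apply: (measurable_restrictT _ (mI (- M) M)).1.
    exact: (measurable_fubini_rect (mI (- M) M) (mI 0 1) mf fin).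
  have [N1 [mN1 N10 hN1]] := ae_slice_trace.
  have [N2 [mN2 N20 hN2]] := ae_slice_invsqrt xM.
  exists (N1 `|` N2); split; [exact: measurableU|by rewrite null_set_setU|].
  move=> xi k; apply: contrapT => /not_orP[n1 n2]; apply: k => _.
  have g1 : mu (xsection trace xi) = 0%E by apply: contrapT => h; apply: n1; exact: hN1.
  rewrite patchE; case: ifPn => [/set_mem|/negP nxi].
    rewrite /= in_itv/= => xiM.
    have g2 : (\int[mu]_(t in `[0%R, 1%R]) invsqrt (x t - xi)%R < +oo)%E.
      by apply: contrapT => h; apply: n2; apply: hN2 => /= /(_ xiM).
    exact: (slice_formula (conj g2 g1) M0 hM).
  suff e : xsection E xi = set0 by rewrite [(mu \o _) xi]/= e measure0 mule0.
  apply/seteqP; split => [eta|eta []]; rewrite /xsection/= inE => Ee; apply: nxi.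
  have [+ _] := enclosed_box hM Ee.
  by rewrite /= inE/= in_itv/= ltr_norml => /andP[/ltW -> /ltW ->].
have Efin : (mu \x mu)%E E \is a fin_num.
  rewrite ge0_fin_numE ?measure_ge0//.
  exact: enclosed_measure_fin.
have : ((2 * pi) * fine ((mu \x mu)%E E))%:E = ((2 * pi) * \int[mu]_(t in `[0, 1]) (x t * y1 t))%:E.
  by rewrite EFinM fineK// lhs fub rhs.
move=> [] /mulfI; apply; rewrite gt_eqF// mulr_gt0//.
Qed.

End ClosedCurve.

(** * The Wulff inequality for Jordan curves and optimal anisotropies *)

Lemma is_deriveMl (R : realType) (c : R) (g g' : R -> R) :
  (forall v : R, is_derive v 1 g (g' v)) ->
  forall v : R, is_derive v 1 (fun v => c * g v) (c * g' v).
Proof.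
by move=> dg v; have := dg v => ?; apply: is_derive_eq; rewrite /GRing.scale/=; ring.
Qed.

Section JordanCurve.
Context {R : realType}.
Notation mu := (@lebesgue_measure R).
Variable G : jordan_curve R.

Local Notation x := (cx G).
Local Notation y := (cy G).
Local Notation x1 := (derive1 x).
Local Notation y1 := (derive1 y).
Local Notation nu := (tangent_angle G).
Local Notation sp := (speed x y).

Let dx (t : R) : is_derive t 1 x (x1 t).
Proof. by rewrite derive1E; apply: derivableP; exact: cx_derivable. Qed.

Let dy (t : R) : is_derive t 1 y (y1 t).
Proof. by rewrite derive1E; apply: derivableP; exact: cy_derivable. Qed.

Let cx1 : continuous x1. Proof. exact: cx_C1. Qed.
Let cy1 : continuous y1. Proof. exact: cy_C1. Qed.
Let px : periodic x 1. Proof. exact: cx_periodic. Qed.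
Let py : periodic y 1. Proof. exact: cy_periodic. Qed.

Lemma speed_gt0 t : 0 < sp t.
Proof.
rewrite sqrtr_gt0 lt_neqAle addr_ge0 ?sqr_ge0// andbT eq_sym paddr_eq0 ?sqr_ge0//.
by rewrite !sqrf_eq0; have := curve_regular G t; rewrite xpair_eqE.
Qed.

Lemma speed_continuous : continuous sp.
Proof.
move=> t; apply: (@continuous_comp _ _ _ (fun t => x1 t ^+ 2 + y1 t ^+ 2) (@Num.sqrt R)).
  by apply: cvgD; rewrite /= expr2; apply: cvgM; [exact: cx1|exact: cx1|exact: cy1|exact: cy1].
exact: sqrt_continuous.
Qed.

Lemma curve_x1E t : x1 t = sp t * cos (nu t).
Proof. by rewrite -tangent_angle_cos mulrCA divff ?mulr1// gt_eqF// speed_gt0. Qed.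

Lemma curve_y1E t : y1 t = sp t * sin (nu t).
Proof. by rewrite -tangent_angle_sin mulrCA divff ?mulr1// gt_eqF// speed_gt0. Qed.

(** The angle itself may jump by multiples of [2 pi]; its trigonometric functions are
    continuous, by induction on [k] from the unit tangent. *)
Lemma angle_continuous (k : nat) :
  continuous (fun t => cos (k%:R * nu t)) /\ continuous (fun t => sin (k%:R * nu t)).
Proof.
have cc : continuous (fun t => cos (nu t)).
  move=> t; under eq_fun do rewrite -tangent_angle_cos.
  by apply: cvgM; [exact: cx1|apply: cvgV; [rewrite gt_eqF// speed_gt0|exact: speed_continuous]].
have cs : continuous (fun t => sin (nu t)).
  move=> t; under eq_fun do rewrite -tangent_angle_sin.
  by apply: cvgM; [exact: cy1|apply: cvgV; [rewrite gt_eqF// speed_gt0|exact: speed_continuous]].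
elim: k => [|k [ck sk]].
  by split=> t; under eq_fun do rewrite mul0r; exact: cvg_cst.
have e t : k.+1%:R * nu t = k%:R * nu t + nu t by rewrite -natr1 mulrDl mul1r.
split=> t; under eq_fun do rewrite e ?cosD ?sinD.
  by apply: cvgB; apply: cvgM; [exact: ck|exact: cc|exact: sk|exact: cs].
by apply: cvgD; apply: cvgM; [exact: sk|exact: cc|exact: ck|exact: cs].
Qed.

Lemma trig_angle_continuous N f : trig N f -> continuous (fun t => f (nu t)).
Proof.
elim=> [k _|k _|g h _ ig _ ih|c g _ ig] t.
- by case: (angle_continuous k) => + _; apply.
- by case: (angle_continuous k) => _; apply.
- by apply: cvgD; [exact: ig|exact: ih].
- by apply: cvgM; [exact: cvg_cst|exact: ig].
Qed.

Lemma trig_energy_continuous N f : trig N f -> continuous (fun t => f (nu t) * sp t).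
Proof.
move=> tf t; apply: cvgM; [exact: (trig_angle_continuous tf)|exact: speed_continuous].
Qed.

Lemma trig_energy_integrable N f : trig N f ->
  mu.-integrable `[0, 1] (EFin \o (fun t => f (nu t) * sp t)).
Proof. by move=> tf; apply: integrable_continuous; exact: trig_energy_continuous tf. Qed.

Lemma interface_energyZ N c f : trig N f ->
  interface_energy (fun v => c * f v) G = c * interface_energy f G.
Proof.
move=> tf; rewrite /interface_energy /curve_integral -RintegralZl//; last exact: trig_energy_integrable tf.
by apply: eq_Rintegral => t _; rewrite mulrA.
Qed.

Lemma curve_length_gt0 : 0 < curve_length G.
Proof.
have [F dF] := primitive_exists (-1) speed_continuous.
have dF01 (t : R) : 0 <= t <= 1 -> is_derive t 1 F (sp t).
  by move=> /andP[t0 _]; apply: dF; apply: lt_le_trans t0; rewrite ltrN10.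
rewrite /curve_length /curve_integral; under eq_Rintegral do rewrite mul1r.
rewrite (int_FTC_global ler01 speed_continuous dF01) subr_gt0.
by apply: (gt0_derive_lt ltr01 dF01) => t _; exact: speed_gt0.
Qed.

Let wintE p : wint x y x1 y1 p = 2 * pi * winding_number x y p.
Proof.
have pi0 := pi_gt0 R.
by rewrite /winding_number mulrA divff ?mul1r// gt_eqF// mulr_gt0.
Qed.

Let Hccw p : enclosed_region x y p -> wint x y x1 y1 p = 2 * pi.
Proof. by move=> pE; rewrite wintE curve_counterclockwise ?mulr1. Qed.

Lemma enclosed_areaE : enclosed_area G = \int[mu]_(t in `[0, 1]) (x t * y1 t).
Proof. exact: (area_formula dx dy cx1 cy1 px py Hccw). Qed.

Lemma enclosed_area_gt0 : 0 < enclosed_area G.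
Proof.
have [p po pw] := winding_jump dx dy cx1 cy1 px py (curve_regular G) (curve_simple (j := G)).
have Ep : enclosed_region x y !=set0.
  exists p; apply/(enclosedP dx dy cx1 cy1 px py Hccw); split => //; exact/eqP.
have E0 := enclosed_measure_gt0 dx dy cx1 cy1 px py Hccw Ep.
have Eoo := enclosed_measure_fin dx dy cx1 cy1 px py Hccw.
by rewrite /enclosed_area fine_gt0// E0 Eoo.
Qed.

Lemma trig_wulff_inequality N f f' f'' : trig N f -> trig N f' -> trig N f'' ->
  (forall v : R, is_derive v 1 f (f' v)) -> (forall v : R, is_derive v 1 f' (f'' v)) ->
  (forall v, 0 < f v + f'' v) -> 0 <= wulff_area f ->
  4 * wulff_area f * enclosed_area G <= interface_energy f G ^+ 2.
Proof.
move=> tf tf' tf'' df df' f0 W0.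
have pi0 := pi_gt0 R.
rewrite enclosed_areaE.
have A0 := ltW enclosed_area_gt0; rewrite enclosed_areaE in A0.
have WE := trig_wulff_area tf tf' tf'' df df'.
rewrite WE pmulr_rge0// in W0; rewrite WE.
have x01 : x 0 = x 1 by rewrite -[1]add0r px.
have y01 : y 0 = y 1 by rewrite -[1]add0r py.
apply: (wulff_C2 dx dy cx1 cy1 x01 y01 _ curve_x1E curve_y1E df df') => //.
- by move=> t; apply: ltW; exact: speed_gt0.
- exact: trig_continuous tf''.
- exact: trig_periodic tf.
- exact: trig_periodic tf'.
- exact: trig_energy_integrable tf.
Qed.

Lemma interface_energy_cvg (t_ : nat -> R -> R) s M :
  (forall n, trig n.+1 (t_ n)) -> (forall v, t_ ^~ v @ \oo --> s v) ->
  (forall n v, `|t_ n v| <= M) ->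
  (fun n => interface_energy (t_ n) G) @ \oo --> interface_energy s G.
Proof.
move=> tt ts tM.
have [C hC] := @continuous_bounded_itv R 0 1 sp speed_continuous.
apply: (@Rintegral_bounded_cvg R 0 1 (M * C)) => [n|t _|n t t01].
- apply: measurable_funTS; apply: continuous_measurable_fun.
  exact: trig_energy_continuous (tt n).
- by apply: cvgM; [exact: ts|exact: cvg_cst].
- by rewrite normrM ler_pM//; exact: hC.
Qed.

(** The inequality passes to the limit along the approximants of [cone_approx]: their
    energies converge because they converge boundedly at each tangent angle. *)
Lemma wulff_inequality s : anisotropy_cone s -> 0 < wulff_area s ->
  0 <= interface_energy s G /\ 4 * wulff_area s * enclosed_area G <= interface_energy s G ^+ 2.
Proof.
move=> /cone_approx[t_ [t_' [t_'' [W [M [h1 [h2 [ts tM Ws hW]]]]]]]] s0.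
have tt n : trig n.+1 (t_ n) by case: (h1 n).
have Lc := interface_energy_cvg tt ts tM.
split.
  rewrite -(cvg_lim _ Lc)//; apply: limr_ge; first exact: cvgP Lc.
  near=> n; apply: Rintegral_ge0 => t _.
  by apply: mulr_ge0; [case: (h2 n (nu t))|exact: ltW (speed_gt0 t)].
have Wc : (fun n => 4 * W n * enclosed_area G) @ \oo --> 4 * wulff_area s * enclosed_area G.
  by apply: cvgM; [apply: cvgM => //; exact: cvg_cst|exact: cvg_cst].
have L2c : (fun n => interface_energy (t_ n) G ^+ 2) @ \oo --> interface_energy s G ^+ 2.
  by rewrite expr2; apply: cvgM.
apply: (ler_cvg_to Wc L2c); near=> n; have [tn tn' tn'' dn dn'] := h1 n.
apply: le_trans (trig_wulff_inequality tn tn' tn'' dn dn' _ _).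
- apply: ler_wpM2r; first exact: ltW enclosed_area_gt0.
  by apply: ler_wpM2l; [exact: ler0n|exact: hW].
- by move=> v; case: (h2 n v).
- by apply: ltW; apply: lt_le_trans (hW n); near: n; exact: cvgr_gt Ws _ s0.
Unshelve. all: by end_near. Qed.

Lemma wulff_area_trigZ N c f f' f'' : trig N f -> trig N f' -> trig N f'' ->
  (forall v : R, is_derive v 1 f (f' v)) -> (forall v : R, is_derive v 1 f' (f'' v)) ->
  wulff_area (fun v => c * f v) = c ^+ 2 * wulff_area f.
Proof.
move=> tf tf' tf'' df df'.
have ci : mu.-integrable `[0, 2 * pi] (EFin \o (fun t => f t * (f t + f'' t))).
  apply: integrable_continuous => t.
  by apply: cvgM; [|apply: cvgD]; [exact: trig_continuous tf t|exact: trig_continuous tf t|exact: trig_continuous tf'' t].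
rewrite (trig_wulff_area tf tf' tf'' df df').
rewrite (trig_wulff_area (trig_scale c tf) (trig_scale c tf') (trig_scale c tf'') (is_deriveMl c df) (is_deriveMl c df')).
rewrite mulrCA; congr (_ * _).
rewrite -RintegralZl//; apply: eq_Rintegral => t _; ring.
Qed.

(** The ratio is invariant under scaling, so that the constraint on the energy can
    be met by normalization. *)
Lemma trig_feasible N f f' f'' : trig N f -> trig N f' -> trig N f'' ->
  (forall v : R, is_derive v 1 f (f' v)) -> (forall v : R, is_derive v 1 f' (f'' v)) ->
  (forall v, 0 <= f v) -> (forall v, 0 <= f v + f'' v) ->
  0 < interface_energy f G -> 0 < wulff_area f ->
  exists g, [/\ feasible G N g, 0 < wulff_area g &
                anisoperimetric_ratio g G = anisoperimetric_ratio f G].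
Proof.
move=> tf tf' tf'' df df' f0 ff0 L0 W0.
pose c := curve_length G / interface_energy f G.
have c0 : 0 < c by rewrite divr_gt0// curve_length_gt0.
have WZ := wulff_area_trigZ c tf tf' tf'' df df'.
have LZ := interface_energyZ c tf.
exists (fun v => c * f v); split.
- split; first by rewrite LZ /c divfK// gt_eqF.
  apply: (trig_cone_trig (trig_scale c tf) (trig_scale c tf') (trig_scale c tf'') (is_deriveMl c df) (is_deriveMl c df')) => v.
    by rewrite mulr_ge0// ltW.
  by rewrite -mulrDr mulr_ge0// ltW.
- by rewrite WZ mulr_gt0// exprn_gt0.
- rewrite /anisoperimetric_ratio WZ LZ; field.
  by rewrite !gt_eqF// ?enclosed_area_gt0.
Qed.

Let den_gt0 (w : R) : 0 < w -> 0 < 4 * w * enclosed_area G.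
Proof. by move=> w0; apply: mulr_gt0; [exact: mulr_gt0|exact: enclosed_area_gt0]. Qed.

Lemma anisoperimetric_ratio_ge1 s : anisotropy_cone s -> 0 < wulff_area s ->
  1 <= anisoperimetric_ratio s G.
Proof.
move=> cs s0; have [_ wi] := wulff_inequality cs s0.
rewrite /anisoperimetric_ratio ler_pdivlMr ?mul1r//.
exact: den_gt0.
Qed.

(** Since the Wulff areas of the approximants are bounded below by a sequence that
    converges to the area of [s], their ratios are eventually below that of [s]
    plus [e]. *)
Lemma exists_feasible s e : anisotropy_cone s -> 0 < wulff_area s -> 0 < e ->
  exists n, forall N, (n < N)%N -> exists f, [/\ feasible G N f, 0 < wulff_area f &
     anisoperimetric_ratio f G < anisoperimetric_ratio s G + e].
Proof.
move=> cs s0 e0.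
have A0 := enclosed_area_gt0.
have [L0 wi] := wulff_inequality cs s0.
have {L0 wi} L0 : 0 < interface_energy s G.
  rewrite lt_neqAle L0 andbT eq_sym; apply: contraTneq wi => ->.
  by rewrite expr0n/= -ltNge den_gt0.
have /cone_approx[t_ [t_' [t_'' [W [M [h1 [h2 [ts tM Ws hW]]]]]]]] := cs.
have tt n : trig n.+1 (t_ n) by case: (h1 n).
have Lc := interface_energy_cvg tt ts tM.
have rc : (fun n => interface_energy (t_ n) G ^+ 2 / (4 * W n * enclosed_area G)) @ \oo -->
    anisoperimetric_ratio s G.
  apply: cvgM; first by rewrite expr2; apply: cvgM.
  apply: cvgV; first by rewrite gt_eqF// den_gt0.
  by apply: cvgM; [apply: cvgM => //; exact: cvg_cst|exact: cvg_cst].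
have se : anisoperimetric_ratio s G < anisoperimetric_ratio s G + e by rewrite ltrDl.
have : \forall n \near \oo, [/\ 0 < W n, 0 < interface_energy (t_ n) G &
    interface_energy (t_ n) G ^+ 2 / (4 * W n * enclosed_area G) < anisoperimetric_ratio s G + e].
  near=> n; split; near: n; [exact: cvgr_gt Ws _ s0|exact: cvgr_gt Lc _ L0|exact: cvgr_lt rc _ se].
move=> /filter_ex[n [Wn Ln rn]]; exists n => N nN.
have [tn tn' tn'' dn dn'] := h1 n.
have f0 v : 0 <= t_ n v by case: (h2 n v).
have ff0 v : 0 <= t_ n v + t_'' n v by apply: ltW; case: (h2 n v).
have W0 := lt_le_trans Wn (hW n).
have [g [fg g0 rg]] := trig_feasible (trigW nN tn) (trigW nN tn') (trigW nN tn'') dn dn' f0 ff0 Ln W0.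
exists g; split; [exact: fg|exact: g0|rewrite rg; apply: le_lt_trans rn].
rewrite /anisoperimetric_ratio; apply: ler_wpM2l; first exact: sqr_ge0.
rewrite lef_pV2 ?posrE; [|exact: den_gt0|exact: den_gt0].
apply: ler_wpM2r; first exact: ltW.
by apply: ler_wpM2l; [exact: ler0n|exact: hW].
Unshelve. all: by end_near. Qed.

Lemma isotropic_feasible N : (0 < N)%N -> feasible G N (fun=> 1) /\ 0 < wulff_area (fun=> 1 : R).
Proof.
move=> N0; have pi0 := pi_gt0 R.
have t1 : trig N (fun=> 1 : R) by exact: trig_cst.
have t0 : trig N (fun=> 0 : R) by exact: trig_cst.
have d1 (v : R) : is_derive v 1 (fun=> 1 : R) 0 by exact: is_derive_cst.
have d0 (v : R) : is_derive v 1 (fun=> 0 : R) 0 by exact: is_derive_cst.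
split.
  split=> //; apply: (trig_cone_trig t1 t0 t0 d1 d0) => v; rewrite ?addr0; exact: ler01.
rewrite (trig_wulff_area t1 t0 t0 d1 d0).
under eq_Rintegral do rewrite addr0 mul1r.
rewrite Rintegral_one ?subr0; last by rewrite mulr_ge0// ltW.
by rewrite mulr_gt0 ?invr_gt0// mulr_gt0.
Qed.

Lemma optimal_ratio_le N s f : optimal G N s -> feasible G N f -> 0 < wulff_area f ->
  anisoperimetric_ratio s G <= anisoperimetric_ratio f G.
Proof.
move=> [[sL _] smax] ff f0; have A0 := enclosed_area_gt0.
have s0 := lt_le_trans f0 (smax _ ff).
rewrite /anisoperimetric_ratio sL ff.1; apply: ler_wpM2l; first exact: sqr_ge0.
rewrite lef_pV2 ?posrE; [|exact: den_gt0|exact: den_gt0].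
apply: ler_wpM2r; first exact: ltW.
by apply: ler_wpM2l; [exact: ler0n|exact: smax].
Qed.

End JordanCurve.

Theorem theorem6p1 (R : realType) (G : jordan_curve R)
    (sigma : nat -> R -> R)
    (Hsigma : forall N : nat, (1 <= N)%N -> optimal G N (sigma N)) :
  let ratio := fun N : nat => anisoperimetric_ratio (sigma N) G in
  [/\ cvgn ratio,
      1 <= limn ratio &
      limn ratio =
        inf [set anisoperimetric_ratio tau G |
              tau in [set tau | anisotropy_cone tau /\ 0 < wulff_area tau]]].
Proof.
move=> ratio; set S := [set _ | _ in _].
have S1 : lbound S 1 by move=> _ [tau [ct t0] <-]; exact: anisoperimetric_ratio_ge1.
have [[_ [one_cone _]] one_gt0] := isotropic_feasible G (ltnSn 0).
have S0 : S !=set0 by exists (anisoperimetric_ratio (fun=> 1) G), (fun=> 1).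
have inf1 : 1 <= inf S by exact: lb_le_inf.
(* The isotropic anisotropy is feasible, so that an optimal solution has a positive
   Wulff area and its ratio is among those of which the infimum is taken. *)
have inf_le N : (0 < N)%N -> inf S <= ratio N.
  move=> N0; have [[_ [cs _]] smax] := Hsigma N N0.
  have [f1 f10] := isotropic_feasible G N0.
  apply: ge_inf; first by exists 1.
  by exists (sigma N); [split; [exact: cs|exact: lt_le_trans f10 (smax _ f1)]|].
have cvg_inf : ratio @ \oo --> inf S.
  apply/cvgrPdist_lt => e e0.
  have e2 : 0 < e / 2 by rewrite divr_gt0.
  have [_ [tau [ct t0] <-] tau_inf] := inf_adherent e2 (conj S0 (ex_intro _ 1 S1)).
  have [n hn] := exists_feasible G ct t0 e2.
  near=> N; have N0 : (n < N)%N by near: N; exact: nbhs_infty_gt.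
  have [f [ff f0 rf]] := hn N N0.
  have N1 := leq_ltn_trans (leq0n n) N0.
  have rN : ratio N <= anisoperimetric_ratio f G := optimal_ratio_le (Hsigma N N1) ff f0.
  rewrite distrC ger0_norm ?subr_ge0; last exact: inf_le.
  rewrite ltrBlDl; apply: (le_lt_trans rN); apply: (lt_le_trans rf).
  by rewrite {2}(splitr e) addrA lerD2r; exact: ltW.
have lim_inf : limn ratio = inf S by apply: cvg_lim.
by split; [exact: cvgP cvg_inf|rewrite lim_inf; exact: inf1|exact: lim_inf].
Unshelve. all: by end_near. Qed.
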